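(* Let $G=\mathrm{PH}(\boldsymbol\beta,\mathbf{\Lambda})$ be a phase-type distribution whose sub-intensity matrix $\mathbf{\Lambda}$ has only real eigenvalues, let $S\sim H$ be a scaling random variable, and let $F(x)=\int_0^\infty G(x/s)\,dH(s)$, $x\ge0$, be the corresponding phase-type scale mixture distribution. Let $\eta$ be the largest dimension among the Jordan blocks associated to the largest eigenvalue of $\mathbf{\Lambda}$, and let $$V(x)=(-1)^{\eta-1}\mathcal{L}_{1/S}^{(\eta-1)}(x),$$ where $\mathcal{L}_{1/S}^{(k)}$ is the $k$-th derivative of the Laplace--Stieltjes transform of $1/S$. If $V(\cdot)$ is a von Mises function, then $F$ belongs to the maximum domain of attraction of the Gumbel distribution. Moreover, $F$ is subexponential if $$\liminf_{x\to\infty}\frac{V(tx)\,V'(x)}{V'(tx)\,V(x)}>1,\qquad \forall\, t>1.$$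
   Context: A phase-type distribution $G=\mathrm{PH}(\boldsymbol\beta,\mathbf{\Lambda})$ is the distribution of the absorption time of a Markov jump process with finitely many transient states $\{1,\dots,p\}$ and one absorbing state $0$, where $\boldsymbol\beta$ is the $p$-dimensional row vector of initial probabilities on the transient states and the $p\times p$ sub-intensity matrix $\mathbf{\Lambda}$ is the restriction of the intensity matrix to the transient states; its distribution function is $G(x)=1-\boldsymbol\beta e^{\mathbf{\Lambda}x}\mathbf{e}$ for $x>0$, with $\mathbf{e}$ the column vector of ones. All eigenvalues of $\mathbf{\Lambda}$ have negative real part; the largest eigenvalue is denoted $-\lambda$, $\lambda>0$. A scaling random variable is a random variable $S\ge0$ whose distribution $H$ is a proper probability distribution without an atom at $0$; $F$ is the distribution of $S\cdot Y$ with $S\sim H$ and $Y\sim G$ independent. $\mathcal{L}_{1/S}(x)=\int_0^\infty e^{-x/s}\,dH(s)$, $x>0$, is the Laplace--Stieltjes transform of $1/S$, so $V(x)=\int_0^\infty s^{-(\eta-1)}e^{-x/s}\,dH(s)$. Von Mises function: a positive, twice differentiable function $V$ that decreases to $0$ at infinity (playing the role of a tail function) is a von Mises function if there is $x_0$ such that $-V''(x)<0$ for all $x>x_0$ and $$\lim_{x\to\infty}\frac{V(x)\,(-V''(x))}{(-V'(x))^2}=-1.$$ (For a twice differentiable distribution function $K$ with tail $V=\overline{K}=1-K$, this reads $K''<0$ eventually and $\overline{K}K''/(K')^2\to-1$.) $F$ is in the maximum domain of attraction of the Gumbel distribution if there are constants $c_n>0$, $d_n\in\mathbb{R}$ with $F(c_nx+d_n)^n\to\exp(-e^{-x})$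 for all $x\in\mathbb{R}$. A distribution $F$ on $[0,\infty)$ with tail $\overline F=1-F>0$ is subexponential if $\limsup_{x\to\infty}\overline{F^{*n}}(x)/\overline{F}(x)=n$ for all $n\ge2$, where $\overline{F^{*n}}$ is the tail of the $n$-fold convolution of $F$. *)

(* Defs.v *)
From HB Require Import structures.
From mathcomp Require Import all_boot all_order all_algebra complex.
From mathcomp Require Import all_classical all_reals all_analysis.
Import Order.TTheory GRing.Theory Num.Theory.
Import numFieldNormedType.Exports.

Set Implicit Arguments.
Unset Strict Implicit.
Unset Printing Implicit Defensive.

Local Open Scope ring_scope.
Local Open Scope classical_set_scope.

Section MarkovJumpProcess.
Context {R : realType}.

Definition intensity_matrix n (Q : 'M[R]_n) : Prop :=
  (forall i j, i != j -> 0 <= Q i j) /\ (forall i, \sum_j Q i j = 0).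

Definition absorbing n (Q : 'M[R]_n) (i : 'I_n) : Prop := row i Q = 0.

Definition accessible n (Q : 'M[R]_n) : rel 'I_n :=
  connect [rel i j | (i != j) && (0 < Q i j)].

(* On a finite state space, a state is transient iff it leads to some state
   from which it cannot be reached again. *)
Definition transient n (Q : 'M[R]_n) (i : 'I_n) : Prop :=
  exists j, accessible Q i j /\ ~~ accessible Q j i.

(* The state space is 'I_(1 + p): index 0 is the absorbing state and the
   indices rshift 1 i are the p transient states. *)
Definition subintensity_matrix p (L : 'M[R]_p) : Prop :=
  exists Q : 'M[R]_(1 + p),
    [/\ intensity_matrix Q, absorbing Q (lshift p ord0),
        forall i : 'I_p, transient Q (rshift 1 i)
      & L = drsubmx Q].

(* The process may also start in the absorbing state, with probability
   1 - \sum_i beta 0 i; beta = 0 is excluded, since the absorption time would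
   then be identically 0. *)
Definition initial_probabilities p (beta : 'rV[R]_p) : Prop :=
  [/\ forall i, 0 <= beta 0 i, \sum_i beta 0 i <= 1 & beta != 0].

Definition expmx p (A : 'M[R]_p) : 'M[R]_p :=
  limn (series (fun k => k`!%:R^-1 *: A ^+ k)).

Definition phase_type_cdf p (beta : 'rV[R]_p) (L : 'M[R]_p) (x : R) : R :=
  if x < 0 then 0
  else 1 - (beta *m expmx (x *: L) *m (const_mx 1 : 'cV[R]_p)) 0 0.

End MarkovJumpProcess.

Section Spectrum.
Context {R : realType}.

Definition only_real_eigenvalues p (A : 'M[R]_p) : Prop :=
  forall z : R[i], eigenvalue (map_mx (real_complex R) A) z -> complex.Im z = 0.

Definition largest_eigenvalue p (A : 'M[R]_p) (a : R) : Prop :=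
  eigenvalue A a /\ forall b, eigenvalue A b -> b <= a.

Definition jordan_block (a : R) k : 'M[R]_k :=
  \matrix_(i, j) (a *+ (i == j) + (i.+1 == j)%:R).

(* The sum of the block sizes is only propositionally equal to p, so the change
   of basis P is a rectangular matrix of full row and column rank. *)
Definition jordan_form p (A : 'M[R]_p) m (a : 'I_m -> R) (k : 'I_m -> nat) :
    Prop :=
  (forall i, (0 < k i)%N) /\
  exists P : 'M[R]_(\sum_i k i, p),
    [/\ row_free P, row_full P
      & P *m A = (\mxdiag_(i < m) jordan_block (a i) (k i)) *m P].

Definition max_jordan_dim p (A : 'M[R]_p) (a : R) (eta : nat) : Prop :=
  exists (m : nat) (ev : 'I_m -> R) (k : 'I_m -> nat),
    jordan_form A ev k /\ eta = (\max_(i < m | ev i == a) k i)%N.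

End Spectrum.

Section Mixture.
Context {R : realType}.
Implicit Type H : probability (measurableTypeR R) R.

Definition scaling_distribution H : Prop :=
  H `]-oo, 0[ = 0%E /\ H [set 0] = 0%E.

Definition scale_mixture (G : R -> R) H (x : R) : R :=
  \int[H]_(s in `]0, +oo[) G (x / s).

Definition laplace_inv H (x : R) : R :=
  \int[H]_(s in `]0, +oo[) expR (- x / s).

End Mixture.

Section Tails.
Context {R : realType}.

Definition von_mises (V : R -> R) : Prop :=
  [/\ forall x, 0 < x -> 0 < V x,
      forall x, 0 < x -> derivable V x 1 /\ derivable (derive1 V) x 1,
      forall x y, 0 < x -> x <= y -> V y <= V x,
      V x @[x --> +oo] --> 0
    & exists x0 : R, forall x, x0 < x -> - derive1n 2 V x < 0]
  /\ V x * (- derive1n 2 V x) / (- derive1 V x) ^+ 2 @[x --> +oo] --> (-1 : R).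

Definition gumbel_mda (F : R -> R) : Prop :=
  exists c d : nat -> R, (forall n, 0 < c n) /\
    forall x : R, F (c n * x + d n) ^+ n @[n --> \oo] --> expR (- expR (- x)).

(* Distribution function of the n-fold convolution of mu, a law on [0, +oo[. *)
Fixpoint conv_cdf (mu : probability (measurableTypeR R) R) (n : nat) (x : R) :
    R :=
  if n is n'.+1 then \int[mu]_(y in `[0, +oo[) conv_cdf mu n' (x - y)
  else (0 <= x)%R%:R.

Definition subexponential (F : R -> R) : Prop :=
  exists mu : probability (measurableTypeR R) R,
    [/\ forall x, mu `]-oo, x] = (F x)%:E,
        mu `]-oo, 0[ = 0%E,
        forall x, 0 < 1 - F x
      & forall n, (2 <= n)%N ->
          limf_esup (fun x => ((1 - conv_cdf mu n x) / (1 - F x))%:E) +oo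
          = n%:R%:E].

End Tails.

(* Main.v *)
Require Import Defs.
From HB Require Import structures.
From mathcomp Require Import all_boot all_order all_algebra.
From mathcomp Require Import all_classical all_reals all_analysis.
From mathcomp Require Import measurable_realfun.
From mathcomp Require Import ring lra.
Import Order.TTheory GRing.Theory Num.Theory.
Import numFieldNormedType.Exports.

Set Implicit Arguments.
Unset Strict Implicit.
Unset Printing Implicit Defensive.

Local Open Scope ring_scope.
Local Open Scope classical_set_scope.

(** Write M_k(x) for the integral of s^-k e^(-x/s) against H.  Differentiating
    under the integral sign gives M_k' = - M_(k+1), so that V = M_(eta-1), and
    q_k = M_(k+1)/M_k is the hazard rate of the tail M_k.  In these terms the
    von Mises condition on V says that q_(k+1)/q_k tends to 1 for k = eta - 1.

    This condition does not depend on k.  It passes from k+1 to k by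
    integration ([steady_pred]) and from k to k+1 by convexity of M_(k+2)
    ([steady_succ]), so that it holds for every k.  As the derivative of 1/q_k
    is q_(k+1)/q_k - 1, the scale 1/q_k then varies slowly, and
    M_k(x + u/q_k(x)) / M_k(x) tends to e^(-u) ([lmoment_gamma]).

    The Jordan form of the sub-intensity matrix, whose eigenvalues are negative
    by a maximum principle, writes the tail of G as a linear combination of
    functions y^d e^(-l y) with l > 0 ([phase_type_tail]).  Integrating against
    H turns such a function into x^d M_d(l x).  These are totally ordered by
    asymptotic domination: the smaller rate l wins, then the larger degree d
    ([mixterm_dominated]).  Hence 1 - F(x) is equivalent to C x^d M_d(k x) for
    the rate k and the degree d of the dominant term that really occurs in the
    tail of G ([mixture_dominant]).  As the von Mises condition holds for every
    index, this one included, the tail of F inherits the limit e^(-u) above, and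
    the normalizing constants d_n with 1 - F(d_n) = 1/n and
    c_n = 1/(k q_d(k d_n)) yield the Gumbel limit ([mixture_gumbel]).

    The hypothesis for subexponentiality, at t = 2, gives c q_0(2x) <= q_0(x)
    for some c > 1 and all large x.  The cumulative hazard
    Q = - ln M_0 therefore satisfies y q_0(y) <= a Q(y) with a = 2/(1+c) < 1
    ([cumhazard_halving]).  This bounds (1 - F(x-y))/(1 - F(x)), for y <= x/2,
    by a multiple of e^(theta Q(k y)) ([tail_ratio_bound]), while 1 - F(y) is
    bounded by a multiple of e^(-kappa Q(k y)) ([tail_decay]), where
    theta < kappa because a < 1.  So e^(theta Q(k y)) is F-integrable, and
    dominated convergence gives the limit 2 for the twofold convolution
    ([fold2_cvg]); induction gives n for the n-fold one ([conv_tail_cvg]). *)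

(** * Real-valued integrals and derivatives *)

Lemma bounded_integrable d (T : measurableType d) (R : realType)
    (P : probability T R) (D : set T) (f : T -> R) (C : R) :
  measurable D -> measurable_fun D f -> (forall t, D t -> `|f t| <= C) ->
  P.-integrable D (EFin \o f).
Proof.
move=> mD mf fC; apply: measurable_bounded_integrable => //.
  by rewrite (le_lt_trans (probability_le1 _ mD))// ltry.
exists C; split; first exact: num_real.
by move=> y Cy t Dt; exact: le_trans (fC t Dt) (ltW Cy).
Qed.

Section RealIntegrable.
Context d (T : measurableType d) (R : realType) (mu : {measure set T -> \bar R}).
Context (D : set T) (mD : measurable D).
Implicit Types f g : T -> R.

Lemma integrable_EFinZl r f : mu.-integrable D (EFin \o f) ->
  mu.-integrable D (EFin \o (fun t => r * f t)).
Proof. by move=> fi; exact: (integrableZl mD r fi). Qed.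

Lemma integrable_EFinD f g : mu.-integrable D (EFin \o f) ->
  mu.-integrable D (EFin \o g) ->
  mu.-integrable D (EFin \o (fun t => f t + g t)).
Proof. by move=> fi gi; exact: (integrableD mD fi gi). Qed.

Lemma integrable_EFinB f g : mu.-integrable D (EFin \o f) ->
  mu.-integrable D (EFin \o g) ->
  mu.-integrable D (EFin \o (fun t => f t - g t)).
Proof. by move=> fi gi; exact: (integrableB mD fi gi). Qed.

Lemma integrable_EFin_sum (I : Type) (r : seq I) (f : I -> T -> R) :
  (forall i, mu.-integrable D (EFin \o f i)) ->
  mu.-integrable D (EFin \o (fun t => \sum_(i <- r) f i t)).
Proof.
move=> fi; elim: r => [|i r IH].
  apply: (eq_integrable mD (fun=> 0%E)) => [t _|]; first by rewrite /= big_nil.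
  exact: integrable0.
apply: (eq_integrable mD (EFin \o (fun t => f i t + \sum_(j <- r) f j t))).
  by move=> t _; rewrite /= big_cons.
exact: integrable_EFinD.
Qed.

Lemma Rintegral_sum (I : Type) (r : seq I) (f : I -> T -> R) :
  (forall i, mu.-integrable D (EFin \o f i)) ->
  \int[mu]_(t in D) (\sum_(i <- r) f i t) =
  \sum_(i <- r) \int[mu]_(t in D) f i t.
Proof.
move=> fi; elim: r => [|i r IH].
  rewrite big_nil (eq_Rintegral _ (g := fun=> 0)); last first.
    by move=> t _; rewrite big_nil.
  by rewrite Rintegral_cst// mul0r.
rewrite big_cons -IH -RintegralD//; last exact: integrable_EFin_sum.
by apply: eq_Rintegral => t _; rewrite big_cons.
Qed.

End RealIntegrable.

(** One term of the exponential series is at most the whole series. *)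
Lemma exprn_expRN_le (R : realType) (k : nat) (y : R) :
  0 <= y -> y ^+ k * expR (- y) <= k`!%:R.
Proof.
move=> y0; rewrite expRN ler_pdivrMr ?expR_gt0//.
case: k => [|k]; first by rewrite expr0 fact0 mul1r -expR0 ler_expR.
have := expR_ge1Dxn k y0; rewrite -lerBrDl => h.
rewrite mulrC -ler_pdivrMr ?ltr0n ?fact_gt0//.
by rewrite (le_trans h)// lerBlDl lerDr.
Qed.

Lemma dominated_cvg_Rintegral d (T : measurableType d) (R : realType)
    (mu : {measure set T -> \bar R}) (D : set T) (f_ : nat -> T -> R) (f g : T -> R) :
  measurable D -> (forall n, measurable_fun D (f_ n)) ->
  measurable_fun D f -> mu.-integrable D (EFin \o g) ->
  (forall n t, D t -> `|f_ n t| <= g t) ->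
  (forall t, D t -> f_ n t @[n --> \oo] --> f t) ->
  \int[mu]_(t in D) f_ n t @[n --> \oo] --> \int[mu]_(t in D) f t.
Proof.
move=> mD mf_ mf ig fg cf.
have fg' t : D t -> `|f t| <= g t.
  move=> Dt; have cn : `|f_ n t| @[n --> \oo] --> `|f t|.
    by apply: cvg_norm; exact: cf.
  rewrite -(cvg_lim _ cn)//; apply: limr_le; first by apply/cvg_ex; eexists; exact: cn.
  by apply: nearW => n; exact: fg.
have fi : mu.-integrable D (EFin \o f).
  apply: le_integrable ig => //; first exact/measurable_realfun.measurable_EFinP.
  by move=> t Dt /=; rewrite lee_fin (le_trans (fg' t Dt))// ler_norm.
apply: (@fine_cvg _ _ \oo _ (fun n => \int[mu]_(t in D) (f_ n t)%:E)%E).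
rewrite fineK; last exact: integrable_fin_num.
apply: (@dominated_cvg _ _ _ mu D mD (fun n t => (f_ n t)%:E) (fun t => (f t)%:E)
  (EFin \o g)) => //.
- by move=> n; exact/measurable_realfun.measurable_EFinP.
- by move=> t Dt; apply: cvg_EFin; [exact: nearW|exact: cf].
Qed.

Lemma bounded_cvg_Rintegral d (T : measurableType d) (R : realType)
    (P : probability T R) (D : set T) (f_ : nat -> T -> R) (f : T -> R) (C : R) :
  measurable D -> (forall n, measurable_fun D (f_ n)) -> measurable_fun D f ->
  (forall n t, D t -> `|f_ n t| <= C) ->
  (forall t, D t -> f_ n t @[n --> \oo] --> f t) ->
  \int[P]_(t in D) f_ n t @[n --> \oo] --> \int[P]_(t in D) f t.
Proof.
move=> mD mf_ mf; apply: dominated_cvg_Rintegral => //.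
exact: finite_measure_integrable_cst.
Qed.

(** A quadratic bound on the error makes the estimate of the difference quotient
    elementary, with no exchange of limits. *)
Lemma is_derive_quadratic (R : realType) (f : R -> R) (x a C e : R) : 0 < e ->
  (forall h, `|h| < e -> `|f (x + h) - f x - h * a| <= h ^+ 2 * C) ->
  is_derive x 1 f a.
Proof.
move=> e0 fC.
have L : h^-1 *: ((f \o shift x) (h *: (1 : R)) - f x) @[h --> 0^'] --> a.
  apply/cvgrPdist_le => eps eps0.
  near=> h.
  have h0 : h != 0 by near: h; exact: nbhs_dnbhs_neq.
  have he : `|h| < e.
    by near: h; apply: dnbhs0_lt.
  have := fC _ he; rewrite /= /GRing.scale /= mulr1 [h + x]addrC => hC.
  rewrite distrC.
  have -> : h^-1 * (f (x + h) - f x) - a = h^-1 * (f (x + h) - f x - h * a).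
    by field.
  rewrite normrM normfV -ler_pdivlMl ?invr_gt0 ?normr_gt0// invrK.
  apply: le_trans hC _.
  rewrite -real_normK ?num_real// expr2 -mulrA ler_wpM2l//.
  apply: (@le_trans _ _ (`|h| * (`|C| + 1))).
    by rewrite ler_wpM2l// (le_trans (ler_norm _))// lerDl.
  rewrite -ler_pdivlMr ?ltr_wpDl//.
  by near: h; apply: dnbhs0_le; rewrite divr_gt0// ltr_wpDl.
split; first by apply/cvg_ex; exists a; exact: L.
exact/cvg_lim.
Unshelve. all: by end_near. Qed.

(** Here f' = - g and g' = - c with f and g convex.  The tangents to f at both
    ends bound f1 - f0 from both sides, up to h (g0 - g1), and those to g bound
    this in turn by h^2 C. *)
Lemma taylor_sandwich (R : realFieldType) (h f0 f1 g0 g1 c0 c1 C : R) :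
  f0 - h * g0 <= f1 -> f1 - - h * g1 <= f0 ->
  g0 - h * c0 <= g1 -> g1 - - h * c1 <= g0 -> c0 <= C -> c1 <= C ->
  `|f1 - f0 - h * - g0| <= h ^+ 2 * C.
Proof.
move=> lo up g01 g10 c0C c1C; rewrite ger0_norm; last by lra.
have [h0|/ltW h0] := leP 0 h; first by nra.
by nra.
Qed.

(** * Moments of the Laplace transform *)

Section LaplaceMoments.
Context {R : realType} (H : probability (measurableTypeR R) R).
Hypothesis H1 : H `]0, +oo[ = 1%E.

Local Notation D := (`]0, +oo[%classic : set (measurableTypeR R)).

Lemma pos_itvP (s : R) : D s -> 0 < s.
Proof. by rewrite /= in_itv/= andbT. Qed.

(** Up to the sign (-1)^k, the k-th derivative of the Laplace transform of 1/S. *)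
Definition lmoment (k : nat) (x : R) : R :=
  \int[H]_(s in `]0, +oo[) (s^-1 ^+ k * expR (- (x / s))).

Local Notation M := lmoment.
Implicit Types (k : nat) (x y : R).

Lemma continuous_divr (x s : R) : 0 < s -> {for s, continuous (fun t : R => x / t)}.
Proof.
move=> s0; apply: cvgM; first exact: cvg_cst.
by apply: cvgV => //; rewrite gt_eqF.
Qed.

Lemma measurable_moment k x :
  measurable_fun D (fun s : R => s^-1 ^+ k * expR (- (x / s))).
Proof.
apply: measurable_realfun.measurable_funM.
  apply: measurable_realfun.measurable_funX.
  apply: measurable_realfun.open_continuous_measurable_fun => // s.
  by rewrite inE => /pos_itvP s0; apply: inv_continuous; rewrite gt_eqF.
apply: measurable_realfun.open_continuous_measurable_fun => // s.
rewrite inE => /pos_itvP s0.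
apply: (@continuous_comp _ _ _ (fun s : R => - (x / s)) (@expR R) s).
  exact/continuousN/continuous_divr.
exact: continuous_expR.
Qed.

Lemma integrable_moment k x : 0 < x ->
  H.-integrable D (EFin \o (fun s : R => s^-1 ^+ k * expR (- (x / s)))).
Proof.
move=> x0; apply: (@bounded_integrable _ _ _ _ _ _ (k`!%:R / x ^+ k)) => //.
  exact: measurable_moment.
move=> s /pos_itvP s0; rewrite ger0_norm; last first.
  by rewrite mulr_ge0 ?expR_ge0// exprn_ge0// invr_ge0 ltW.
rewrite ler_pdivlMr ?exprn_gt0// mulrAC -exprMn [_^-1 * _]mulrC.
by apply: exprn_expRN_le; rewrite divr_ge0// ltW.
Qed.

Ltac integ := do ?[apply: integrable_EFinB => //|apply: integrable_EFinD => //
  |apply: integrable_EFinZl => //|exact: integrable_moment].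

Lemma lmoment_gt0 k x : 0 < x -> 0 < M k x.
Proof.
move=> x0; pose f (s : R) : R := s^-1 ^+ k * expR (- (x / s)).
have fgt0 s : D s -> 0 < f s.
  by move=> /pos_itvP s0; rewrite mulr_gt0 ?expR_gt0// exprn_gt0// invr_gt0.
have fge0 s : D s -> 0 <= f s by move=> /fgt0/ltW.
rewrite lt_neqAle eq_sym Rintegral_ge0// andbT; apply/eqP => M0.
have mf := measurable_moment k x.
move/measurable_realfun.measurable_EFinP in mf.
have [//|+ _] := @ae_eq_integral_abs _ _ _ H D _ _ mf.
have -> : (\int[H]_(s in D) `|(EFin \o f) s| = 0)%E.
  have fin : (\int[H]_(s in D) (f s)%:E)%E \is a fin_num.
    by apply: integrable_fin_num => //; exact: integrable_moment.
  move/fineK in fin.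
  transitivity (\int[H]_(s in D) (f s)%:E)%E.
    apply: eq_integral => s; rewrite inE => Ds; rewrite /= ger0_norm//.
    exact: fge0.
  by rewrite -fin; congr (_%:E); exact: M0.
move=> /(_ erefl) [N [mN N0 sub]].
have DN : D `<=` N.
  move=> s Ds; apply: sub => /= /(_ Ds) /eqP; rewrite eqe gt_eqF//.
  exact: fgt0.
have : (H D <= H N)%E by apply: le_measure => //; rewrite inE.
by rewrite H1 N0 leNgt lte01.
Qed.

(** The hazard rate - M_k'/M_k of M_k seen as a tail. *)
Definition hazard k x := M k.+1 x / M k x.
Local Notation q := hazard.

Lemma hazard_gt0 k x : 0 < x -> 0 < q k x.
Proof. by move=> x0; rewrite divr_gt0// lmoment_gt0. Qed.

Lemma lmomentS k x : 0 < x -> M k.+1 x = q k x * M k x.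
Proof. by move=> x0; rewrite divfK// gt_eqF// lmoment_gt0. Qed.

(** The logarithm of M_k is convex, as M_k is a mixture of exponentials, so that
    M_k lies above the exponential tangent to it at x.  Proof: Jensen's
    inequality for the law with density proportional to s^-k e^(-x/s). *)
Lemma lmoment_tangent k x y : 0 < x -> 0 < y ->
  M k x * expR (- (q k x * (y - x))) <= M k y.
Proof.
move=> x0 y0; set h := y - x; set c := q k x.
have -> : M k x * expR (- (c * h)) =
    \int[H]_(s in D) (expR (- (c * h)) *
      ((1 + c * h) * (s^-1 ^+ k * expR (- (x / s))) -
       h * (s^-1 ^+ k.+1 * expR (- (x / s))))).
  rewrite RintegralZl//; last by integ.
  rewrite RintegralB//; [|by integ|by integ].
  rewrite RintegralZl//; last exact: integrable_moment.
  rewrite RintegralZl//; last exact: integrable_moment.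
  rewrite -/(M k x) -/(M k.+1 x) lmomentS// -/c; ring.
apply: le_Rintegral => //; last 1 first.
- move=> s /pos_itvP s0.
  have -> : - (y / s) = - (c * h) + (- (x / s)) + (c * h - h / s).
    by rewrite /h; field; rewrite gt_eqF.
  rewrite 2!expRD; set E := expR (- (c * h)); set G := expR (- (x / s)).
  have -> : E * ((1 + c * h) * (s^-1 ^+ k * G) - h * (s^-1 ^+ k.+1 * G)) =
    s^-1 ^+ k * (E * G * (1 + (c * h - h / s))) by rewrite exprS; ring.
  apply: ler_wpM2l; first by rewrite exprn_ge0// invr_ge0 ltW.
  apply: ler_wpM2l; first by rewrite mulr_ge0// expR_ge0.
  exact: expR_ge1Dx.
- by integ.
- exact: integrable_moment.
Qed.

(** The variance of 1/s under the law with density proportional to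
    s^-k e^(-x/s) is nonnegative. *)
Lemma hazard_leS k x : 0 < x -> q k x <= q k.+1 x.
Proof.
move=> x0; set c := q k x.
have Mk := lmoment_gt0 k x0; have Mk1 := lmoment_gt0 k.+1 x0.
suff : 0 <= M k.+2 x - c *+ 2 * M k.+1 x + c ^+ 2 * M k x.
  have E : c * M k x = M k.+1 x by rewrite lmomentS.
  rewrite /(q k.+1 x) ler_pdivlMr// expr2 -mulrA E; lra.
have -> : M k.+2 x - c *+ 2 * M k.+1 x + c ^+ 2 * M k x =
    \int[H]_(s in D) (((s^-1 ^+ k.+2 * expR (- (x / s))) -
      c *+ 2 * (s^-1 ^+ k.+1 * expR (- (x / s)))) +
      c ^+ 2 * (s^-1 ^+ k * expR (- (x / s)))).
  rewrite RintegralD//; [|by integ|by integ].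
  rewrite RintegralB//; [|exact: integrable_moment|by integ].
  rewrite RintegralZl//; last exact: integrable_moment.
  by rewrite RintegralZl//; last exact: integrable_moment.
apply: Rintegral_ge0 => s /pos_itvP s0.
set G := expR _.
have -> : s^-1 ^+ k.+2 * G - c *+ 2 * (s^-1 ^+ k.+1 * G) +
  c ^+ 2 * (s^-1 ^+ k * G) = s^-1 ^+ k * G * (s^-1 - c) ^+ 2.
  by rewrite !exprS; ring.
by rewrite mulr_ge0 ?sqr_ge0// mulr_ge0 ?expR_ge0// exprn_ge0// invr_ge0 ltW.
Qed.

Lemma lmoment_nonincreasing k x y : 0 < x -> x <= y -> M k y <= M k x.
Proof.
move=> x0 xy; apply: le_Rintegral => //.
- by apply: integrable_moment; exact: lt_le_trans xy.
- exact: integrable_moment.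
- move=> s /pos_itvP s0; apply: ler_wpM2l; first by rewrite exprn_ge0// invr_ge0 ltW.
  by rewrite ler_expR lerN2 ler_pM2r// invr_gt0.
Qed.

Lemma lmoment_tangentV k x y : 0 < x -> 0 < y ->
  M k y <= M k x * expR (q k y * (x - y)).
Proof.
move=> x0 y0; have := lmoment_tangent k y0 x0.
by rewrite expRN ler_pdivrMr ?expR_gt0.
Qed.

(** The slopes of the convex function ln M_k increase; compare its tangents at
    both points. *)
Lemma hazard_nonincreasing k x y : 0 < x -> x <= y -> q k y <= q k x.
Proof.
move=> x0; rewrite le_eqVlt => /predU1P[->//|xy].
have y0 : 0 < y by exact: lt_trans xy.
have := le_trans (lmoment_tangent k x0 y0) (lmoment_tangentV k x0 y0).
rewrite ler_pM2l ?lmoment_gt0// ler_expR.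
have xy0 : 0 < y - x by rewrite subr_gt0.
by rewrite -[x - y]opprB mulrN lerN2 ler_pM2r.
Qed.

Lemma lmoment_line k x y : 0 < x -> 0 < y ->
  M k x - (y - x) * M k.+1 x <= M k y.
Proof.
move=> x0 y0; apply: le_trans (lmoment_tangent k x0 y0).
have -> : M k x - (y - x) * M k.+1 x = M k x * (1 + - (q k x * (y - x))).
  by rewrite lmomentS//; ring.
by rewrite ler_pM2l ?lmoment_gt0// expR_ge1Dx.
Qed.

(** Both M_k and M_(k+1) are convex with slopes given by the next moment, which
    is bounded near x by M_(k+2)(x/2). *)
Lemma is_derive_lmoment k x : 0 < x -> is_derive x 1 (M k) (- M k.+1 x).
Proof.
move=> x0; apply: (@is_derive_quadratic _ _ _ _ (M k.+2 (x / 2)) (x / 2)).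
  by rewrite divr_gt0.
move=> h; rewrite ltr_norml => /andP[h1 h2].
have xh0 : 0 < x + h by lra.
have hx1 : x / 2 <= x by lra.
have hx2 : x / 2 <= x + h by lra.
have hx3 : 0 < x / 2 by lra.
have eh : x + h - x = h by ring.
have eh' : x - (x + h) = - h by ring.
have lo := lmoment_line k x0 xh0.
have up := lmoment_line k xh0 x0.
have M1x := lmoment_line k.+1 x0 xh0.
have M1xh := lmoment_line k.+1 xh0 x0.
rewrite eh in lo M1x; rewrite eh' in up M1xh.
apply: taylor_sandwich lo up M1x M1xh _ _; exact: lmoment_nonincreasing.
Qed.

Lemma continuous_lmoment k x : 0 < x -> {for x, continuous (M k)}.
Proof.
move=> x0; apply/differentiable_continuous/derivable1_diffP.
by have [] := is_derive_lmoment k x0.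
Qed.

Lemma continuous_hazard k x : 0 < x -> {for x, continuous (q k)}.
Proof.
move=> x0; apply: cvgM; first exact: continuous_lmoment.
apply: cvgV; last exact: continuous_lmoment.
by rewrite gt_eqF// lmoment_gt0.
Qed.

Lemma lmoment_cvg0 k : M k x @[x --> +oo] --> 0.
Proof.
(* Truncating the sequence at 1 keeps the integrands bounded from its start. *)
apply/cvg_pinftyP => u uoo.
pose v n := Order.max (u n) 1.
have vu : \forall n \near \oo, v n = u n.
  move/cvgryPge : uoo => /(_ 1); apply: filterS => n; rewrite /v.
  exact: max_l.
apply: cvg_trans (_ : M k (v n) @[n --> \oo] --> 0).
  apply: near_eq_cvg; apply: filterS vu => n ->.
  by [].
have voo : v n @[n --> \oo] --> +oo.
  by apply: cvg_trans uoo; apply: near_eq_cvg; apply: filterS vu => n ->.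
have v1 n : 1 <= v n by rewrite /v le_max lexx orbT.
have -> : 0 = \int[H]_(s in D) (0 : R) by rewrite Rintegral_cst// mul0r.
apply: (@bounded_cvg_Rintegral _ _ _ _ _ _ _ (k`!%:R)) => //.
- by move=> n; exact: measurable_moment.
- move=> n s /pos_itvP s0; have v0 := lt_le_trans ltr01 (v1 n).
  rewrite ger0_norm; last first.
    by rewrite mulr_ge0 ?expR_ge0// exprn_ge0// invr_ge0 ltW.
  apply: le_trans (@exprn_expRN_le R k (v n / s) _); last first.
    by rewrite divr_ge0// ltW.
  apply: ler_wpM2r; first exact: expR_ge0.
  rewrite lerXn2r ?nnegrE ?invr_ge0 ?divr_ge0 ?(ltW s0) ?(ltW v0)//.
  by rewrite ler_peMl// invr_ge0 ltW.
- move=> s /pos_itvP s0.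
  rewrite -[X in _ --> X](mulr0 (s^-1 ^+ k)); apply: cvgMr.
  apply: (@cvg_comp _ _ _ (fun n => v n / s) (fun y : R => expR (- y)) _ (+oo)).
    by apply: (cvg_comp _ _ voo (gt0_cvgMly _ (@cvg_id _ _))); rewrite invr_gt0.
  exact: cvgr_expR.
Qed.

(** The von Mises ratio q_(k+1)/q_k is thus 1 plus the slope of the scale 1/q_k. *)
Lemma is_derive_hazardV k x : 0 < x ->
  is_derive x 1 (fun y : R => (q k y)^-1) (q k.+1 x / q k x - 1).
Proof.
move=> x0.
have Mk0 := lmoment_gt0 k x0; have Mk1 := lmoment_gt0 k.+1 x0.
have d1 := is_derive_lmoment k x0; have d2 := is_derive_lmoment k.+1 x0.
have d3 := is_deriveV (lt0r_neq0 Mk1) d2.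
have -> : (fun y => (q k y)^-1) = (M k * (fun y => (M k.+1 y)^-1)).
  by apply/funext => y; rewrite invf_div.
apply: (is_derive_eq (is_deriveM d1 d3)).
rewrite /q /hazard /GRing.scale /=; field.
by rewrite !gt_eqF.
Qed.

Lemma lmoment0_le1 x : 0 < x -> M 0 x <= 1.
Proof.
move=> x0; have e1 : \int[H]_(s in D) (1 : R) = 1.
  by rewrite Rintegral_cst//= H1 mul1r.
rewrite -e1.
apply: le_Rintegral => //.
- exact: integrable_moment.
- exact: finite_measure_integrable_cst.
- move=> s /pos_itvP s0; rewrite expr0 mul1r -expR0 ler_expR oppr_le0.
  by rewrite divr_ge0// ltW.
Qed.

Lemma lmoment_laplace : laplace_inv H = M 0.
Proof.
apply/funext => x; apply: eq_Rintegral => s _.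
by rewrite expr0 mul1r mulNr.
Qed.

End LaplaceMoments.

(** * The von Mises condition propagates to all moments *)

Section Steady.
Context {R : realType} (H : probability (measurableTypeR R) R).
Hypothesis H1 : H `]0, +oo[ = 1%E.
Implicit Types (k d : nat) (x y e l u : R).

Local Notation M := (lmoment H).
Local Notation q := (hazard H).

(** The von Mises condition for M_k, as q_(k+1)/q_k = M_k M_k'' / M_k'^2. *)
Definition steady k : Prop := q k.+1 x / q k x @[x --> +oo] --> (1 : R).

Lemma steady_le k e : steady k -> 0 < e ->
  \forall x \near +oo, q k.+1 x / q k x <= 1 + e.
Proof. by move=> sk e0; apply: (cvgr_le 1 sk); rewrite ltrDl. Qed.

Lemma hazard_ratio_ge1 k x : 0 < x -> 1 <= q k.+1 x / q k x.
Proof. by move=> x0; rewrite ler_pdivlMr ?hazard_gt0// mul1r hazard_leS. Qed.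

Lemma steadyP k :
  (forall e, 0 < e -> \forall x \near +oo, q k.+1 x / q k x <= 1 + e) ->
  steady k.
Proof.
move=> sk; apply/cvgrPdist_le => e e0; near=> x.
have x0 : 0 < x by near: x; exact: nbhs_pinfty_gt.
have h1 := hazard_ratio_ge1 k x0.
have h2 : q k.+1 x / q k x <= 1 + e by near: x; exact: sk.
by rewrite distrC ger0_norm ?subr_ge0// lerBlDl.
Unshelve. all: by end_near. Qed.

(** By [is_derive_hazardV] the slope of 1/q_k tends to 0. *)
Lemma steady_lipschitz k e : steady k -> 0 < e ->
  exists2 A, 0 < A & forall x y, A <= x -> A <= y ->
    `|(q k y)^-1 - (q k x)^-1| <= e * `|y - x|.
Proof.
move=> sk e0; have /pinfty_ex_gt0[A A0 hA] : \forall A \near +oo,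
  forall x, A <= x -> q k.+1 x / q k x <= 1 + e.
  have [A [_ hA]] := steady_le sk e0.
  exists A; split; first exact: num_real.
  by move=> B AB x Bx; apply: hA; exact: lt_le_trans Bx.
exists A => // x y Ax Ay.
wlog xy : x y Ax Ay / x <= y => [hw|].
  have [xy|/ltW yx] := leP x y; first exact: hw.
  by rewrite distrC [in leRHS]distrC hw.
have x0 := lt_le_trans A0 Ax.
have [c + E] : exists2 c, c \in `[x, y]%R & (q k y)^-1 - (q k x)^-1 =
    (q k.+1 c / q k c - 1) * (y - x).
  apply: (@MVT_segment R (fun y => (q k y)^-1)
    (fun c => q k.+1 c / q k c - 1)) => //.
    move=> c; rewrite in_itv/= => /andP[xc _].
    by apply: is_derive_hazardV => //; exact: lt_trans xc.
  apply: continuous_in_subspaceT => c; rewrite inE/= in_itv/= => /andP[xc _].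
  have c0 := lt_le_trans x0 xc.
  apply: cvgV; first by rewrite gt_eqF// hazard_gt0.
  exact: continuous_hazard.
rewrite in_itv/= => /andP[xc cy].
have c0 := lt_le_trans x0 xc.
have h1 := hazard_ratio_ge1 k c0.
have h2 := hA c (le_trans Ax xc).
rewrite E normrM ler_wpM2r// ger0_norm ?subr_ge0//.
by rewrite lerBlDl.
Qed.

Lemma steady_hazard_large k e : steady k -> 0 < e ->
  \forall x \near +oo, (q k x)^-1 <= e * x.
Proof.
move=> sk e0; have e20 : 0 < e / 2 by rewrite divr_gt0.
have [A A0 hA] := steady_lipschitz sk e20.
near=> x.
have Ax : A <= x by near: x; apply: nbhs_pinfty_ge; exact: num_real.
have := hA A x (lexx A) Ax.
rewrite (ger0_norm (_ : 0 <= x - A)) ?subr_ge0//.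
move=> /(le_trans (ler_norm _)).
have fx : (q k A)^-1 / (e / 2) <= x.
  by near: x; apply: nbhs_pinfty_ge; exact: num_real.
rewrite ler_pdivrMr// in fx; nra.
Unshelve. all: by end_near. Qed.

(** L'Hospital's rule for M_k against M_(k+1)/q_(k+1), in monotone form: the
    difference D below has eventually nonnegative derivative and is eventually
    below any positive number, so it is nonpositive, which says
    q_(k+1) <= (1 + e) q_k. *)
Lemma steady_pred k : steady k.+1 -> steady k.
Proof.
move=> sk; apply: steadyP => e e0.
have ee0 : 0 < e / (1 + e) by rewrite divr_gt0// addr_gt0.
(* The derivative of M_(k+1)/q_(k+1) is (q_(k+2)/q_(k+1) - 2) M_(k+1). *)
pose D x := M k x - (1 + e) * ((q k.+1 x)^-1 * M k.+1 x).
pose D' x := M k.+1 x * ((1 + e) * (2 - q k.+2 x / q k.+1 x) - 1).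
have dD x : 0 < x -> is_derive x 1 D (D' x).
  move=> x0.
  have dM := is_derive_lmoment H1 k x0; have dM1 := is_derive_lmoment H1 k.+1 x0.
  have dq := is_derive_hazardV H1 k.+1 x0.
  have dp := is_deriveM dq dM1.
  have dz := is_deriveZ (1 + e) dp.
  have -> : D = M k - (1 + e) \*: ((fun y : R => (q k.+1 y)^-1) * M k.+1) by [].
  apply: (is_derive_eq (is_deriveB dM dz)).
  have E : M k.+2 x = q k.+1 x * M k.+1 x by rewrite lmomentS.
  rewrite /D' /GRing.scale /= E; field.
  by rewrite gt_eqF// hazard_gt0.
have [A A0 hA] : exists2 A, 0 < A & forall x, A <= x -> 0 <= D' x.
  have [A [_ hA]] := steady_le sk ee0.
  exists (Order.max A 0 + 1); first by rewrite ltr_wpDl// le_max lexx orbT.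
  move=> x Ax.
  have {}hA : q k.+2 x / q k.+1 x <= 1 + e / (1 + e).
    by apply: hA; apply: lt_le_trans Ax; rewrite ltr_pwDr// le_max lexx.
  have x0 : 0 < x by apply: lt_le_trans Ax; rewrite ltr_wpDl// le_max lexx orbT.
  rewrite mulr_ge0 ?(ltW (lmoment_gt0 H1 _ x0))// subr_ge0.
  rewrite [leLHS](_ : 1 = (1 + e) * (2 - (1 + e / (1 + e)))); last first.
    by field; rewrite gt_eqF// addr_gt0.
  by rewrite ler_pM2l ?addr_gt0// lerB.
have Dmono x y : A <= x -> x <= y -> D x <= D y.
  move=> Ax xy; have x0 := lt_le_trans A0 Ax.
  have [c + E] : exists2 c, c \in `[x, y]%R & D y - D x = D' c * (y - x).
    apply: MVT_segment => //.
      move=> c; rewrite in_itv/= => /andP[xc _].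
      by apply: dD => //; exact: lt_trans xc.
    apply: continuous_in_subspaceT => c; rewrite inE/= in_itv/= => /andP[xc _].
    have c0 := lt_le_trans x0 xc.
    apply/differentiable_continuous/derivable1_diffP.
    by have [] := dD _ c0.
  rewrite in_itv/= => /andP[xc cy].
  rewrite -subr_ge0 E mulr_ge0 ?subr_ge0//.
  by apply: hA; exact: le_trans xc.
have Dneg x : A <= x -> D x <= 0.
  move=> Ax; rewrite leNgt; apply/negP => Dx.
  have [B [_ hB]] := cvgr_lt 0 (lmoment_cvg0 H k) _ Dx.
  pose y := Order.max x (B + 1).
  have xy : x <= y by rewrite le_max lexx.
  have yB : B < y by rewrite lt_max ltrDl ltr01 orbT.
  have y0 : 0 < y by apply: lt_le_trans xy; exact: lt_le_trans Ax.
  have := Dmono _ _ Ax xy; apply/negP; rewrite -ltNge.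
  apply: le_lt_trans (hB y yB).
  rewrite /D gerBl mulr_ge0 ?addr_ge0 ?(ltW e0)//.
  by rewrite mulr_ge0 ?invr_ge0 ?(ltW (hazard_gt0 H1 _ y0))// ltW// lmoment_gt0.
near=> x.
have Ax : A <= x by near: x; apply: nbhs_pinfty_ge; exact: num_real.
have x0 := lt_le_trans A0 Ax.
have := Dneg x Ax; rewrite /D lmomentS// subr_le0.
have Mx := lmoment_gt0 H1 k x0; have q1 := hazard_gt0 H1 k.+1 x0.
have q0 := hazard_gt0 H1 k x0.
have -> : (1 + e) * ((q k.+1 x)^-1 * (q k x * M k x)) =
  ((1 + e) * ((q k.+1 x)^-1 * q k x)) * M k x by ring.
rewrite -[X in X <= _]mul1r ler_pM2r// => h.
rewrite ler_pdivrMr// -(ler_pM2l (_ : 0 < (q k.+1 x)^-1)) ?invr_gt0//.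
by rewrite mulVf ?gt_eqF// mulrCA.
Unshelve. all: by end_near. Qed.

(** The growth of M_(k+2) over a backward step of length d/q_k, when 1/q_k has
    slope at most e = d^2: to first order in d it is 1 + d. *)
Lemma exp_quotient_le (e d : R) : 0 < d -> d <= 1 / 4 -> e = d ^+ 2 ->
  expR (d / (1 - e * d)) * ((1 + e) / (1 - e * d) ^+ 2) <= 1 + d * (1 + 10 * d).
Proof.
move=> d0 d4 eE; have c3 : 0 < 1 - e * d by rewrite eE; nra.
have c2 : 0 < 1 - e * d - d by rewrite eE; nra.
have -> : d / (1 - e * d) = - (- d / (1 - e * d)) by rewrite mulNr opprK.
rewrite expRN -[X in _ * X]invf_div -invfM.
have E : 0 < (1 - e * d) ^+ 2 / (1 + e) by rewrite divr_gt0 ?exprn_gt0// eE; nra.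
have h : 1 - d / (1 - e * d) <= expR (- d / (1 - e * d)).
  by rewrite mulNr expR_ge1Dx.
apply: (@le_trans _ _ ((1 - d / (1 - e * d)) * ((1 - e * d) ^+ 2 / (1 + e)))^-1).
  rewrite lef_pV2 ?posrE ?ler_pM2r// mulr_gt0 ?expR_gt0//.
  by rewrite subr_gt0 ltr_pdivrMr// mul1r -subr_gt0.
have -> : ((1 - d / (1 - e * d)) * ((1 - e * d) ^+ 2 / (1 + e)))^-1 =
   (1 + e) / ((1 - e * d - d) * (1 - e * d)).
  field; rewrite !gt_eqF//; first by rewrite eE; nra.
rewrite ler_pdivrMr ?mulr_gt0// eE.
have d2 : 0 <= d ^+ 2 by exact: sqr_ge0.
have d3 : d ^+ 3 <= d ^+ 2 / 4 by rewrite exprSr; nra.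
have d40 : 0 <= d ^+ 4 by rewrite exprn_ge0// ltW.
have d30 : 0 <= d ^+ 3 by rewrite exprn_ge0// ltW.
have d4' : d ^+ 4 <= d ^+ 3 / 4 by rewrite exprSr; nra.
have d5 : d ^+ 5 <= d ^+ 4 / 4 by rewrite exprSr; nra.
have d50 : 0 <= d ^+ 5 by rewrite exprn_ge0// ltW.
have d70 : 0 <= d ^+ 6 by rewrite exprn_ge0// ltW.
have d80 : 0 <= d ^+ 7 by rewrite exprn_ge0// ltW.
have d90 : 0 <= d ^+ 8 by rewrite exprn_ge0// ltW.
have -> : (1 + d * (1 + 10 * d)) * ((1 - d ^+ 2 * d - d) * (1 - d ^+ 2 * d)) =
  1 + 9 * d ^+ 2 - 12 * d ^+ 3 - d ^+ 4 - 19 * d ^+ 5 + 11 * d ^+ 6 + d ^+ 7 +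
  10 * d ^+ 8
  by ring.
lra.
Qed.

(** By convexity of M_(k+2), its slope at x is at most its growth over a backward
    step of length h = d/q_k(x) divided by h.  On such a step q_k is almost
    constant, M_(k+2) = q_(k+1) q_k M_k is at most (1 + d + O(d^2)) times its
    value at x, and so q_(k+2) h <= d (1 + O(d)). *)
Lemma steady_succ k : steady k -> steady k.+1.
Proof.
move=> sk; apply: steadyP => eps eps0.
(* A step of d scales, on which q_k may vary by slope e = d^2, costs 10 d. *)
pose d := Order.min (1 / 4) (eps / 10).
have d0 : 0 < d by rewrite lt_min !divr_gt0.
have d4 : d <= 1 / 4 by rewrite ge_min lexx.
have deps : 10 * d <= eps.
  by rewrite -ler_pdivlMl// [_^-1 * _]mulrC ge_min lexx orbT.
pose e := d ^+ 2.
have e0 : 0 < e by rewrite exprn_gt0.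
have ed1 : 0 < 1 - e * d by rewrite /e; nra.
have [A A0 lip] := steady_lipschitz sk e0.
have [B [_ hB]] := steady_le sk e0.
near=> x.
have x0 : 0 < x by near: x; exact: nbhs_pinfty_gt.
have xA : A <= x by near: x; apply: nbhs_pinfty_ge; exact: num_real.
have xB : B < x by near: x; apply: nbhs_pinfty_gt; exact: num_real.
pose f := (q k x)^-1; pose h := d * f.
have qx := hazard_gt0 H1 k x0.
have f0 : 0 < f by rewrite invr_gt0.
have h0 : 0 < h by rewrite mulr_gt0.
have hx : h <= x / 2.
  have : f <= 2 * x.
    by rewrite /f; near: x; apply: steady_hazard_large.
  rewrite /h; nra.
pose y := x - h.
have yx : x / 2 <= y by rewrite /y; lra.
have y0 : 0 < y by apply: lt_le_trans yx; rewrite divr_gt0.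
have yA : A <= y.
  have : 2 * A <= x by near: x; apply: nbhs_pinfty_ge; exact: num_real.
  by move=> ?; apply: le_trans yx; rewrite ler_pdivlMr// mulrC.
have yB : B < y.
  have : 2 * B < x by near: x; apply: nbhs_pinfty_gt; exact: num_real.
  by move=> ?; apply: lt_le_trans yx; rewrite ltr_pdivlMr// mulrC.
have qy := hazard_gt0 H1 k y0.
have yxh : x - y = h by rewrite /y; ring.
have fy : f * (1 - e * d) <= (q k y)^-1.
  have := lip y x yA xA; rewrite yxh (gtr0_norm h0) -/f.
  move/(le_trans (ler_norm _)); rewrite /h => L.
  have -> : f * (1 - e * d) = f - e * (d * f) by ring.
  by rewrite lerBlDr addrC -lerBlDr.
have qyx : q k y <= q k x / (1 - e * d).
  rewrite -[q k y]invrK -[q k x]invrK -/f -invfM lef_pV2 ?posrE ?invr_gt0//.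
  by rewrite mulr_gt0.
have q1y : q k.+1 y <= (1 + e) * q k y by rewrite -ler_pdivrMr// hB.
have Mxy : M k y <= M k x * expR (d / (1 - e * d)).
  apply: le_trans (lmoment_tangentV H1 k x0 y0) _.
  rewrite ler_pM2l ?lmoment_gt0// ler_expR yxh.
  apply: le_trans (ler_wpM2r (ltW h0) qyx) _.
  by rewrite /h /f mulrAC mulrCA mulfV ?gt_eqF// mulr1.
have Mx0 := ltW (lmoment_gt0 H1 k x0).
have M2 : M k.+2 y <= M k.+2 x * (1 + d * (1 + 10 * d)).
  rewrite lmomentS// lmomentS// [M k.+2 x]lmomentS// [M k.+1 x]lmomentS//.
  apply: (@le_trans _ _ (((1 + e) * (q k x / (1 - e * d))) *
     ((q k x / (1 - e * d)) * (M k x * expR (d / (1 - e * d)))))).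
    apply: ler_pM.
    - exact/ltW/hazard_gt0.
    - by rewrite mulr_ge0// ltW// ?lmoment_gt0.
    - by apply: le_trans q1y _; rewrite ler_pM2l// addr_gt0.
    - apply: ler_pM; [exact/ltW| |by []|by []].
      by rewrite ltW// lmoment_gt0.
  apply: (@le_trans _ _ ((q k x * (q k x * M k x)) *
     (expR (d / (1 - e * d)) * ((1 + e) / (1 - e * d) ^+ 2)))).
    rewrite le_eqVlt; apply/orP; left; apply/eqP; field.
    by rewrite gt_eqF.
  apply: ler_pM.
  - exact: mulr_ge0 (ltW qx) (mulr_ge0 (ltW qx) Mx0).
  - by rewrite mulr_ge0 ?expR_ge0// divr_ge0 ?exprn_ge0 ?(ltW ed1)// addr_ge0 ?(ltW e0).
  - rewrite ler_wpM2r ?hazard_leS//.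
    exact: mulr_ge0 (ltW qx) Mx0.
  - exact: exp_quotient_le.
have line := lmoment_line H1 k.+2 x0 y0.
have M3 : h * M k.+3 x <= M k.+2 x * (d * (1 + 10 * d)).
  have -> : h * M k.+3 x = - ((y - x) * M k.+3 x) by rewrite -yxh; ring.
  rewrite -(lerD2l (M k.+2 x)) (le_trans line)// (le_trans M2)//.
  by rewrite le_eqVlt; apply/orP; left; apply/eqP; ring.
have M2x := lmoment_gt0 H1 k.+2 x0.
have : h * q k.+2 x <= d * (1 + 10 * d).
  rewrite -(ler_pM2l M2x); apply: le_trans M3.
  by rewrite [M k.+3 x]lmomentS// mulrCA [M _ _ * _]mulrC.
rewrite /h -mulrA ler_pM2l// => h2.
apply: (@le_trans _ _ (1 + 10 * d)); last by rewrite lerD2l.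
apply: le_trans h2.
rewrite mulrC ler_pM2r ?hazard_gt0// lef_pV2 ?posrE ?hazard_gt0//.
exact: hazard_leS.
Unshelve. all: by end_near. Qed.

Lemma steady_all n k : steady n -> steady k.
Proof.
move=> sn; have s0 : steady 0.
  by elim: n sn => // n IH /steady_pred.
by elim: k => // k /steady_succ.
Qed.

End Steady.

(** * Gamma variation and comparison of the mixture terms *)

Section GammaVariation.
Context {R : realType} (H : probability (measurableTypeR R) R).
Hypothesis H1 : H `]0, +oo[ = 1%E.
Implicit Types (k d : nat) (x y e l u : R).

Local Notation M := (lmoment H).
Local Notation q := (hazard H).
Hypothesis st : forall k, steady H k.

(** A scale 1/q_k of vanishing slope is negligible against x. *)
Lemma cvg_mul_hazard k : x * q k x @[x --> +oo] --> +oo.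
Proof.
apply/cvgryPge => A; near=> x.
have x0 : 0 < x by near: x; exact: nbhs_pinfty_gt.
have A1 : 0 < `|A| + 1 by rewrite ltr_wpDl.
have : (q k x)^-1 <= (`|A| + 1)^-1 * x.
  by near: x; apply: steady_hazard_large => //; rewrite invr_gt0.
have qx := hazard_gt0 H1 k x0.
rewrite ler_pdivlMl// ler_pdivrMr// => h.
by rewrite (le_trans _ h)// (le_trans (ler_norm _))// lerDl.
Unshelve. all: by end_near. Qed.

Lemma cvg_shift_hazard k u : x + u / q k x @[x --> +oo] --> +oo.
Proof.
apply/cvgryPge => A; near=> x.
have x0 : 0 < x by near: x; exact: nbhs_pinfty_gt.
have u1 : 0 < 2 * (`|u| + 1) by rewrite mulr_gt0// ltr_wpDl.
have : (q k x)^-1 <= (2 * (`|u| + 1))^-1 * x.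
  by near: x; apply: steady_hazard_large => //; rewrite invr_gt0.
rewrite ler_pdivlMl// => h.
have f0 : 0 < (q k x)^-1 by rewrite invr_gt0 hazard_gt0.
have xA : 2 * A <= x by near: x; apply: nbhs_pinfty_ge; exact: num_real.
have := ler_norm (- u); rewrite normrN => nu.
by nra.
Unshelve. all: by end_near. Qed.

Lemma hazard_shift_ratio k u :
  q k (x + u / q k x) / q k x @[x --> +oo] --> (1 : R).
Proof.
suff : q k x / q k (x + u / q k x) @[x --> +oo] --> (1 : R).
  move/(cvgV (oner_neq0 R)); rewrite invr1; apply: cvg_trans.
  by apply: near_eq_cvg; apply: nearW => x /=; rewrite invf_div.
apply/cvgrPdist_le => e e0.
have u1 : 0 < `|u| + 1 by rewrite ltr_wpDl.
have eu : 0 < e / (`|u| + 1) by rewrite divr_gt0.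
have [A A0 lip] := steady_lipschitz H1 (st k) eu.
near=> x.
have Ax : A <= x by near: x; apply: nbhs_pinfty_ge; exact: num_real.
have x0 := lt_le_trans A0 Ax.
have Ay : A <= x + u / q k x.
  by near: x; move: (A); apply/cvgryPge; exact: cvg_shift_hazard.
have qx := hazard_gt0 H1 k x0.
have := lip _ _ Ax Ay; rewrite [x + _ - x]addrC addKr => L.
rewrite distrC -[X in `|_ - X|](mulfV (lt0r_neq0 qx)) -mulrBr normrM.
rewrite (gtr0_norm qx) -ler_pdivlMl//.
apply: le_trans L _; rewrite normrM normfV (gtr0_norm qx) mulrA mulrC.
rewrite ler_pM2l ?invr_gt0// mulrAC ler_pdivrMr// ler_pM2l// lerDl//.
Unshelve. all: by end_near. Qed.

(** ln M_k is convex with slope - q_k, so its increment over the step u/q_k(x) lies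
    between - u and - u times the ratio of the hazard rates at both ends. *)
Lemma lmoment_gamma k u :
  M k (x + u / q k x) / M k x @[x --> +oo] --> expR (- u).
Proof.
apply: (@squeeze_cvgr _ _ _ _ (fun=> expR (- u))
  (fun x => expR (- (u * (q k (x + u / q k x) / q k x))))).
- near=> x.
  have x0 : 0 < x by near: x; exact: nbhs_pinfty_gt.
  have y0 : 0 < x + u / q k x.
    by near: x; move: 0; apply/cvgryPgt; exact: cvg_shift_hazard.
  have Mx := lmoment_gt0 H1 k x0.
  have qx := lt0r_neq0 (hazard_gt0 H1 k x0).
  rewrite ler_pdivlMr// ler_pdivrMr// mulrC; apply/andP; split.
    apply: le_trans (lmoment_tangent H1 k x0 y0).
    by rewrite [x + _ - x]addrC addKr [q k x * _]mulrC divfK.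
  apply: le_trans (lmoment_tangentV H1 k x0 y0) _.
  rewrite mulrC opprD addrA subrr add0r mulrN.
  by rewrite [_ * (u / _)]mulrC -mulrA [_^-1 * _]mulrC.
- exact: cvg_cst.
- rewrite -[X in expR (- X)]mulr1.
  have h : - (u * (q k (x + u / q k x) / q k x)) @[x --> +oo] --> - (u * 1).
    by apply: cvgN; apply: cvgMr; exact: hazard_shift_ratio.
  exact: (cvg_comp _ _ h (@continuous_expR R _)).
Unshelve. all: by end_near. Qed.

(** The scale mixture of y |-> y^d e^(-l y); see [mixtermE]. *)
Definition mixterm d l x : R := x ^+ d * M d (l * x).

Local Notation phi := mixterm.

Lemma mixterm_gt0 d l x : 0 < l -> 0 < x -> 0 < phi d l x.
Proof. by move=> l0 x0; rewrite mulr_gt0 ?exprn_gt0 ?lmoment_gt0// mulr_gt0. Qed.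

Lemma mixtermE d l x : 0 < l -> 0 < x ->
  phi d l x = \int[H]_(s in `]0, +oo[) ((x / s) ^+ d * expR (- (l * (x / s)))).
Proof.
move=> l0 x0; rewrite /phi /lmoment -RintegralZl//; last first.
  by apply: integrable_moment; rewrite mulr_gt0.
apply: eq_Rintegral => s _; rewrite exprMn -!mulrA; congr (_ * (_ * expR _)).
Qed.

Lemma integrable_mixterm d l x : 0 < l -> 0 < x ->
  H.-integrable `]0, +oo[
    (EFin \o (fun s : measurableTypeR R => (x / s) ^+ d * expR (- (l * (x / s))))).
Proof.
move=> l0 x0; have lx : 0 < l * x by rewrite mulr_gt0.
have mD : measurable (`]0, +oo[ : set (measurableTypeR R)) by [].
have := integrable_EFinZl mD (x ^+ d) (integrable_moment H d lx).
apply: eq_integrable => // s _ /=.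
by rewrite exprMn -!mulrA.
Qed.

(** The larger rate pays for the extra powers of y, as y^j e^(-(l'-l) y) is bounded. *)
Lemma mixterm_le d j l l' x : 0 < l -> l < l' -> 0 < x ->
  phi (d + j) l' x <= j`!%:R / (l' - l) ^+ j * phi d l x.
Proof.
move=> l0 ll' x0; have l'0 := lt_trans l0 ll'.
rewrite !mixtermE// -RintegralZl//; last exact: integrable_mixterm.
apply: le_Rintegral => //; first exact: integrable_mixterm.
  by apply: integrable_EFinZl => //; exact: integrable_mixterm.
move=> s; rewrite /= in_itv/= andbT => s0.
have y0 : 0 < x / s by rewrite divr_gt0.
move: (x / s) y0 => y y0.
have dl : 0 < l' - l by rewrite subr_gt0.
have := exprn_expRN_le j (ltW (mulr_gt0 dl y0)).
rewrite exprMn -mulrA -ler_pdivlMl ?exprn_gt0// [_^-1 * _]mulrC => h.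
have -> : y ^+ (d + j) * expR (- (l' * y)) =
    (y ^+ j * expR (- ((l' - l) * y))) * (y ^+ d * expR (- (l * y))).
  have -> : - (l' * y) = - ((l' - l) * y) - l * y by ring.
  by rewrite expRD exprD; ring.
by rewrite ler_pM2r// mulr_gt0 ?exprn_gt0 ?expR_gt0.
Qed.

Lemma cvg_mull_pinfty l : 0 < l -> l * x @[x --> +oo] --> +oo.
Proof. by move=> l0; apply: gt0_cvgMry => //; exact: cvg_id. Qed.

(** Increasing the degree from d to d+1 multiplies the term by x q_d(l x), which
    tends to infinity. *)
Lemma mixterm_deg_lt d j l : 0 < l ->
  phi d l x / phi (d + j.+1) l x @[x --> +oo] --> 0.
Proof.
move=> l0.
have step i : phi i l x / phi i.+1 l x @[x --> +oo] --> 0.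
  have : ((l * x) * q i (l * x))^-1 @[x --> +oo] --> 0.
    apply/gtr0_cvgV0; last first.
      exact: (cvg_comp _ _ (cvg_mull_pinfty l0) (cvg_mul_hazard i)).
    near=> x; have x0 : 0 < x by near: x; exact: nbhs_pinfty_gt.
    by rewrite mulr_gt0 ?hazard_gt0 ?mulr_gt0.
  move=> h; have : l * (l * x * q i (l * x))^-1 @[x --> +oo] --> l * 0.
    exact: cvgMr.
  rewrite mulr0; apply: cvg_trans; apply: near_eq_cvg; near=> x.
  have x0 : 0 < x by near: x; exact: nbhs_pinfty_gt.
  have lx : 0 < l * x by rewrite mulr_gt0.
  rewrite /phi /hazard exprSr; field.
  by rewrite !gt_eqF ?lmoment_gt0 ?exprn_gt0.
elim: j => [|j IH]; first by rewrite addn1; exact: step.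
have : phi d l x / phi (d + j.+1) l x *
  (phi (d + j.+1) l x / phi (d + j.+1).+1 l x) @[x --> +oo] --> (0 * 0 : R).
  by apply: cvgM => //; exact: step.
rewrite mulr0; apply: cvg_trans.
apply: near_eq_cvg; near=> x.
have x0 : 0 < x by near: x; exact: nbhs_pinfty_gt.
by rewrite [(d + j.+2)%N]addnS mulrA divfK// lt0r_neq0// mixterm_gt0.
Unshelve. all: by end_near. Qed.

(** Increasing the rate divides the term by at least e^((l'-l) x q_d(l' x)). *)
Lemma mixterm_rate_lt d l l' : 0 < l -> l < l' ->
  phi d l' x / phi d l x @[x --> +oo] --> 0.
Proof.
move=> l0 ll'; have l'0 := lt_trans l0 ll'.
apply: (@squeeze_cvgr _ _ _ _ (fun=> 0)
  (fun x => expR (- ((l' - l) / l' * ((l' * x) * q d (l' * x)))))).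
- near=> x.
  have x0 : 0 < x by near: x; exact: nbhs_pinfty_gt.
  rewrite divr_ge0 ?(ltW (mixterm_gt0 _ _ _))//=.
  rewrite ler_pdivrMr ?mixterm_gt0// /phi mulrCA ler_pM2l ?exprn_gt0//.
  have lx : 0 < l * x by rewrite mulr_gt0.
  have l'x : 0 < l' * x by rewrite mulr_gt0.
  apply: le_trans (lmoment_tangentV H1 d lx l'x) _.
  rewrite mulrC le_eqVlt; apply/orP; left; apply/eqP.
  by congr (expR _ * _); field; rewrite gt_eqF.
- exact: cvg_cst.
- have c0 : 0 < (l' - l) / l' by rewrite divr_gt0 ?subr_gt0.
  apply: (@cvg_comp _ _ _ _ (fun y : R => expR (- y)) _ (+oo)); last exact: cvgr_expR.
  apply: gt0_cvgMry => //.
  exact: (cvg_comp _ _ (cvg_mull_pinfty l'0) (cvg_mul_hazard d)).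
Unshelve. all: by end_near. Qed.

(** When the term of larger rate has the larger degree, an intermediate rate
    absorbs the excess of degree. *)
Lemma mixterm_dominated d l d' l' : 0 < l -> (l < l') || (l == l') && (d' < d)%N ->
  phi d' l' x / phi d l x @[x --> +oo] --> 0.
Proof.
move=> l0 /orP[ll'|/andP[/eqP <- d'd]]; last first.
  have -> : d = (d' + (d - d').-1.+1)%N by rewrite prednK ?subn_gt0// subnKC// ltnW.
  exact: mixterm_deg_lt.
have l'0 := lt_trans l0 ll'.
have [dd'|d'd] := leqP d d'; last first.
  have e : d = (d' + (d - d').-1.+1)%N by rewrite prednK ?subn_gt0// subnKC// ltnW.
  pose a := phi d' l'; pose b := phi d l'; pose c := phi d l.
  have ab : a x / b x @[x --> +oo] --> (0 : R).
    by rewrite /b e; exact: mixterm_deg_lt.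
  have bc : b x / c x @[x --> +oo] --> (0 : R) by exact: mixterm_rate_lt.
  have : a x / b x * (b x / c x) @[x --> +oo] --> (0 * 0 : R) by exact: (cvgM ab bc).
  rewrite mulr0; apply: cvg_trans; apply: near_eq_cvg; near=> x.
  have x0 : 0 < x by near: x; exact: nbhs_pinfty_gt.
  by rewrite -/a -/c mulrA divfK// gt_eqF// mixterm_gt0.
pose m := (l + l') / 2.
have lm : l < m by rewrite /m; lra.
have ml' : m < l' by rewrite /m; lra.
have m0 := lt_trans l0 lm.
pose C := (d' - d)`!%:R / (l' - m) ^+ (d' - d).
apply: (@squeeze_cvgr _ _ _ _ (fun=> 0) (fun x => C * (phi d m x / phi d l x))).
- near=> x.
  have x0 : 0 < x by near: x; exact: nbhs_pinfty_gt.
  rewrite divr_ge0 ?(ltW (mixterm_gt0 _ _ _))//= mulrA.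
  rewrite ler_pM2r ?invr_gt0 ?mixterm_gt0//.
  by rewrite -[X in phi X _ _](subnKC dd'); exact: mixterm_le.
- exact: cvg_cst.
- by rewrite -[X in _ --> X](mulr0 C); apply: cvgMr; exact: mixterm_rate_lt.
Unshelve. all: by end_near. Qed.

End GammaVariation.

(** * The exponential of a sub-intensity matrix *)

Section Spectrum.
Context {R : realType}.

(** A transient state leads to some state from which it is out of reach, so that
    strictly fewer states are accessible from there: induction on their number. *)
Lemma accessible_absorbing p (Q : 'M[R]_(1 + p)) :
  (forall i : 'I_p, transient Q (rshift 1 i)) ->
  forall i, accessible Q i (lshift p ord0).
Proof.
move=> tQ i; have [n] := ubnP #|accessible Q i|.
elim: n i => // n IH i; rewrite ltnS.
case: (split_ordP i) => k ->.
  by rewrite (ord1 k) /accessible connect0.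
have [j [ij ji]] := tQ k => ni.
apply: (connect_trans ij); apply: IH; apply: leq_trans ni.
apply: proper_card; apply/properP; split.
  by apply/fintype.subsetP => l; rewrite !inE; exact: (connect_trans ij).
by exists (rshift 1 k); rewrite !inE// /accessible connect0.
Qed.

Lemma eigenvalue_trmx p (A : 'M[R]_p) (a : R) :
  eigenvalue A^T a = eigenvalue A a.
Proof.
rewrite !eigenvalue_root_char; suff -> : char_poly A^T = char_poly A by [].
rewrite /char_poly -[RHS]det_tr; congr (\det _).
by apply/matrixP => i j; rewrite !mxE eq_sym.
Qed.

(** Maximum principle.  An eigenvector of L for a >= 0, extended by 0 to the
    absorbing state, satisfies Q W = a W; where W attains its maximum, so does it
    at all neighbours, hence along a path to the absorbing state, where W = 0. *)
Lemma subintensity_eigenvalue_lt0 p (L : 'M[R]_p) (a : R) :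
  subintensity_matrix L -> eigenvalue L a -> a < 0.
Proof.
move=> [Q [[Qoff Qsum] Q0 tQ LQ]].
rewrite -eigenvalue_trmx => /eigenvalueP[u uL u0]; rewrite ltNge; apply/negP => a0.
pose w (i : 'I_(1 + p)) := (row_mx (0 : 'rV[R]_1) u) 0 i.
pose im := [arg max_(i > lshift p ord0) `|w i|]%O.
have wmax j : `|w j| <= `|w im|.
  by rewrite /im; case: arg_maxP => // i _; exact.
have m0 : 0 < `|w im|.
  have /rV0Pn[j uj] : u != 0 by [].
  apply: lt_le_trans (wmax (rshift 1 j)).
  by rewrite /w row_mxEr normr_gt0.
(* W is the eigenvector, with the sign that makes its largest entry positive. *)
pose W j := Num.sg (w im) * w j.
have Wim : W im = `|w im| by rewrite /W normrEsg.
have Wle j : W j <= W im.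
  rewrite Wim (le_trans (ler_norm _))// normrM normr_sg.
  have -> : w im != 0 by rewrite -normr_gt0.
  by rewrite mul1r.
have W0 : W (lshift p ord0) = 0
  by rewrite /W [w (lshift _ _)](_ : _ = 0) ?mulr0// /w row_mxEl mxE.
have QW i : \sum_j Q i j * W j = a * W i.
  case: (split_ordP i) => k ->.
    rewrite (ord1 k) W0 mulr0 big1// => j _.
    by have /rowP/(_ j) := Q0; rewrite !mxE => ->; rewrite mul0r.
  rewrite big_split_ord/= big_ord1 W0 mulr0 add0r /W.
  have /rowP/(_ k) := uL; rewrite !mxE => Luk.
  rewrite mulrCA [w (rshift 1 k)](_ : _ = u 0 k); last by rewrite /w row_mxEr.
  rewrite -Luk mulr_sumr; apply: eq_bigr => j _.
  by rewrite mulrCA /w row_mxEr LQ !mxE [u _ _ * _]mulrC.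
have step i j : W i = W im -> i != j -> 0 < Q i j -> W j = W im.
  move=> Wi ij Qij.
  have E : \sum_l Q i l * (W im - W l) = - (a * W im).
    under eq_bigr do rewrite mulrBr.
    by rewrite sumrB QW -mulr_suml Qsum mul0r sub0r Wi.
  have ge l : 0 <= Q i l * (W im - W l).
    have [->|il] := eqVneq l i; first by rewrite Wi subrr mulr0.
    by rewrite mulr_ge0 ?subr_ge0// Qoff// eq_sym.
  have : Q i j * (W im - W j) <= 0.
    apply: (@le_trans _ _ (\sum_l Q i l * (W im - W l))).
      by rewrite (bigD1 j)//= lerDl sumr_ge0.
    by rewrite E oppr_le0 mulr_ge0// Wim.
  rewrite pmulr_rle0// subr_le0 => h.
  by apply/eqP; rewrite eq_le Wle h.
have /connectP[s sp se] := accessible_absorbing tQ im.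
have walk t i : path [rel i j | (i != j) && (0 < Q i j)] i t ->
    W i = W im -> W (last i t) = W im.
  elim: t i => //= j t IH i /andP[/andP[ij Qij] tp] Wi.
  by apply: IH => //; exact: step Wi ij Qij.
have Wlast := walk s im sp erefl.
by move: m0; rewrite -Wim -Wlast -se W0 ltxx.
Qed.

(** The nilpotent part of a Jordan block. *)
Definition nilblock k : 'M[R]_k := \matrix_(i, j) (i.+1 == j)%:R.

Lemma jordan_blockE (a : R) k : jordan_block a k = a%:M + nilblock k.
Proof. by apply/matrixP => i j; rewrite !mxE. Qed.

Lemma nilblockX k d : nilblock k ^+ d = \matrix_(i, j) (i + d == j)%N%:R.
Proof.
elim: d => [|d IH].
  by apply/matrixP => i j; rewrite expr0 !mxE addn0.
rewrite exprSr IH; apply/matrixP => i j; rewrite !mxE.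
have [ik|ki] := ltnP (i + d) k.
  rewrite (bigD1 (Ordinal ik))//= !mxE/= eqxx mul1r addnS big1 ?addr0// => l li.
  rewrite !mxE; case: eqP => [e|]; last by rewrite mul0r.
  by case/eqP: li; apply: val_inj.
rewrite big1 => [|l _]; last first.
  rewrite !mxE; case: eqP => [e|]; last by rewrite mul0r.
  by move: ki; rewrite e leqNgt ltn_ord.
case: eqP => // e; have := ltn_ord j.
by rewrite -e addnS ltnNge (leq_trans ki).
Qed.

Lemma nilblock_nilpotent k d : (k <= d)%N -> nilblock k ^+ d = 0.
Proof.
move=> kd; rewrite nilblockX; apply/matrixP => i j; rewrite !mxE.
by case: eqP => // e; have := ltn_ord j; rewrite -e ltnNge (leq_trans kd)// leq_addl.
Qed.

(** The E_i are the products of the columns of P^-1 and the rows of P that belong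
    to block i: projections onto the generalized eigenspaces, summing to 1. *)
Lemma jordan_resolution p (L : 'M[R]_p) m (a : 'I_m -> R) (k : 'I_m -> nat) :
  jordan_form L a k ->
  exists E : 'I_m -> 'M[R]_p, \sum_i E i = 1 /\
    forall i d, (\sum_i k i <= d)%N -> E i *m (L - (a i)%:M) ^+ d = 0.
Proof.
move=> [_ [P [_ /row_fullP[B BP] PL]]].
pose Pi i := submxcol P i; pose Bi i := submxrow B i.
have PLi i : Pi i *m L = jordan_block (a i) (k i) *m Pi i.
  have : (\mxcol_i Pi i) *m L =
      (\mxdiag_(i < m) jordan_block (a i) (k i)) *m (\mxcol_i Pi i).
    by rewrite submxcolK.
  by rewrite mul_mxdiag_mxcol mxcol_mul => /eq_mxcolP/(_ i).
have PN i d : Pi i *m (L - (a i)%:M) ^+ d = nilblock (k i) ^+ d *m Pi i.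
  elim: d => [|d IH]; first by rewrite !expr0 mulmx1 mul1mx.
  rewrite exprSr -[_ * _]/(_ *m _) mulmxA IH -mulmxA mulmxBr PLi jordan_blockE.
  rewrite mulmxDl mul_mx_scalar mul_scalar_mx addrAC subrr add0r mulmxA.
  by rewrite exprSr.
exists (fun i => Bi i *m Pi i); split.
  rewrite -[RHS]BP -[in RHS](submxcolK P) -[in RHS](submxrowK B).
  by rewrite mul_mxrow_mxcol.
move=> i d kd; rewrite -mulmxA PN nilblock_nilpotent ?mul0mx ?mulmx0//.
by apply: leq_trans kd; rewrite (bigD1 i)//= leq_addr.
Qed.

(** The number a_i is an eigenvalue of L if E_i is not 0; if E_i = 0 any
    negative number serves in its place. *)
Lemma subintensity_resolution p (L : 'M[R]_p) m (a : 'I_m -> R)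
    (k : 'I_m -> nat) :
  subintensity_matrix L -> jordan_form L a k ->
  exists (b : 'I_m -> R) (E : 'I_m -> 'M[R]_p) (D : nat),
    [/\ forall i, b i < 0, \sum_i E i = 1 &
    forall i d, (D <= d)%N -> E i *m (L - (b i)%:M) ^+ d = 0].
Proof.
move=> sL /jordan_resolution[E [E1 EN]].
pose b i := if E i == 0 then -1 else a i.
exists b, E, (\sum_i k i)%N; split => //; last first.
  move=> i d kd; have [E0|E0] := eqVneq (E i) 0; first by rewrite E0 mul0mx.
  by rewrite /b (negbTE E0) EN.
move=> i; rewrite /b; case: eqVneq => [_|E0]; first by rewrite ltrN10.
apply: (subintensity_eigenvalue_lt0 sL).
pose X d := E i *m (L - (a i)%:M) ^+ d.
(* The last nonzero X d consists of rows that are left eigenvectors of L. *)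
have [d [Xd XdS]] : exists d, X d != 0 /\ X d.+1 == 0.
  have exX : exists d, X d == 0 by exists (\sum_i k i)%N; rewrite /X EN.
  case: (ex_minnP exX) => -[|d] Xd minX.
    by move: Xd E0; rewrite /X expr0 mulmx1 => ->.
  exists d; split => //; apply/negP => /minX; by rewrite ltnn.
have [r Xr] : exists r, row r (X d) != 0.
  apply: contrapT => h; case/eqP: Xd; apply/row_matrixP => r; rewrite row0.
  by apply/eqP; apply/negPn/negP => hr; apply: h; exists r.
apply/eigenvalueP; exists (row r (X d)) => //.
have : row r (X d.+1) = 0 by rewrite (eqP XdS) row0.
rewrite /X exprSr -[_ * _]/(_ *m _) mulmxA -/(X d) row_mul mulmxBr mul_mx_scalar.
by move/eqP; rewrite subr_eq0 => /eqP.
Qed.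

Lemma cvg_sumr (V : normedModType R) (I : Type) (r : seq I) (T : Type)
    (F : set_system T) (f : I -> T -> V) (l : I -> V) : Filter F ->
  (forall i, f i x @[x --> F] --> l i) ->
  \sum_(i <- r) f i x @[x --> F] --> \sum_(i <- r) l i.
Proof.
move=> FF fl; elim: r => [|i r IH].
  by rewrite big_nil; under eq_fun do rewrite big_nil; exact: cvg_cst.
by rewrite big_cons; under eq_fun do rewrite big_cons; exact: cvgD.
Qed.

(** The exponential series of a x, differentiated d times in a. *)
Lemma series_bin_exp (d : nat) (a x : R) :
  series (fun k => x ^+ k / k`!%:R * ('C(k, d)%:R * a ^+ (k - d))) n @[n --> \oo]
    --> x ^+ d / d`!%:R * expR (a * x).
Proof.
pose u k := x ^+ k / k`!%:R * ('C(k, d)%:R * a ^+ (k - d)).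
rewrite -/u.
have uE n : series u (n + d)%N =
    x ^+ d / d`!%:R * series (exp_coeff (a * x)) n.
  elim: n => [|n IH].
    rewrite add0n !seriesEord /= big_ord0 mulr0 big1// => i _.
    by rewrite /u bin_small ?mul0r ?mulr0.
  rewrite addSn /series/= !big_nat_recr//= -[X in X + _]/(series u (n + d)%N) IH.
  rewrite mulrDr; congr (_ + _).
  have nf : n`!%:R != 0 :> R by rewrite pnatr_eq0 -lt0n fact_gt0.
  have df : d`!%:R != 0 :> R by rewrite pnatr_eq0 -lt0n fact_gt0.
  have ndf : (n + d)`!%:R != 0 :> R by rewrite pnatr_eq0 -lt0n fact_gt0.
  have := bin_fact (leq_addl n d); rewrite addnK => /(congr1 (fun k => k%:R : R)).
  rewrite !natrM => /esym bE.
  rewrite /u addnK exprD -[exp_coeff _ _]/((a * x) ^+ n / n`!%:R) exprMn.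
  have -> : 'C(n + d, d)%:R = (n + d)`!%:R / (d`!%:R * n`!%:R) :> R.
    by rewrite bE; field; rewrite nf df.
  by field; rewrite nf df ndf.
have h : series (exp_coeff (a * x)) n @[n --> \oo] --> expR (a * x).
  exact: is_cvg_series_exp_coeff.
have h2 : x ^+ d / d`!%:R * series (exp_coeff (a * x)) n @[n --> \oo] -->
  x ^+ d / d`!%:R * expR (a * x) by exact: cvgMr.
rewrite -(cvg_shiftn d); apply: cvg_trans h2; apply: near_eq_cvg.
by apply: nearW => n; rewrite -uE.
Qed.

Lemma is_derive_exp_monomial (d : nat) (a x : R) :
  is_derive x 1 (fun x => x ^+ d / d`!%:R * expR (a * x))
   (a * (x ^+ d / d`!%:R * expR (a * x)) +
    if d is d'.+1 then x ^+ d' / d'`!%:R * expR (a * x) else 0).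
Proof.
have idX n (y : R) : ((id : R -> R) ^+ n) y = y ^+ n.
  by elim: n => // n IH; rewrite !exprS -IH.
have dX := is_deriveX d (is_derive_id x (1 : R)).
have dE : is_derive x 1 (fun x => expR (a * x)) (expR (a * x) * a).
  have da : is_derive x 1 (a \*: id) (a *: (1 : R)).
    exact: is_deriveZ.
  have := is_derive1_comp (is_derive_expR (a * x)) da.
  by rewrite /GRing.scale/= mulr1.
have dM := is_deriveM (is_deriveZ (d`!%:R^-1) dX) dE.
have E y : (d`!%:R^-1 \*: (id : R -> R) ^+ d) y = y ^+ d / d`!%:R.
  by rewrite [RHS]mulrC -idX.
have Ef : (d`!%:R^-1 \*: (id : R -> R) ^+ d * (fun x => expR (a * x))) =
  (fun x => x ^+ d / d`!%:R * expR (a * x)).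
  by apply/funext => y; rewrite -E.
rewrite Ef E in dM; apply: (is_derive_eq dM).
case: d {dX dM E Ef} => [|d]; rewrite /GRing.scale/=.
  by rewrite expr0 fact0; ring.
rewrite factS natrM; field.
by rewrite nat1r !pnatr_eq0 -lt0n fact_gt0.
Qed.

Section Resolution.
Context (p m D : nat) (L : 'M[R]_p) (b : 'I_m -> R) (E : 'I_m -> 'M[R]_p).
Hypothesis E1 : \sum_i E i = 1.
Hypothesis EN : forall i d, (D <= d)%N -> E i *m (L - (b i)%:M) ^+ d = 0.

Let C i d := E i *m (L - (b i)%:M) ^+ d.

Lemma scalar_mxX (c : R) n : (c%:M : 'M[R]_p) ^+ n = (c ^+ n)%:M.
Proof.
elim: n => [|n IH]; first by rewrite !expr0.
by rewrite exprS IH [in RHS]exprS scalar_mxM.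
Qed.

(** Expand ((b_i + c) + (L - b_i))^n by the binomial formula in each block. *)
Lemma resolution_powers (c : R) n :
  (L + c%:M) ^+ n = \sum_(i < m) \sum_(d < D)
    ('C(n, d)%:R * (b i + c) ^+ (n - d)) *: C i d.
Proof.
rewrite -[LHS]mul1mx -[1%:M]/(1 : 'M[R]_p) -E1 mulmx_suml; apply: eq_bigr => i _.
have -> : L + c%:M = (b i + c)%:M + (L - (b i)%:M).
  by rewrite raddfD/= addrCA addrAC subrr add0r addrC.
rewrite exprDn_comm; last exact: comm_scalar_mx.
rewrite mulmx_sumr.
pose f d := ('C(n, d)%:R * (b i + c) ^+ (n - d)) *: C i d.
transitivity (\sum_(0 <= d < n.+1) f d).
  rewrite big_mkord; apply: eq_bigr => d _.
  rewrite scalar_mxX -[_ * _]/(_ *m _) -scaler_nat mul_scalar_mx scalerA.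
  by rewrite -scalemxAr.
transitivity (\sum_(0 <= d < D) f d); last by rewrite big_mkord.
have ext k N : (k <= N)%N -> (forall d, (k <= d)%N -> f d = 0) ->
    \sum_(0 <= d < N) f d = \sum_(0 <= d < k) f d.
  move=> kN f0; rewrite (big_cat_nat _ kN)//= [X in _ + X]big_nat_cond.
  by rewrite [X in _ + X]big1 ?addr0// => d /andP[/andP[kd _] _]; exact: f0.
have fn d : (n.+1 <= d)%N -> f d = 0.
  by move=> nd; rewrite /f bin_small// mul0r scale0r.
have fD d : (D <= d)%N -> f d = 0 by move=> Dd; rewrite /f /C EN// scaler0.
by rewrite -(ext n.+1 (maxn n.+1 D))// ?leq_maxl// (ext D)// leq_maxr.
Qed.

(** The matrix exponential of x L, as a finite sum. *)
Definition resolved_exp (x : R) : 'M[R]_p :=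
  \sum_(i < m) \sum_(d < D) (x ^+ d / d`!%:R * expR (b i * x)) *: C i d.

Lemma scalemxX (x : R) (A : 'M[R]_p) n : (x *: A) ^+ n = x ^+ n *: A ^+ n.
Proof.
elim: n => [|n IH]; first by rewrite !expr0 scale1r.
rewrite !exprS IH -[_ * _]/(_ *m _) -scalemxAl -scalemxAr scalerA.
by [].
Qed.

(** Sum the exponential series with [resolution_powers] and [series_bin_exp]. *)
Lemma expmx_resolved x : expmx (x *: L) = resolved_exp x.
Proof.
apply/cvg_lim => //.
have -> : series (fun k => k`!%:R^-1 *: (x *: L) ^+ k) =
  fun n => \sum_(i < m) \sum_(d < D)
    series (fun k => x ^+ k / k`!%:R * ('C(k, d)%:R * b i ^+ (k - d))) n *: C i d.
  apply/funext => n; rewrite seriesEnat/=.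
  transitivity (\sum_(0 <= k < n) \sum_(i < m) \sum_(d < D)
      (x ^+ k / k`!%:R * ('C(k, d)%:R * b i ^+ (k - d))) *: C i d).
    apply: eq_bigr => k _.
    have := resolution_powers 0 k; rewrite raddf0 addr0 => Lk.
    rewrite scalemxX Lk scalerA scaler_sumr; apply: eq_bigr => i _.
    rewrite scaler_sumr addr0; apply: eq_bigr => d _.
    by rewrite scalerA [k`!%:R^-1 * _]mulrC.
  rewrite exchange_big/=; apply: eq_bigr => i _.
  rewrite exchange_big/=; apply: eq_bigr => d _.
  by rewrite seriesEnat/= scaler_suml.
apply: cvg_sumr => i; apply: cvg_sumr => d.
apply: cvgZr_tmp; exact: series_bin_exp.
Qed.

Definition resolved_fun (v : 'rV[R]_p) (w : 'cV[R]_p) (x : R) : R :=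
  \sum_(i < m) \sum_(d < D)
    (v *m C i d *m w) 0 0 * (x ^+ d / d`!%:R * expR (b i * x)).

Lemma resolved_funE v w x : (v *m resolved_exp x *m w) 0 0 = resolved_fun v w x.
Proof.
rewrite /resolved_exp mulmx_sumr mulmx_suml summxE; apply: eq_bigr => i _.
rewrite mulmx_sumr mulmx_suml summxE; apply: eq_bigr => d _.
by rewrite -scalemxAr -scalemxAl mxE mulrC.
Qed.

(** Shifting L by c multiplies its exponential by e^(c x); for large c the entries
    of L + c are nonnegative, which makes signs visible on this series. *)
Lemma resolved_fun_series c (v : 'rV[R]_p) (w : 'cV[R]_p) x :
  series (fun k => x ^+ k / k`!%:R * (v *m (L + c%:M) ^+ k *m w) 0 0) n @[n --> \oo]
  --> expR (c * x) * resolved_fun v w x.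
Proof.
have -> : series (fun k => x ^+ k / k`!%:R * (v *m (L + c%:M) ^+ k *m w) 0 0) =
  fun n => \sum_(i < m) \sum_(d < D) (v *m C i d *m w) 0 0 *
    series (fun k => x ^+ k / k`!%:R * ('C(k, d)%:R * (b i + c) ^+ (k - d))) n.
  apply/funext => n; rewrite seriesEnat/=.
  transitivity (\sum_(0 <= k < n) \sum_(i < m) \sum_(d < D)
      (v *m C i d *m w) 0 0 *
      (x ^+ k / k`!%:R * ('C(k, d)%:R * (b i + c) ^+ (k - d)))).
    apply: eq_bigr => k _.
    rewrite resolution_powers mulmx_sumr mulmx_suml summxE mulr_sumr.
    apply: eq_bigr => i _; rewrite mulmx_sumr mulmx_suml summxE mulr_sumr.
    by apply: eq_bigr => d _; rewrite -scalemxAr -scalemxAl mxE; ring.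
  rewrite exchange_big/=; apply: eq_bigr => i _.
  rewrite exchange_big/=; apply: eq_bigr => d _.
  by rewrite seriesEnat/= mulr_sumr.
rewrite /resolved_fun mulr_sumr.
apply: cvg_sumr => i; rewrite mulr_sumr; apply: cvg_sumr => d.
rewrite mulrCA; apply: cvgMr.
rewrite mulrCA -expRD -mulrDl [c + _]addrC; exact: series_bin_exp.
Qed.

(** All terms of the series in [resolved_fun_series] are nonnegative; keep the
    first one. *)
Lemma resolved_fun_lower c (v : 'rV[R]_p) (w : 'cV[R]_p) x : 0 <= x ->
  (forall i j, 0 <= (L + c%:M) i j) -> (forall j, 0 <= v 0 j) ->
  (forall j, 0 <= w j 0) ->
  expR (- (c * x)) * (v *m w) 0 0 <= resolved_fun v w x.
Proof.
move=> x0 L0 v0 w0.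
rewrite expRN ler_pdivrMl ?expR_gt0//.
have Lk k i j : 0 <= ((L + c%:M) ^+ k) i j.
  elim: k i j => [|k IH] i j; first by rewrite expr0 mxE ler0n.
  by rewrite exprS mxE sumr_ge0// => l _; rewrite mulr_ge0.
have t0 k : 0 <= (v *m (L + c%:M) ^+ k *m w) 0 0.
  rewrite mxE sumr_ge0// => i _; rewrite mulr_ge0//.
  by rewrite mxE sumr_ge0// => j _; rewrite mulr_ge0.
have h := @resolved_fun_series c v w x.
rewrite -(cvg_lim _ h)//; apply: limr_ge; first by apply/cvg_ex; eexists; exact: h.
exists 1%N => // n /= n1; rewrite seriesEnat/= (big_ltn n1) expr0 fact0 divr1 mul1r.
rewrite expr0 mulmx1 lerDl; apply: sumr_ge0 => k _.
by rewrite mulr_ge0// divr_ge0// exprn_ge0.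
Qed.

Lemma resolution_shift (v : 'rV[R]_p) (w : 'cV[R]_p) i d : (v *m C i d *m (L *m w)) 0 0 =
  b i * (v *m C i d *m w) 0 0 + (v *m C i d.+1 *m w) 0 0.
Proof.
have CL : C i d *m L = b i *: C i d + C i d.+1.
  rewrite /C exprSr -[_ * _]/(_ *m _) !mulmxA mulmxBr mul_mx_scalar.
  by rewrite addrCA subrr addr0.
by rewrite mulmxA -[v *m C i d *m L]mulmxA CL mulmxDr mulmxDl -scalemxAr -scalemxAl !mxE.
Qed.

(** The derivative is computed from the closed form, where [resolution_shift]
    identifies its coefficients with those of L w. *)
Lemma is_derive_resolved_fun (v : 'rV[R]_p) (w : 'cV[R]_p) (x : R) :
  is_derive x 1 (resolved_fun v w) (resolved_fun v (L *m w) x).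
Proof.
pose T (i : 'I_m) d x := x ^+ d / d`!%:R * expR (b i * x).
pose T' (i : 'I_m) d x := b i * T i d x + if d is d'.+1 then T i d' x else 0.
pose c i d := (v *m C i d *m w) 0 0.
have cD i d : (D <= d)%N -> c i d = 0.
  by move=> Dd; rewrite /c /C EN// mulmx0 mul0mx mxE.
have -> : resolved_fun v w = \sum_(i < m) \sum_(d < D) c i d \*: T i d.
  apply/funext => y; rewrite fct_sumE; apply: eq_bigr => i _.
  by rewrite fct_sumE.
have dT : is_derive x 1 (\sum_(i < m) \sum_(d < D) c i d \*: T i d)
    (\sum_(i < m) \sum_(d < D) c i d *: T' i d x).
  apply: is_derive_sum => i; apply: is_derive_sum => d; apply: is_deriveZ.
  exact: is_derive_exp_monomial.
apply: (is_derive_eq dT); apply: eq_bigr => i _.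
under [RHS]eq_bigr do rewrite resolution_shift mulrDl.
rewrite big_split/=.
under eq_bigr do rewrite /T' scalerDr.
rewrite big_split/=; congr (_ + _).
  by apply: eq_bigr => d _; rewrite /GRing.scale/= -/(c i d) mulrCA mulrA.
pose f d := c i d.+1 * T i d x.
transitivity (\sum_(0 <= d < D) (c i d * if d is d'.+1 then T i d' x else 0)).
  by rewrite big_mkord.
transitivity (\sum_(0 <= d < D) f d); last by rewrite big_mkord.
case: D cD => [|D'] cD; first by rewrite !big_geq.
rewrite big_nat_recl// mulr0 add0r big_nat_recr//= /f cD// mul0r addr0.
by [].
Qed.

End Resolution.

End Spectrum.

(** * Tails of phase-type distributions *)

Section PhaseTypeTail.
Context {R : realType}.

Lemma subintensity_offdiag p (L : 'M[R]_p) i j :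
  subintensity_matrix L -> i != j -> 0 <= L i j.
Proof.
move=> [Q [[Qoff _] _ _ ->]] ij; rewrite !mxE; apply: Qoff.
by apply: contra ij => /eqP/rshift_inj ->.
Qed.

Lemma subintensity_rowsum p (L : 'M[R]_p) i :
  subintensity_matrix L -> (L *m const_mx 1 : 'cV_p) i 0 <= 0.
Proof.
move=> [Q [[Qoff Qsum] _ _ ->]].
have := Qsum (rshift 1 i); rewrite big_split_ord/= big_ord1 => /eqP.
rewrite addrC addr_eq0 => /eqP E.
rewrite mxE (eq_bigr (fun j => Q (rshift 1 i) (rshift 1 j))) => [|j _].
  by rewrite E oppr_le0 Qoff// eq_sym eq_lrshift.
by rewrite !mxE mulr1.
Qed.

Definition exp_poly m D (l : 'I_m -> R) (c : 'I_m -> nat -> R) (y : R) : R :=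
  \sum_(i < m) \sum_(d < D) c i d * (y ^+ d * expR (- (l i * y))).

(** Positivity and the exponential lower bound come from [resolved_fun_lower]
    applied to the vector of ones, monotonicity from the same lemma applied to
    - L 1, which is nonnegative because the row sums of L are nonpositive. *)
Lemma phase_type_tail p (beta : 'rV[R]_p) (L : 'M[R]_p) n (a : 'I_n -> R)
    (k : 'I_n -> nat) :
  initial_probabilities beta -> subintensity_matrix L -> jordan_form L a k ->
  exists (m D : nat) (l : 'I_m -> R) (c : 'I_m -> nat -> R),
  [/\ forall i, 0 < l i,
      forall y, 0 <= y -> phase_type_cdf beta L y = 1 - exp_poly D l c y,
      forall x y, 0 <= x -> x <= y -> exp_poly D l c y <= exp_poly D l c x,
      exp_poly D l c 0 <= 1 &
      exists c0 c1 : R, [/\ 0 < c0, 0 < c1 &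
        forall y, 0 <= y -> c0 * expR (- (c1 * y)) <= exp_poly D l c y]].
Proof.
move=> [beta0 beta1 betan] sL /(subintensity_resolution sL)[b [E [D0 [b0 E1 EN0]]]].
(* One more degree than needed, so that the constant term d = 0 always exists. *)
pose D := D0.+1.
have EN i d : (D <= d)%N -> E i *m (L - (b i)%:M) ^+ d = 0.
  by move=> Dd; apply: EN0; exact: ltnW.
pose one := const_mx 1 : 'cV[R]_p.
pose g := resolved_fun D L b E beta one.
pose c i d := (beta *m (E i *m (L - (b i)%:M) ^+ d) *m one) 0 0 / d`!%:R.
have gE y : g y = exp_poly D (fun i => - b i) c y.
  apply: eq_bigr => i _; apply: eq_bigr => d _.
  by rewrite /c mulNr opprK; ring.
(* A shift that makes the diagonal of L + c1 nonnegative. *)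
pose c1 := 1 + \sum_i `|L i i|.
have L1 i j : 0 <= (L + c1%:M) i j.
  rewrite !mxE; have [<-|ij] := eqVneq i j; last first.
    by rewrite addr0 subintensity_offdiag.
  rewrite mulr1n /c1 (bigD1 i)//= addrCA addr_ge0// addrA.
  rewrite addr_ge0 ?sumr_ge0//.
  by have := ler_norm (- L i i); rewrite normrN => h; lra.
have one0 j : 0 <= one j 0 by rewrite mxE.
have bone : (beta *m one) 0 0 = \sum_i beta 0 i.
  by rewrite mxE; apply: eq_bigr => i _; rewrite mxE mulr1.
have betagt0 : 0 < \sum_i beta 0 i.
  have /rV0Pn[j bj] : beta != 0 by [].
  rewrite (bigD1 j)//= ltr_pwDl ?sumr_ge0//.
  by rewrite lt_neqAle eq_sym bj beta0.
have glow y : 0 <= y -> (\sum_i beta 0 i) * expR (- (c1 * y)) <= g y.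
  move=> y0; rewrite -bone mulrC.
  exact: (resolved_fun_lower E1 EN y0 L1 beta0 one0).
have g0 : g 0 = \sum_i beta 0 i.
  rewrite -bone -[beta]mulmx1 -[1%:M]/(1 : 'M[R]_p) -E1 mulmx_sumr mulmx_suml summxE.
  apply: eq_bigr => i _.
  rewrite big_ord_recl !expr0 mulmx1 fact0 divr1 mulr0 expR0 !mulr1 big1 ?addr0//.
  by move=> d _; rewrite lift0 expr0n/= !mul0r mulr0.
have gmono x y : 0 <= x -> x <= y -> g y <= g x.
  move=> x0 xy.
  have dg z := is_derive_resolved_fun (b := b) EN beta one z.
  have [z + Ec] : exists2 z, z \in `[x, y]%R &
      g y - g x = resolved_fun D L b E beta (L *m one) z * (y - x).
    apply: MVT_segment => //; apply: continuous_subspaceT => w.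
    by apply/differentiable_continuous/derivable1_diffP; have [] := dg w.
  rewrite in_itv/= => /andP[xc _].
  rewrite -subr_le0 Ec mulr_le0_ge0 ?subr_ge0//.
  rewrite -oppr_ge0.
  have z0 : 0 <= z by exact: le_trans xc.
  have Lo j : 0 <= (- (L *m one)) j 0.
    by rewrite mxE oppr_ge0 subintensity_rowsum.
  have := resolved_fun_lower E1 EN z0 L1 beta0 Lo.
  have -> : resolved_fun D L b E beta (- (L *m one)) z =
      - resolved_fun D L b E beta (L *m one) z.
    rewrite /resolved_fun -sumrN; apply: eq_bigr => i _.
    rewrite -sumrN; apply: eq_bigr => d _.
    by rewrite mulmxN mxE mulNr.
  apply: le_trans; rewrite mulr_ge0 ?expR_ge0//.
  by rewrite mxE sumr_ge0// => j _; rewrite mulr_ge0.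
exists n, D, (fun i => - b i), c; split.
- by move=> i; rewrite oppr_gt0.
- move=> y y0; rewrite /phase_type_cdf ltNge y0/= -gE.
  by rewrite (expmx_resolved E1 EN) resolved_funE.
- by move=> x y x0 xy; rewrite -!gE gmono.
- by rewrite -gE g0.
- exists (\sum_i beta 0 i), c1; split => //.
    by rewrite ltr_pwDl// sumr_ge0.
  by move=> y y0; rewrite -gE glow.
Qed.

Lemma continuous_exp_poly m D (l : 'I_m -> R) (c : 'I_m -> nat -> R) :
  continuous (exp_poly D l c).
Proof.
move=> y; rewrite /exp_poly.
have -> : (fun y : R => \sum_(i < m) \sum_(d < D) c i d * (y ^+ d * expR (- (l i * y)))) =
  exp_poly D l c by [].
apply: cvg_sumr => i; apply: cvg_sumr => d; apply: cvgMr; apply: cvgM.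
  exact: exprn_continuous.
have h : - (l i * z) @[z --> y] --> - (l i * y).
  by apply: cvgN; apply: cvgMr; exact: cvg_id.
exact: (cvg_comp _ _ h (@continuous_expR R _)).
Qed.

End PhaseTypeTail.

Section Grouping.
Context {R : realType}.

Lemma sum_group_by (V : nmodType) (I : finType) (K : eqType) (k : I -> K)
    (F : I -> V) :
  \sum_i F i = \sum_(v <- undup (codom k)) \sum_(i | k i == v) F i.
Proof.
rewrite (exchange_big_dep xpredT)//=; apply: eq_bigr => i _.
rewrite -big_filter (_ : [seq v <- _ | k i == v] = [:: k i]) ?big_seq1//.
have u := undup_uniq (codom k); have ki : k i \in undup (codom k).
  by rewrite mem_undup codom_f.
elim: (undup (codom k)) u ki => //= v s IH /andP[vs us].
rewrite inE; have [kv _|kv /=] := eqVneq (k i) v; last exact: IH.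
rewrite -kv in vs.
rewrite kv; congr (_ :: _).
rewrite (@eq_in_filter _ _ pred0) ?filter_pred0// => w ws.
by rewrite -kv; apply/negbTE; apply: contra vs => /eqP ->.
Qed.

(** Different Jordan blocks may share a rate, and their contributions may cancel.
    After grouping by rate, the dominant term is the one of least rate, then of
    largest degree, among those with nonzero total coefficient. *)
Lemma dominant_term m D (l : 'I_m -> R) (c : 'I_m -> nat -> R)
    (phi : nat -> R -> R -> R) :
  (forall i, 0 < l i) ->
  (forall d l x, 0 < l -> 0 < x -> 0 < phi d l x) ->
  (forall d l d' l', 0 < l -> (l < l') || (l == l') && (d' < d)%N ->
    phi d' l' x / phi d l x @[x --> +oo] --> 0) ->
  (exists y, exp_poly D l c y != 0) ->
  exists (d : nat) (l0 C : R), [/\ 0 < l0, C != 0 &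
    (\sum_(i < m) \sum_(d < D) c i d * phi d (l i) x) / phi d l0 x @[x --> +oo] --> C].
Proof.
move=> lpos phipos dom [y gy].
pose a v d := \sum_(i < m | l i == v) c i d.
pose s := undup (codom l).
have group (f : nat -> R -> R) : \sum_(i < m) \sum_(d < D) c i d * f d (l i) =
   \sum_(v <- s) \sum_(d < D) a v d * f d v.
  rewrite (sum_group_by l); apply: eq_bigr => v _.
  rewrite exchange_big/=; apply: eq_bigr => d _.
  by rewrite mulr_suml; apply: eq_bigr => i /eqP ->.
pose P (t : 'I_m * 'I_D) := a (l t.1) t.2 != 0.
have [t0 Pt0] : exists t, P t.
  apply: contrapT => nP; case/eqP: gy.
  rewrite /exp_poly (group (fun d v => y ^+ d * expR (- (v * y)))).
  rewrite big_seq big1// => v; rewrite mem_undup => /codomP[i ->].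
  rewrite big1// => d _; have [->|ad] := eqVneq (a (l i) d) 0; first by rewrite mul0r.
  by case: nP; exists (i, d).
pose t1 := [arg min_(t < t0 | P t) l t.1]%O.
have [Pt1 min1] : P t1 /\ forall t, P t -> l t1.1 <= l t.1.
  by rewrite /t1; case: arg_minP.
pose Q (t : 'I_m * 'I_D) := P t && (l t.1 == l t1.1).
have Qt1 : Q t1 by rewrite /Q Pt1 eqxx.
pose t2 := [arg max_(t > t1 | Q t) (val t.2)]%N.
have [Qt2 max2] : Q t2 /\ forall t, Q t -> (t.2 <= t2.2)%N.
  by rewrite /t2; case: arg_maxnP.
have /andP[Pt2 /eqP lt2] := Qt2.
pose l0 := l t2.1; pose d0 : nat := t2.2.
exists d0, l0, (a l0 d0); split => //; first exact: lpos.
pose lim v d := if (v == l0) && (d == d0) then a l0 d0 else 0.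
have -> : a l0 d0 = \sum_(v <- s) \sum_(d < D) lim v d.
  rewrite (bigD1_seq l0) ?undup_uniq ?mem_undup ?codom_f//= [X in _ + X]big1 ?addr0.
    rewrite (bigD1 t2.2)//= /lim !eqxx [X in _ + X]big1 ?addr0// => d dt.
    by rewrite ifN.
  by move=> v vl0; rewrite big1// => d _; rewrite /lim (negbTE vl0).
have -> : (fun x => (\sum_(i < m) \sum_(d < D) c i d * phi d (l i) x) / phi d0 l0 x) =
  (fun x => \sum_(v <- s) \sum_(d < D) a v d * (phi d v x / phi d0 l0 x)).
  apply/funext => x; rewrite (group (fun d v => phi d v x)) mulr_suml.
  apply: eq_bigr => v _; rewrite mulr_suml; apply: eq_bigr => d _.
  by rewrite mulrA.
apply: cvg_sumr => v; apply: cvg_sumr => d.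
have [avd|avd] := eqVneq (a v d) 0.
  have -> : lim v d = 0.
    by rewrite /lim; case: ifP => // /andP[/eqP <- /eqP <-].
  by rewrite avd; under eq_fun do rewrite mul0r; exact: cvg_cst.
have [i vi] : exists i, v = l i.
  apply: contrapT => ni; case/eqP: avd; rewrite /a big1// => i /eqP iv.
  by case: ni; exists i.
have Pid : P (i, d) by rewrite /P/= -vi.
have lv : l0 <= v by rewrite vi /l0 lt2; exact: min1 Pid.
rewrite -[lim v d]mulr1 -[X in _ --> X]mulr1.
have [/andP[/eqP vl /eqP dd]|ne] := boolP ((v == l0) && (d == d0 :> nat)).
  rewrite /lim vl dd !eqxx/= mulr1; apply: cvgMr.
  have c1 : (fun _ : R => 1 : R) x @[x --> +oo] --> (1 : R) by exact: cvg_cst.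
  apply: cvg_trans c1; apply: near_eq_cvg; near=> x.
  have x0 : 0 < x by near: x; exact: nbhs_pinfty_gt.
  by rewrite divff// lt0r_neq0// phipos//; exact: lpos.
rewrite /lim (negbTE ne) !mul0r -[X in _ --> X](mulr0 (a v d)); apply: cvgMr.
apply: dom; first exact: lpos.
move: lv; rewrite le_eqVlt => /predU1P[vl|->//].
apply/orP; right; rewrite vl eqxx/=.
have Qid : Q (i, d) by rewrite /Q Pid /= -vi -vl /l0 lt2 eqxx.
have := max2 _ Qid; rewrite leq_eqVlt => /predU1P[/= dd|//].
by case/negP: ne; rewrite -vl dd !eqxx.
Unshelve. all: by end_near. Qed.

End Grouping.

(** * Tails of scale mixtures *)

Section MixtureCdf.
Context {R : realType} (H : probability (measurableTypeR R) R).
Hypothesis hH : scaling_distribution H.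

Local Notation Dom := (`]0, +oo[%classic : set (measurableTypeR R)).
Local Notation phi := (mixterm H).
Implicit Types x y : R.

Lemma scaling_support : H `]0, +oo[ = 1%E.
Proof.
have [Hneg H0] := hH.
have e : (setT : set (measurableTypeR R)) = (`]-oo, 0[ `|` [set 0]) `|` `]0, +oo[.
  apply/seteqP; split => // x _ /=; rewrite !in_itv/= andbT.
  by have [x0|x0|->] := ltgtP x 0; [left; left|right|left; right].
have := probability_setT H; rewrite e measureU//; last first.
- apply/seteqP; split => // x /= [[|->]]; rewrite !in_itv/= ?andbT ?ltxx// => x0.
  by move/(lt_trans x0); rewrite ltxx.
- exact: measurableU.
rewrite measureU//; last first.
  by apply/seteqP; split => // x /= [xn x0]; move: xn; rewrite x0 in_itv/= ltxx.
move=> <-; rewrite [X in _ = (X + _ + _)%E](_ : _ = 0%E); last exact: Hneg.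
by rewrite [X in _ = (_ + X + _)%E](_ : _ = 0%E) ?add0e//; exact: H0.
Qed.

Let H1 := scaling_support.

Context (G : R -> R) (m D : nat) (l : 'I_m -> R) (c : 'I_m -> nat -> R).
Context (c0 c1 : R).
Local Notation g := (exp_poly D l c).
Hypothesis lpos : forall i, 0 < l i.
Hypothesis G0 : forall y, y < 0 -> G y = 0.
Hypothesis GE : forall y, 0 <= y -> G y = 1 - g y.
Hypothesis gmono : forall x y, 0 <= x -> x <= y -> g y <= g x.
Hypothesis g01 : g 0 <= 1.
Hypothesis c00 : 0 < c0.
Hypothesis c10 : 0 < c1.
Hypothesis glow : forall y, 0 <= y -> c0 * expR (- (c1 * y)) <= g y.

Local Notation F := (scale_mixture G H).

Lemma exp_poly_gt0 y : 0 <= y -> 0 < g y.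
Proof. by move=> y0; apply: lt_le_trans (glow y0); rewrite mulr_gt0 ?expR_gt0. Qed.

Lemma cdf_bounds y : 0 <= G y <= 1.
Proof.
have [y0|y0] := ltP y 0; first by rewrite G0// lexx ler01.
rewrite GE// gerBl (ltW (exp_poly_gt0 y0)) andbT subr_ge0.
by apply: le_trans g01; exact: gmono.
Qed.

Lemma measurable_cdf_scaled x : measurable_fun Dom (fun s : R => G (x / s)).
Proof.
have [x0|x0] := ltP x 0.
  apply: (eq_measurable_fun (fun=> 0 : R)) => [s|]; last exact: measurable_cst.
  by rewrite inE => /pos_itvP s0; rewrite G0// pmulr_llt0// invr_gt0.
apply: (eq_measurable_fun (fun s : R => 1 - g (x / s))) => [s|].
  by rewrite inE => /pos_itvP s0; rewrite GE// divr_ge0// ltW.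
apply: measurable_realfun.open_continuous_measurable_fun => // s.
rewrite inE => /pos_itvP s0; apply: cvgB; first exact: cvg_cst.
apply: (@continuous_comp _ _ _ (fun s : R => x / s) g s).
  exact: continuous_divr.
exact: continuous_exp_poly.
Qed.

Lemma integrable_cdf_scaled x :
  H.-integrable Dom (EFin \o (fun s : R => G (x / s))).
Proof.
apply: (@bounded_integrable _ _ _ _ _ _ 1) => //; first exact: measurable_cdf_scaled.
by move=> s _; have /andP[? ?] := cdf_bounds (x / s); rewrite ger0_norm.
Qed.

Lemma mixture_lt0 x : x < 0 -> F x = 0.
Proof.
move=> x0; rewrite /scale_mixture (eq_Rintegral _ (g := fun=> 0)).
  by rewrite Rintegral_cst// mul0r.
by move=> s; rewrite inE => /pos_itvP s0; rewrite G0// pmulr_llt0// invr_gt0.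
Qed.

Lemma mixture_nondecreasing : {homo F : x y / x <= y}.
Proof.
move=> x y xy; apply: le_Rintegral => //; try exact: integrable_cdf_scaled.
move=> s /pos_itvP s0.
have xys : x / s <= y / s by rewrite ler_pM2r// invr_gt0.
have [xs|xs] := ltP (x / s) 0.
  by rewrite (G0 xs); have /andP[] := cdf_bounds (y / s).
by rewrite !GE ?(le_trans xs)// lerB// gmono.
Qed.

Lemma mixture_tailE x : 0 < x ->
  1 - F x = \sum_(i < m) \sum_(d < D) c i d * phi d (l i) x.
Proof.
move=> x0.
have e1 : \int[H]_(s in Dom) (1 : R) = 1 by rewrite Rintegral_cst//= H1 mul1r.
rewrite -{1}e1 -RintegralB//; last 2 first.
- exact: finite_measure_integrable_cst.
- exact: integrable_cdf_scaled.
pose f i d (s : measurableTypeR R) := c i d * ((x / s) ^+ d * expR (- (l i * (x / s)))).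
have fi i d : H.-integrable Dom (EFin \o f i d).
  by apply: integrable_EFinZl => //; exact: integrable_mixterm.
transitivity (\int[H]_(s in Dom) (\sum_(i < m) \sum_(d < D) f i d s)).
  apply: eq_Rintegral => s; rewrite inE => /pos_itvP s0.
  by rewrite GE ?divr_ge0 ?ltW// opprB addrC subrK.
rewrite Rintegral_sum//; last by move=> i; apply: integrable_EFin_sum.
apply: eq_bigr => i _; rewrite Rintegral_sum//; apply: eq_bigr => d _.
by rewrite RintegralZl//; [rewrite mixtermE|exact: integrable_mixterm].
Qed.

Lemma mixture_tail_gt0 x : 0 < 1 - F x.
Proof.
have pos z : 0 < z -> 0 < 1 - F z.
  move=> z0.
  have e1 : \int[H]_(s in Dom) (1 : R) = 1 by rewrite Rintegral_cst//= H1 mul1r.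
  rewrite -{1}e1 -RintegralB//; last 2 first.
  - exact: finite_measure_integrable_cst.
  - exact: integrable_cdf_scaled.
  have cz : 0 < c1 * z by rewrite mulr_gt0.
  apply: (@lt_le_trans _ _ (c0 * lmoment H 0 (c1 * z))).
    by rewrite mulr_gt0// lmoment_gt0.
  rewrite -RintegralZl//; last exact: integrable_moment.
  apply: le_Rintegral => //.
  - by apply: integrable_EFinZl => //; exact: integrable_moment.
  - apply: integrable_EFinB => //; last exact: integrable_cdf_scaled.
    exact: finite_measure_integrable_cst.
  - move=> s /pos_itvP s0; have zs : 0 <= z / s by rewrite divr_ge0 ?ltW.
    by rewrite GE// opprB addrC subrK expr0 mul1r -mulrA glow.
apply: lt_le_trans (pos (Num.max x 1) _) _; first by rewrite lt_max ltr01 orbT.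
by rewrite lerB// mixture_nondecreasing// le_max lexx.
Qed.

(** At 0 nothing better holds in general, as G may have an atom there. *)
Lemma mixture_right_continuous : right_continuous F.
Proof.
move=> x; have [x0|x0] := ltP x 0.
  apply: cvg_at_right_filter.
  have cx : (fun _ : R => 0 : R) y @[y --> x] --> F x.
    by rewrite mixture_lt0//; exact: cvg_cst.
  apply: cvg_trans cx; apply: near_eq_cvg; near=> y.
  by rewrite -/(F y) mixture_lt0//; near: y; exact: lt_nbhsl.
apply/cvg_at_rightP => u [ux cu].
apply: (@bounded_cvg_Rintegral _ _ _ _ _ _ _ 1) => //.
- by move=> n; exact: measurable_cdf_scaled.
- exact: measurable_cdf_scaled.
- by move=> n s _; have /andP[? ?] := cdf_bounds (u n / s); rewrite ger0_norm.
- move=> s /pos_itvP s0; rewrite GE ?divr_ge0// ?ltW//.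
  have h : 1 - g (u n / s) @[n --> \oo] --> 1 - g (x / s).
    apply: cvgB; first exact: cvg_cst.
    have us : u n / s @[n --> \oo] --> x / s by apply: cvgMl.
    exact: (cvg_comp _ _ us (@continuous_exp_poly _ m D l c (x / s))).
  apply: cvg_trans h; apply: near_eq_cvg; apply: nearW => n.
  by rewrite GE// divr_ge0// ltW// (le_lt_trans x0).
Unshelve. all: by end_near. Qed.

Lemma continuous_mixterm d (k : R) x : 0 < k -> 0 < x -> {for x, continuous (phi d k)}.
Proof.
move=> k0 x0; apply: cvgM; first exact: exprn_continuous.
have h : k * y @[y --> x] --> k * x by apply: cvgMr; exact: cvg_id.
have kx := mulr_gt0 k0 x0.
exact: (cvg_comp _ _ h (continuous_lmoment H1 (k := d) kx)).
Qed.

Lemma mixture_continuous x : 0 < x -> {for x, continuous F}.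
Proof.
move=> x0.
have h : 1 - \sum_(i < m) \sum_(d < D) c i d * phi d (l i) y @[y --> x] --> F x.
  rewrite -[F x](subKr 1) (mixture_tailE x0).
  apply: cvgB; first exact: cvg_cst.
  apply: cvg_sumr => i; apply: cvg_sumr => d; apply: cvgMr.
  exact: continuous_mixterm.
apply: cvg_trans h; apply: near_eq_cvg; near=> y.
rewrite -mixture_tailE ?subKr//; near: y; exact: lt_nbhsr.
Unshelve. all: by end_near. Qed.

Lemma mixterm_cvg0 d k : 0 < k -> phi d k x @[x --> +oo] --> 0.
Proof.
move=> k0; have k20 : 0 < k / 2 by rewrite divr_gt0.
have kk : k / 2 < k by rewrite ltr_pdivrMr// ltr_pMr// ltr1n.
pose C := d`!%:R / (k - k / 2) ^+ d.
apply: (@squeeze_cvgr _ _ _ _ (fun=> 0) (fun x => C * lmoment H 0 (k / 2 * x))).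
- near=> x.
  have x0 : 0 < x by near: x; exact: nbhs_pinfty_gt.
  rewrite (ltW (mixterm_gt0 H1 _ k0 x0))/=.
  have := mixterm_le H 0 d k20 kk x0.
  by rewrite add0n /mixterm expr0 mul1r.
- exact: cvg_cst.
- rewrite -[X in _ --> X](mulr0 C); apply: cvgMr.
  exact: (cvg_comp _ _ (cvg_mull_pinfty k20) (lmoment_cvg0 H 0)).
Unshelve. all: by end_near. Qed.

Lemma mixture_cvg_pinfty : F x @[x --> +oo] --> (1 : R).
Proof.
have h : 1 - \sum_(i < m) \sum_(d < D) c i d * phi d (l i) y @[y --> +oo] -->
    1 - \sum_(i < m) \sum_(d < D) c i d * 0.
  apply: cvgB; first exact: cvg_cst.
  apply: cvg_sumr => i; apply: cvg_sumr => d; apply: cvgMr.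
  exact: mixterm_cvg0.
have e : 1 - \sum_(i < m) \sum_(d < D) c i d * 0 = 1.
  by rewrite big1 ?subr0// => i _; rewrite big1// => d _; rewrite mulr0.
rewrite e in h; apply: cvg_trans h; apply: near_eq_cvg; near=> y.
rewrite -mixture_tailE ?subKr//; near: y; exact: nbhs_pinfty_gt.
Unshelve. all: by end_near. Qed.

Lemma mixture_cvg_ninfty : F x @[x --> -oo] --> (0 : R).
Proof.
have h : (fun _ : R => 0 : R) y @[y --> -oo] --> (0 : R) by exact: cvg_cst.
apply: cvg_trans h; apply: near_eq_cvg; near=> y.
by rewrite mixture_lt0//; near: y; exact: nbhs_ninfty_lt.
Unshelve. all: by end_near. Qed.

(** The limit C is nonzero by [dominant_term] and nonnegative as a limit of ratios
    of positive numbers. *)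
Lemma mixture_dominant : (forall k, steady H k) ->
  exists d (k C : R), [/\ 0 < k, 0 < C &
    (1 - F x) / phi d k x @[x --> +oo] --> C].
Proof.
move=> st.
have [d [k [C [k0 C0 cC]]]] : exists (d : nat) (l0 C : R), [/\ 0 < l0, C != 0 &
    (\sum_(i < m) \sum_(d < D) c i d * phi d (l i) x) / phi d l0 x @[x --> +oo] --> C].
  apply: dominant_term => //.
  - by move=> d k x k0 x0; exact: mixterm_gt0.
  - by move=> d k d' k' k0 h; exact: mixterm_dominated.
  - by exists 0; rewrite gt_eqF// exp_poly_gt0.
have cF : (1 - F x) / phi d k x @[x --> +oo] --> C.
  apply: cvg_trans cC; apply: near_eq_cvg; near=> x.
  by rewrite mixture_tailE//; near: x; exact: nbhs_pinfty_gt.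
exists d, k, C; split => //; rewrite lt_neqAle eq_sym C0/=.
rewrite -(cvg_lim _ cF)//; apply: limr_ge; first by apply/cvg_ex; exists C.
near=> x; have x0 : 0 < x by near: x; exact: nbhs_pinfty_gt.
by rewrite divr_ge0 ?(ltW (mixture_tail_gt0 _))// ltW// mixterm_gt0.
Unshelve. all: by end_near. Qed.

End MixtureCdf.

(** * Attraction to the Gumbel law *)

Section PowerLimit.
Context {R : realType}.

(** Sandwich 1 - t between e^(-t/(1-t)) and e^(-t). *)
Lemma pow_cvg_expR (t : nat -> R) (a : R) :
  (forall n, 0 <= t n) -> n%:R * t n @[n --> \oo] --> a ->
  (1 - t n) ^+ n @[n --> \oo] --> expR (- a).
Proof.
move=> t0 cnt.
have ct : t n @[n --> \oo] --> (0 : R).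
  have h : (n.+1%:R)^-1 * (n.+1%:R * t n.+1) @[n --> \oo] --> 0 * a.
    apply: cvgM; first exact: cvg_harmonic.
    by move: cnt; rewrite -(cvg_shiftS (fun n => n%:R * t n)).
  rewrite mul0r in h; rewrite -(cvg_shiftS t).
  apply: cvg_trans h; apply: near_eq_cvg; apply: nearW => n.
  by rewrite mulKf// pnatr_eq0.
have cq : n%:R * t n / (1 - t n) @[n --> \oo] --> a.
  have h : n%:R * t n * (1 - t n)^-1 @[n --> \oo] --> a * (1 - 0)^-1.
    apply: cvgM => //; apply: cvgV; first by rewrite subr0 oner_eq0.
    by apply: cvgB => //; exact: cvg_cst.
  by rewrite subr0 invr1 mulr1 in h.
apply: (@squeeze_cvgr _ _ _ _ (fun n => expR (- (n%:R * t n / (1 - t n))))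
  (fun n => expR (- (n%:R * t n)))).
- near=> n.
  have t1 : t n < 1 by near: n; apply: (cvgr_lt 0 ct); exact: ltr01.
  have u0 : 0 < 1 - t n by rewrite subr_gt0.
  have lo : expR (- (t n / (1 - t n))) <= 1 - t n.
    rewrite expRN -[leRHS]invrK lef_pV2 ?posrE ?expR_gt0 ?invr_gt0//.
    apply: le_trans (expR_ge1Dx _); rewrite le_eqVlt; apply/orP; left; apply/eqP.
    by field; rewrite gt_eqF.
  have up : 1 - t n <= expR (- t n) by exact: expR_ge1Dx.
  have -> : - (n%:R * t n / (1 - t n)) = n%:R * - (t n / (1 - t n)).
    by rewrite mulrN mulrA.
  have -> : - (n%:R * t n) = n%:R * - t n by rewrite mulrN.
  by rewrite !expRM_natl; apply/andP; split; apply: lerXn2r => //;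
    rewrite nnegrE ?expR_ge0 ?(ltW u0).
- exact: (cvg_comp _ _ (cvgN cq) (@continuous_expR R _)).
- exact: (cvg_comp _ _ (cvgN cnt) (@continuous_expR R _)).
Unshelve. all: by end_near. Qed.

End PowerLimit.

Section Gumbel.
Context {R : realType} (H : probability (measurableTypeR R) R).
Hypothesis H1 : H `]0, +oo[ = 1%E.
Hypothesis st : forall k, steady H k.
Implicit Types x y u : R.

Local Notation phi := (mixterm H).
Local Notation M := (lmoment H).
Local Notation q := (hazard H).

Context (F : R -> R) (d : nat) (k C : R).
Hypothesis Fnd : {homo F : x y / x <= y}.
Hypothesis Fpos : forall x, 0 < 1 - F x.
Hypothesis Fcont : forall x, 0 < x -> {for x, continuous F}.
Hypothesis F1 : F x @[x --> +oo] --> (1 : R).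
Hypothesis k0 : 0 < k.
Hypothesis C0 : 0 < C.
Hypothesis FC : (1 - F x) / phi d k x @[x --> +oo] --> C.

Let shift u x := x + u / (k * q d (k * x)).

Let kshift u x : 0 < x -> k * shift u x = k * x + u / q d (k * x).
Proof.
move=> x0; rewrite /shift; field; rewrite (gt_eqF k0)/= gt_eqF//.
by apply: hazard_gt0 => //; exact: mulr_gt0.
Qed.

Let cvg_shift u : shift u x @[x --> +oo] --> +oo.
Proof.
have h : k^-1 * (k * x + u / q d (k * x)) @[x --> +oo] --> +oo.
  apply: gt0_cvgMry; first by rewrite invr_gt0.
  exact: (cvg_comp _ _ (cvg_mull_pinfty k0) (cvg_shift_hazard H1 st d u)).
apply: cvg_trans h; apply: near_eq_cvg; near=> x.
by rewrite -kshift ?mulKf// ?gt_eqF//; near: x; exact: nbhs_pinfty_gt.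
Unshelve. all: by end_near. Qed.

(** The factor x^d is asymptotically unchanged by the shift, since x q_d(k x)
    tends to infinity. *)
Lemma mixterm_gamma u : phi d k (shift u x) / phi d k x @[x --> +oo] --> expR (- u).
Proof.
have cz : (k * x * q d (k * x))^-1 @[x --> +oo] --> (0 : R).
  apply/gtr0_cvgV0; last first.
    exact: (cvg_comp _ _ (cvg_mull_pinfty k0) (cvg_mul_hazard H1 st d)).
  near=> x; have x0 : 0 < x by near: x; exact: nbhs_pinfty_gt.
  by rewrite mulr_gt0 ?hazard_gt0 ?mulr_gt0.
have c1 : 1 + u * (k * x * q d (k * x))^-1 @[x --> +oo] --> 1 + u * 0.
  by apply: cvgD; [exact: cvg_cst|exact: cvgMr].
have cd : (1 + u * (k * x * q d (k * x))^-1) ^+ d @[x --> +oo] --> (1 + u * 0) ^+ d.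
  exact: (cvg_comp _ _ c1 (@exprn_continuous _ _ _)).
have cM := cvg_comp _ _ (cvg_mull_pinfty k0) (@lmoment_gamma R H H1 st d u).
have := cvgM cd cM; rewrite mulr0 addr0 expr1n mul1r => h.
apply: cvg_trans (h _); apply: near_eq_cvg; near=> x.
have x0 : 0 < x by near: x; exact: nbhs_pinfty_gt.
have kx : 0 < k * x by rewrite mulr_gt0.
have q0 := hazard_gt0 H1 d kx; have M0 := lmoment_gt0 H1 d kx.
have -> : phi d k (shift u x) / phi d k x =
    (shift u x / x) ^+ d * (M d (k * shift u x) / M d (k * x)).
  by rewrite /mixterm invfM mulrACA expr_div_n.
rewrite kshift//.
change ((1 + u / (k * x * q d (k * x))) ^+ d *
  (M d (k * x + u / q d (k * x)) / M d (k * x)) = (shift u x / x) ^+ d *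
  (M d (k * x + u / q d (k * x)) / M d (k * x))).
congr (_ ^+ _ * _).
by rewrite /shift; field; rewrite !gt_eqF.
Unshelve. all: by end_near. Qed.

Lemma tail_gamma u : (1 - F (shift u x)) / (1 - F x) @[x --> +oo] --> expR (- u).
Proof.
have h1 := cvg_comp _ _ (cvg_shift u) FC.
have h2 : ((1 - F x) / phi d k x)^-1 @[x --> +oo] --> C^-1.
  by apply: cvgV; [rewrite gt_eqF|exact: FC].
have := cvgM (cvgM h1 h2) (@mixterm_gamma u).
rewrite divff ?gt_eqF// mul1r => h.
apply: cvg_trans (h _ _); apply: near_eq_cvg; near=> x.
have x0 : 0 < x by near: x; exact: nbhs_pinfty_gt.
have y0 : 0 < shift u x.
  by near: x; move: 0; apply/cvgryPgt; exact: cvg_shift.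
change ((1 - F (shift u x)) / phi d k (shift u x) * ((1 - F x) / phi d k x)^-1 *
  (phi d k (shift u x) / phi d k x) = (1 - F (shift u x)) / (1 - F x)).
have := Fpos x; move: (1 - F x) => t t0.
field.
by rewrite !gt_eqF ?mixterm_gt0.
Unshelve. all: by end_near. Qed.

(** By continuity there is d_n with 1 - F(d_n) = 1/n, once n is large.  With
    c_n = 1/(k q_d(k d_n)), [tail_gamma] says that n (1 - F(c_n x + d_n)) tends to
    e^(-x). *)
Lemma mixture_gumbel : gumbel_mda F.
Proof.
have ex n : exists y, 1 <= y /\ (1 <= n%:R * (1 - F 1) -> n%:R * (1 - F y) = 1).
  have [n1|] := leP 1 (n%:R * (1 - F 1)); last by exists 1; split => //.
  have n0 : 0 < n%:R :> R.
    rewrite ltNge; apply/negP => n0; move: n1; rewrite leNgt => /negP; apply.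
    by apply: le_lt_trans ltr01; rewrite mulr_le0_ge0// ltW.
  have [B B1 FB] : exists2 B, 1 < B & 1 - n%:R^-1 < F B.
    have : (1 - n%:R^-1 : R) < 1 by rewrite ltrBlDr ltrDl invr_gt0.
    move/(cvgr_gt 1 F1) => /(pinfty_ex_gt (num_real 1)) [B B1 FB].
    by exists B.
  have : exists2 y, y \in `[1, B]%R & F y = 1 - n%:R^-1.
    apply: IVT; first exact: ltW.
      apply: continuous_in_subspaceT => y; rewrite inE/= in_itv/= => /andP[y1 _].
      by apply: Fcont; exact: lt_le_trans y1.
    rewrite ge_min le_max (ltW FB) orbT andbT; apply/orP; left.
    have : n%:R^-1 <= 1 - F 1 by rewrite -div1r ler_pdivrMr// mulrC.
    by move=> h; lra.
  move=> [y]; rewrite in_itv/= => /andP[y1 _] Fy; exists y; split => // _.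
  by rewrite Fy opprB addrC subrK divff// gt_eqF.
have [dn dnP] := choice ex.
have d1 n : 1 <= dn n by have [] := dnP n.
have d0 n : 0 < dn n by apply: lt_le_trans (d1 n).
have dnE : \forall n \near \oo, n%:R * (1 - F (dn n)) = 1.
  near=> n; have [_] := dnP n; apply.
  rewrite -ler_pdivrMr// mul1r; near: n; exact: nbhs_infty_ger.
have dnoo : dn n @[n --> \oo] --> +oo.
  apply/cvgryPge => A; near=> n.
  rewrite leNgt; apply/negP => dA.
  have e : n%:R * (1 - F (dn n)) = 1 by near: n.
  have n0 : 0 < n%:R :> R by near: n; exact: nbhs_infty_gtr.
  have : 1 < n%:R * (1 - F A).
    rewrite -ltr_pdivrMr// mul1r; near: n; exact: nbhs_infty_gtr.
  rewrite -[ltLHS]e ltr_pM2l// ltrD2l ltrN2 ltNge; apply/negP/negPn.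
  by apply: Fnd; exact: ltW.
exists (fun n => (k * q d (k * dn n))^-1), dn; split.
  by move=> n; rewrite invr_gt0 mulr_gt0// hazard_gt0// mulr_gt0.
move=> x.
pose t n := 1 - F ((k * q d (k * dn n))^-1 * x + dn n).
have ct : n%:R * t n @[n --> \oo] --> expR (- x).
  have h := cvg_comp _ _ dnoo (@tail_gamma x).
  apply: cvg_trans h; apply: near_eq_cvg; near=> n.
  have e : n%:R * (1 - F (dn n)) = 1 by near: n.
  have Fn : (1 - F (dn n))^-1 = n%:R.
    have Fd := lt0r_neq0 (Fpos (dn n)).
    by apply: (mulIf Fd); rewrite e mulVf.
  change ((1 - F (dn n + x / (k * q d (k * dn n)))) / (1 - F (dn n)) = n%:R * t n).
  by rewrite Fn mulrC /t [_^-1 * x]mulrC [_ + dn n]addrC.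
have := pow_cvg_expR (fun n => ltW (Fpos _)) ct.
by under eq_fun do rewrite /t subKr.
Unshelve. all: by end_near. Qed.

End Gumbel.

(** * Tails of convolutions *)

Section Convolution.
Context {R : realType} (mu : probability (measurableTypeR R) R).
Context (F : R -> R).
Hypothesis muF : forall x, mu `]-oo, x] = (F x)%:E.
Hypothesis mu0 : mu `]-oo, 0[ = 0%E.
Implicit Types (x y z a : R) (n : nat).

Local Notation RT := (measurableTypeR R).

Lemma bounded_integrableT (f : R -> R) (C : R) :
  measurable_fun setT f -> (forall y, `|f y| <= C) ->
  mu.-integrable [set: RT] (EFin \o f).
Proof. by move=> mf fC; apply: (@bounded_integrable _ _ _ _ _ _ C). Qed.

Lemma Rintegral_support (f : R -> R) (C : R) :
  measurable_fun setT f -> (forall y, `|f y| <= C) ->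
  \int[mu]_(y in `[0, +oo[) f y = \int[mu]_y f y.
Proof.
move=> mf fC; rewrite /Rintegral; congr fine.
have mN : measurable (`]-oo, 0[ : set RT) by [].
rewrite (@negligible_integral _ _ _ mu setT _ _ mN measurableT _ mu0); last first.
  exact: bounded_integrableT fC.
congr (integral _ _ _); apply/seteqP; split => y /=; rewrite !in_itv/= andbT.
  by move=> y0; split => //; apply/negP; rewrite -leNgt.
by move=> [_ /negP]; rewrite -leNgt.
Qed.

Lemma cdf_tail x : mu `]x, +oo[ = (1 - F x)%:E.
Proof.
have e : (`]x, +oo[%classic : set RT) = ~` `]-oo, x].
  by apply/seteqP; split => y /=; rewrite !in_itv/= andbT ltNge => /negP.
by rewrite e probability_setC// muF.
Qed.

Lemma Rintegral_tail x : \int[mu]_y (x < y)%R%:R = 1 - F x.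
Proof.
rewrite /Rintegral -[RHS]/(fine (1 - F x)%:E) -cdf_tail; congr fine.
rewrite -[in RHS](setIT `]x, +oo[) -integral_indic//; apply: eq_integral => y _.
by rewrite indicE; congr ((_ : bool)%:R)%:E; apply/idP/idP;
  rewrite inE/= in_itv/= andbT.
Qed.

Lemma conv_cdf_bounds n : {homo conv_cdf mu n : x y / x <= y} /\
  forall x, 0 <= conv_cdf mu n x <= 1.
Proof.
elim: n => [|n [mono bnd]].
  split => [x y xy|x] /=; last by case: (0 <= x); rewrite ?lexx ler01.
  by case: (leP 0 x) => [x0|_]; [rewrite (le_trans x0 xy)|rewrite ler0n].
have mc x : measurable_fun setT (fun y => conv_cdf mu n (x - y)).
  apply: nonincreasing_measurable => // y z yz.
  by apply: mono; rewrite lerB.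
have bn x y : `|conv_cdf mu n (x - y)| <= 1.
  by have /andP[? ?] := bnd (x - y); rewrite ger0_norm.
have ic x :
    mu.-integrable (`[0, +oo[ : set RT) (EFin \o (fun y => conv_cdf mu n (x - y))).
  apply: (@bounded_integrable _ _ _ _ _ _ 1) => //.
  exact: (measurable_funS measurableT _ (mc x)).
split => [x y xy|x] /=.
  by apply: le_Rintegral => // z _; apply: mono; rewrite lerB.
rewrite (Rintegral_support (mc x) (bn x)).
rewrite Rintegral_ge0 /=; last by move=> y _; have /andP[] := bnd (x - y).
have e1 : \int[mu]_y (1 : R) = 1.
  by rewrite Rintegral_cst//= probability_setT mul1r.
rewrite -[leRHS]e1; apply: le_Rintegral => //.
- exact: bounded_integrableT (bn x).
- exact: finite_measure_integrable_cst.
- by move=> y _; have /andP[] := bnd (x - y).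
Qed.

Definition conv_tail n x := 1 - conv_cdf mu n x.
Local Notation T := conv_tail.

Lemma conv_tail_bounds n x : 0 <= T n x <= 1.
Proof.
have [_ /(_ x)/andP[a b]] := conv_cdf_bounds n.
by rewrite /T subr_ge0 b gerBl a.
Qed.

Lemma conv_tail_nonincreasing n : {homo T n : x y /~ x <= y}.
Proof. by move=> x y xy; have [m _] := conv_cdf_bounds n; rewrite lerB// m. Qed.

Lemma measurable_conv_tail n x : measurable_fun setT (fun y => T n (x - y)).
Proof.
apply: nondecreasing_measurable => // y z yz.
by apply: conv_tail_nonincreasing; rewrite lerB.
Qed.

Lemma conv_tail_norm n x : `|T n x| <= 1.
Proof. by have /andP[? ?] := conv_tail_bounds n x; rewrite ger0_norm. Qed.

Lemma integrable_conv_tail n x :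
  mu.-integrable [set: RT] (EFin \o (fun y => T n (x - y))).
Proof.
apply: bounded_integrableT; first exact: measurable_conv_tail.
by move=> y; exact: conv_tail_norm.
Qed.

(** Integrating over the whole line instead of [0, +oo[, which carries all the
    mass, avoids boundary terms below. *)
Lemma conv_tailS n x : T n.+1 x = \int[mu]_y T n (x - y).
Proof.
have e1 : \int[mu]_y (1 : R) = 1.
  by rewrite Rintegral_cst//= probability_setT mul1r.
have [mono bnd] := conv_cdf_bounds n.
have mc : measurable_fun setT (fun y => conv_cdf mu n (x - y)).
  apply: nonincreasing_measurable => // y z yz.
  by apply: mono; rewrite lerB.
have bn y : `|conv_cdf mu n (x - y)| <= 1.
  by have /andP[? ?] := bnd (x - y); rewrite ger0_norm.
rewrite {1}/T /= (Rintegral_support mc bn) -{1}e1 -RintegralB//.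
  exact: finite_measure_integrable_cst.
exact: bounded_integrableT bn.
Qed.

Lemma conv_tail_neg n x : x < 0 -> T n x = 1.
Proof.
move=> x0; rewrite /T [conv_cdf _ _ _](_ : _ = 0) ?subr0//.
elim: n x x0 => [|n IH] x x0 /=; first by rewrite leNgt x0.
rewrite (eq_Rintegral _ (g := fun=> 0)) ?Rintegral_cst ?mul0r//.
move=> y; rewrite inE/= in_itv/= andbT => y0; apply: IH.
by rewrite subr_lt0 (lt_le_trans x0).
Qed.

Lemma conv_tail0 x : T 0 x = (x < 0)%R%:R.
Proof. by rewrite /T/= ltNge; case: (0 <= x); rewrite ?subrr ?subr0. Qed.

Lemma conv_tail1 x : T 1 x = 1 - F x.
Proof.
rewrite conv_tailS -Rintegral_tail; apply: eq_Rintegral => y _.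
by rewrite conv_tail0 subr_lt0.
Qed.

Lemma measurable_indicator_le a :
  measurable_fun setT (fun y : R => (y <= a)%R%:R : R).
Proof.
apply: nonincreasing_measurable => // y z yz.
by case: (leP z a) => [za|_]; [rewrite (le_trans yz za)|rewrite ler0n].
Qed.

Lemma measurable_indicator_lt a :
  measurable_fun setT (fun y : R => (a < y)%R%:R : R).
Proof.
apply: nondecreasing_measurable => // y z yz.
by case: (ltP a y) => [ay|_]; [rewrite (lt_le_trans ay yz)|rewrite ler0n].
Qed.

Lemma integrable_indicator_le a (f : R -> R) C : measurable_fun setT f ->
  (forall y, `|f y| <= C) ->
  mu.-integrable [set: RT] (EFin \o (fun y => (y <= a)%R%:R * f y)).
Proof.
move=> mf fC; apply: (@bounded_integrableT _ C).
  by apply: measurable_realfun.measurable_funM => //; exact: measurable_indicator_le.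
move=> y; case: (y <= a); rewrite ?mul1r// mul0r normr0.
by apply: le_trans (fC y).
Qed.

Lemma integrable_indicator_lt a (f : R -> R) C : measurable_fun setT f ->
  (forall y, `|f y| <= C) ->
  mu.-integrable [set: RT] (EFin \o (fun y => (a < y)%R%:R * f y)).
Proof.
move=> mf fC; apply: (@bounded_integrableT _ C).
  by apply: measurable_realfun.measurable_funM => //; exact: measurable_indicator_lt.
move=> y; case: (a < y); rewrite ?mul1r// mul0r normr0.
by apply: le_trans (fC y).
Qed.

Lemma integral_tail_indic a :
  (\int[mu]_z (\1_(`]a, +oo[%classic : set RT) z)%:E)%E = (T 1 a)%:E.
Proof. by rewrite integral_indic// setIT conv_tail1; exact: cdf_tail. Qed.

(** Both sides are the probability that y > x/2 and y + z > x for independent y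
    and z, by Tonelli's theorem. *)
Lemma swap_tail x :
  \int[mu]_y ((x / 2 < y)%R%:R * T 1 (x - y)) =
  \int[mu]_z T 1 (Num.max (x / 2) (x - z)).
Proof.
pose A : set (RT * RT) := [set p | x / 2 < p.1] `&` [set p | x < p.1 + p.2].
have mA : measurable A.
  apply: measurableI.
    rewrite (_ : [set _ | _] = fst @^-1` `]x / 2, +oo[); last first.
      by apply/seteqP; split => p /=; rewrite in_itv/= andbT.
    by rewrite -[_ @^-1` _]setTI; exact: measurable_fst.
  rewrite (_ : [set _ | _] = (fun p : RT * RT => p.1 + p.2) @^-1` `]x, +oo[); last first.
    by apply/seteqP; split => p /=; rewrite in_itv/= andbT.
  rewrite -[_ @^-1` _]setTI.
  by apply: measurable_funD.
rewrite /Rintegral; congr fine.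
transitivity (\int[mu]_y \int[mu]_z (\1_A (y, z))%:E)%E.
  apply: eq_integral => y _; have [xy|yx] := ltP (x / 2) y.
    rewrite mul1r -integral_tail_indic; apply: eq_integral => z _.
    rewrite !indicE; congr ((_ : bool)%:R)%:E; apply/idP/idP; rewrite !inE/= in_itv/= andbT.
      by rewrite ltrBlDl => ?; split.
    by move=> [_]; rewrite ltrBlDl.
  rewrite mul0r (eq_integral (fun=> 0%E)) ?integral0// => z _.
  by rewrite indicE memNset// => -[/=]; rewrite ltNge yx.
rewrite (fubini_tonelli (fun p => (\1_A p)%:E)); last 2 first.
- by apply/measurable_EFinP; exact: measurable_indic.
- by move=> p; rewrite lee_fin indicE ler0n.
apply: eq_integral => z _; rewrite -integral_tail_indic; apply: eq_integral => y _.
rewrite !indicE; congr ((_ : bool)%:R)%:E; apply/idP/idP; rewrite !inE/= in_itv/= andbT gt_max.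
  by move=> [/= -> h]; rewrite ltrBlDr.
by move=> /andP[h1 h2]; split => //=; rewrite -ltrBlDr.
Qed.

(** The event y + z > x splits into y <= x/2, z <= x/2 and y, z > x/2. *)
Lemma fold2_tail x : T 2 x =
  (\int[mu]_y ((y <= x / 2)%R%:R * T 1 (x - y))) *+ 2 + T 1 (x / 2) ^+ 2.
Proof.
have mT := measurable_conv_tail 1 x.
have bT y := conv_tail_norm 1 (x - y).
have i1 := integrable_indicator_le (x / 2) mT bT.
have i2 := integrable_indicator_lt (x / 2) mT bT.
have -> : T 2 x = \int[mu]_y ((y <= x / 2)%R%:R * T 1 (x - y)) +
   \int[mu]_y ((x / 2 < y)%R%:R * T 1 (x - y)).
  rewrite -RintegralD// conv_tailS; apply: eq_Rintegral => y _.
  by case: leP; rewrite ?mul1r ?mul0r ?addr0 ?add0r.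
rewrite swap_tail [X in _ = X + _]mulr2n -addrA; congr (_ + _).
have m3 := measurable_indicator_lt (x / 2).
have i3 := integrable_indicator_lt (x / 2) (@measurable_cst _ _ _ _ setT (T 1 (x / 2)))
   (fun=> conv_tail_norm 1 (x / 2)).
have -> : T 1 (x / 2) ^+ 2 = \int[mu]_y ((x / 2 < y)%R%:R * T 1 (x / 2)).
  rewrite RintegralZr//; last first.
    apply: (@bounded_integrableT _ 1) => // y.
    by rewrite ger0_norm ?ler0n// lern1 leq_b1.
  by rewrite Rintegral_tail -conv_tail1 expr2.
rewrite -RintegralD//; apply: eq_Rintegral => y _.
case: (leP y (x / 2)) => [yx|xy].
  rewrite mul1r mul0r addr0; congr (T 1 _).
  by apply/max_idPr; lra.
rewrite mul0r mul1r add0r; congr (T 1 _).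
by apply/max_idPl; lra.
Qed.

(** On y <= x the tail T_n(x - y) is at least T_n(x), and on y > x it is 1. *)
Lemma conv_tail_step_lower n x : T n x * F x + (1 - F x) <= T n.+1 x.
Proof.
have c1 : measurable_fun setT (cst (T n x) : R -> R) by exact: measurable_cst.
have i1 := integrable_indicator_le x c1 (fun=> conv_tail_norm n x).
have c2 : measurable_fun setT (cst 1 : R -> R) by exact: measurable_cst.
have n1 : `|1 : R| <= 1 by rewrite normr1.
have i2 := integrable_indicator_lt x c2 (fun=> n1).
have e1 : \int[mu]_y (y <= x)%R%:R = F x.
  have e : \int[mu]_y (1 : R) = 1.
    by rewrite Rintegral_cst//= probability_setT mul1r.
  transitivity (\int[mu]_y (1 - (x < y)%R%:R)).
    by apply: eq_Rintegral => y _; case: leP; rewrite ?subr0 ?subrr.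
  rewrite RintegralB//; last 2 first.
  - exact: finite_measure_integrable_cst.
  - by apply: eq_integrable i2 => // y _; rewrite /= mulr1.
  by rewrite e Rintegral_tail subKr.
have -> : T n x * F x + (1 - F x) =
    \int[mu]_y ((y <= x)%R%:R * T n x + (x < y)%R%:R * 1).
  rewrite RintegralD// RintegralZr//; last first.
    have := integrable_indicator_le x c2 (fun=> n1).
    by apply: eq_integrable => // y _; rewrite /= mulr1.
  rewrite e1 mulrC; congr (_ + _); rewrite -Rintegral_tail.
  by apply: eq_Rintegral => y _; rewrite mulr1.
rewrite conv_tailS;
have cN : \int[mu]_y T n (x - y) =
    \int[mu]_(y in `[0, +oo[) T n (x - y).
  by rewrite (Rintegral_support (measurable_conv_tail n x) (fun=> conv_tail_norm n _)).
rewrite cN -(@Rintegral_support _ (`|T n x| + 1)); last 2 first.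
- apply: measurable_funD; apply: measurable_realfun.measurable_funM => //.
    exact: measurable_indicator_le.
  exact: measurable_indicator_lt.
- move=> y; apply: le_trans (ler_normD _ _) _; rewrite mulr1 lerD//.
    by case: (y <= x); rewrite ?mul1r// mul0r normr0.
  by rewrite ger0_norm ?ler0n// lern1 leq_b1.
have mP : measurable (`[0, +oo[ : set RT) by [].
apply: le_Rintegral => //.
- apply: (integrableS measurableT) => //.
  exact: integrable_EFinD.
- by apply: (integrableS measurableT) => //; exact: integrable_conv_tail.
- move=> y; rewrite /= in_itv/= andbT => y0.
  case: leP => xy; last by rewrite mul0r add0r mulr1 conv_tail_neg ?subr_lt0.
  by rewrite mul1r mul0r addr0; apply: conv_tail_nonincreasing; rewrite gerBl.
Qed.

(** On y <= x - z0 use the bound K T_1; the rest of the mass costs at most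
    T_1(x - z0).  The probability of y > x has to be taken off T_2, as there
    T_1(x - y) = 1. *)
Lemma conv_tail_step_upper n x z0 K : 0 <= z0 -> 1 <= K ->
  (forall z, z0 <= z -> T n z <= K * T 1 z) ->
  T n.+1 x <= K * (T 2 x - T 1 x) + T 1 (x - z0).
Proof.
move=> z00 K1 Kz.
have c2 : measurable_fun setT (cst 1 : R -> R) by exact: measurable_cst.
have n1 : `|1 : R| <= 1 by rewrite normr1.
have i2 a : mu.-integrable [set: RT] (EFin \o (fun y => (a < y)%R%:R)).
  have := integrable_indicator_lt a c2 (fun=> n1).
  by apply: eq_integrable => // y _; rewrite /= mulr1.
have iT := integrable_conv_tail 1 x.
have -> : K * (T 2 x - T 1 x) + T 1 (x - z0) =
   \int[mu]_y (K * (T 1 (x - y) - (x < y)%R%:R) + (x - z0 < y)%R%:R).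
  have iB := integrable_EFinB measurableT iT (i2 x).
  rewrite RintegralD//; last exact: integrable_EFinZl.
  rewrite RintegralZl// RintegralB// -conv_tailS !Rintegral_tail -!conv_tail1.
  by [].
rewrite conv_tailS; apply: le_Rintegral => //.
- exact: integrable_conv_tail.
- apply: integrable_EFinD => //; apply: integrable_EFinZl => //.
  exact: integrable_EFinB.
move=> y _; have /andP[T0 T1] := conv_tail_bounds 1 (x - y).
have /andP[t0 t1] := conv_tail_bounds n (x - y).
case: (ltP x y) => xy.
  rewrite (@conv_tail_neg 1) ?subr_lt0// subrr mulr0 add0r.
  by rewrite (_ : x - z0 < y) // ltrBlDr ltr_wpDr.
rewrite subr0; case: (ltP (x - z0) y) => xzy.
  by rewrite (le_trans t1)// lerDr mulr_ge0// (le_trans ler01).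
by rewrite addr0; apply: Kz; lra.
Qed.

Section Limit.
Hypothesis Fpos : forall x, 0 < 1 - F x.
Hypothesis F1 : F x @[x --> +oo] --> (1 : R).
Hypothesis long_tailed : forall a, (1 - F (x - a)) / (1 - F x) @[x --> +oo] --> (1 : R).
Hypothesis half_square : (1 - F (x / 2)) ^+ 2 / (1 - F x) @[x --> +oo] --> (0 : R).
Context (g : R -> R) (x1 : R).
Hypothesis g0 : forall y, 0 <= g y.
Hypothesis ig : mu.-integrable [set: RT] (EFin \o g).
Hypothesis dom : forall x y, x1 <= x -> y <= x / 2 ->
  1 - F (x - y) <= g y * (1 - F x).

(** By dominated convergence: the integrand divided by T_1(x) tends to 1 for each
    y, and is at most g. *)
Lemma half_integral_cvg :
  \int[mu]_y ((y <= x / 2)%R%:R * T 1 (x - y)) / T 1 x @[x --> +oo] --> (1 : R).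
Proof.
apply/cvg_pinftyP => u uoo.
pose v n := Order.max (u n) x1.
have vu : \forall n \near \oo, v n = u n.
  by move/cvgryPge : uoo => /(_ x1); apply: filterS => n; exact: max_l.
have voo : v n @[n --> \oo] --> +oo.
  by apply: cvg_trans uoo; apply: near_eq_cvg; apply: filterS vu => n ->.
have v1 n : x1 <= v n by rewrite /v le_max lexx orbT.
have e1 : \int[mu]_y (1 : R) = 1.
  by rewrite Rintegral_cst//= probability_setT mul1r.
have Tp x : 0 < T 1 x by rewrite conv_tail1.
pose f n y := (y <= v n / 2)%R%:R * T 1 (v n - y) * (T 1 (v n))^-1.
have mf n : measurable_fun setT (f n).
  apply: measurable_realfun.measurable_funM => //.
  apply: measurable_realfun.measurable_funM.
    exact: measurable_indicator_le.
  exact: measurable_conv_tail.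
have : \int[mu]_y f n y @[n --> \oo] --> \int[mu]_y (1 : R).
  apply: (@dominated_cvg_Rintegral _ RT R mu setT f (fun=> 1) g) => //.
  - move=> n y _; rewrite /f; case: (leP y (v n / 2)) => yv; last by rewrite !mul0r normr0.
    rewrite mul1r ger0_norm; last by rewrite divr_ge0 ?(ltW (Tp _)).
    by rewrite ler_pdivrMr// !conv_tail1 dom.
  - move=> y _.
    have h := cvg_comp _ _ voo (long_tailed y).
    apply: cvg_trans h; apply: near_eq_cvg; near=> n.
    rewrite /f /= !conv_tail1 (_ : y <= v n / 2) ?mul1r//.
    rewrite ler_pdivlMr//; near: n; move: (y * 2); apply/cvgryPge; exact: voo.
rewrite e1; apply: cvg_trans; apply: near_eq_cvg; apply: filterS vu => n vn.
rewrite /f vn RintegralZr//.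
by apply: (integrable_indicator_le _ (measurable_conv_tail 1 (u n)) (fun=> conv_tail_norm 1 _)).
Unshelve. all: by end_near. Qed.

Lemma fold2_cvg : T 2 x / T 1 x @[x --> +oo] --> (2 : R).
Proof.
have := cvgD (cvgD half_integral_cvg half_integral_cvg) half_square.
rewrite addr0 -[1 + 1]/(2 : R) => h.
apply: cvg_trans (h _ _); apply: near_eq_cvg; apply: nearW => x.
pose I := \int[mu]_y ((y <= x / 2)%R%:R * T 1 (x - y)).
have -> : T 2 x / T 1 x = I / T 1 x + I / T 1 x + (1 - F (x / 2)) ^+ 2 / (1 - F x).
  by rewrite fold2_tail mulrDl [_ *+ 2]mulr2n mulrDl -!conv_tail1.
by [].
Qed.

(** Induction on n.  Once T_n(z) <= (n + e) T_1(z) for z >= z0, the step lemmas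
    place the limit points of T_(n+1)/T_1 between n + 1 and n + e + 1. *)
Lemma conv_tail_cvg n : (1 <= n)%N -> T n x / T 1 x @[x --> +oo] --> (n%:R : R).
Proof.
have Tp x : 0 < T 1 x by rewrite conv_tail1.
case: n => // n _; elim: n => [|n IH].
  have h : (fun _ : R => 1 : R) x @[x --> +oo] --> (1 : R) by exact: cvg_cst.
  apply: cvg_trans h; apply: near_eq_cvg; apply: nearW => x.
  by rewrite divff// gt_eqF.
apply/cvgrPdist_le => e e0.
pose K := n.+1%:R + e / 2.
have K1 : 1 <= K by rewrite /K -[leLHS]addr0 lerD ?divr_ge0 ?(ltW e0)// ler1n.
have [z0 [z00 hz0]] : exists z0, 0 <= z0 /\ forall z, z0 <= z -> T n.+1 z <= K * T 1 z.
  have : n.+1%:R < K by rewrite /K ltrDl divr_gt0.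
  move/(cvgr_le _ IH) => [A [_ hA]].
  exists (Order.max 0 (A + 1)); rewrite le_max lexx; split => // z.
  rewrite ge_max => /andP[_ Az].
  have := hA z (lt_le_trans _ Az); rewrite ltrDl ltr01 => /(_ isT).
  by rewrite ler_pdivrMr.
have up : K * (T 2 x / T 1 x - 1) + T 1 (x - z0) / T 1 x @[x --> +oo] --> K * (2 - 1) + 1.
  apply: cvgD; last by under eq_fun do rewrite !conv_tail1; exact: long_tailed.
  by apply: cvgMr; apply: cvgB; [exact: fold2_cvg|exact: cvg_cst].
have lo : T n.+1 x / T 1 x * F x + 1 @[x --> +oo] --> (n.+1%:R * 1 + 1 : R).
  by apply: cvgD; [exact: cvgM|exact: cvg_cst].
have upe : K * (2 - 1) + 1 < n.+2%:R + e.
  rewrite /K [n.+2%:R]mulrS; have := e0; lra.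
have loe : n.+2%:R - e < n.+1%:R * 1 + 1.
  by rewrite mulr1 natr1 gtrBl.
near=> x.
have h1 : K * (T 2 x / T 1 x - 1) + T 1 (x - z0) / T 1 x <= n.+2%:R + e.
  by near: x; exact: (cvgr_le _ up _ upe).
have h2 : n.+2%:R - e <= T n.+1 x / T 1 x * F x + 1.
  by near: x; exact: (cvgr_ge _ lo _ loe).
have k1 : T n.+2 x / T 1 x <= n.+2%:R + e.
  apply: le_trans h1; rewrite ler_pdivrMr//.
  apply: le_trans (conv_tail_step_upper x z00 K1 hz0) _.
  rewrite le_eqVlt; apply/orP; left; apply/eqP; field.
  by rewrite gt_eqF.
have k2 : n.+2%:R - e <= T n.+2 x / T 1 x.
  apply: le_trans h2 _; rewrite ler_pdivlMr//.
  apply: le_trans (conv_tail_step_lower n.+1 x).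
  rewrite -conv_tail1 le_eqVlt; apply/orP; left; apply/eqP; field.
  by rewrite gt_eqF.
by rewrite distrC ler_distl k1 andbT.
Unshelve. all: by end_near. Qed.

End Limit.

End Convolution.

Section LimfEsup.
Context {R : realType}.

Lemma cvg_limf_esup_pinfty (f : R -> R) (l : R) : f x @[x --> +oo] --> l ->
  limf_esup (fun x => (f x)%:E) +oo%R = l%:E.
Proof.
move=> fl; rewrite limf_esupE; apply/eqP; rewrite eq_le; apply/andP; split.
  apply/lee_addgt0Pr => e e0.
  have : l < l + e by rewrite ltrDl.
  move/(cvgr_le _ fl) => h.
  apply: (@le_trans _ _ (ereal_sup ((fun x => (f x)%:E) @` [set x | f x <= l + e]))).
    by apply: ereal_inf_lbound; exists [set x | f x <= l + e].
  by apply: ge_ereal_sup => _ [x /= fx <-]; rewrite -EFinD lee_fin.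
apply: le_ereal_inf_tmp => _ [V FV <-].
apply/lee_addgt0Pr => e e0.
have : l - e < l by rewrite gtrBl.
move/(cvgr_ge _ fl) => h.
have [x [Vx fx]] := @filter_ex _ _ _ _ (filterI FV h).
rewrite -leeBlDr//.
apply: (@le_trans _ _ (f x)%:E); first by rewrite -EFinB lee_fin.
by apply: ereal_sup_ubound; exists x.
Qed.

Lemma limf_einf_gt (f : R -> R) (b : R) :
  (b%:E < limf_einf (fun x => (f x)%:E) +oo%R)%E ->
  exists2 c, b < c & \forall x \near +oo, c <= f x.
Proof.
rewrite /limf_einf limf_esupE lteNr -EFinN => /ereal_inf_lt[_ [V FV <-] h].
have ub x : V x -> (- (f x)%:E <= ereal_sup ((\- (fun x => (f x)%:E))%E @` V))%E.
  by move=> Vx; apply: ereal_sup_ubound; exists x.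
move: (ereal_sup _) h ub => [r| |] h ub.
- exists (- r); first by rewrite lte_fin in h; rewrite ltrNr.
  by apply: filterS FV => x /ub; rewrite -EFinN lee_fin lerNl.
- by move/ltW: h; rewrite leye_eq.
- exists (b + 1); first by rewrite ltrDl.
  by apply: filterS FV => x /ub; rewrite leeNy_eq.
Qed.

End LimfEsup.

(** * Decay of the hazard rate under the liminf condition *)

Section HazardDecay.
Context {R : realType} (H : probability (measurableTypeR R) R).
Hypothesis H1 : H `]0, +oo[ = 1%E.
Hypothesis st : forall k, steady H k.
Implicit Types (x y z a e : R) (j k n : nat).

Local Notation M := (lmoment H).
Local Notation q := (hazard H).

Lemma hazard_equiv j k : q j x / q k x @[x --> +oo] --> (1 : R).
Proof.
have base i : q i x / q 0 x @[x --> +oo] --> (1 : R).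
  elim: i => [|i IH].
    have h : (fun _ : R => 1 : R) x @[x --> +oo] --> (1 : R) by exact: cvg_cst.
    apply: cvg_trans h; apply: near_eq_cvg; near=> x.
    have x0 : 0 < x by near: x; exact: nbhs_pinfty_gt.
    by rewrite divff// gt_eqF// hazard_gt0.
  have := cvgM (st i) IH; rewrite mulr1 => h.
  apply: cvg_trans (h _); apply: near_eq_cvg; near=> x.
  have x0 : 0 < x by near: x; exact: nbhs_pinfty_gt.
  change (q i.+1 x / q i x * (q i x / q 0 x) = q i.+1 x / q 0 x).
  by rewrite mulrA divfK// gt_eqF// hazard_gt0.
have kV : (q k x / q 0 x)^-1 @[x --> +oo] --> (1 : R).
  by rewrite -[X in _ --> X]invr1; apply: cvgV; [exact: oner_neq0|exact: base].
have := cvgM (base j) kV; rewrite mulr1 => h.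
apply: cvg_trans (h _); apply: near_eq_cvg; near=> x.
have x0 : 0 < x by near: x; exact: nbhs_pinfty_gt.
change (q j x / q 0 x * (q k x / q 0 x)^-1 = q j x / q k x).
by field; rewrite !gt_eqF ?hazard_gt0.
Unshelve. all: by end_near. Qed.

(** All hazard rates q_n are equivalent, so the inequality transfers to q_0 at
    the cost of a smaller constant. *)
Lemma hazard_halving n : (exists2 c, 1 < c &
    \forall x \near +oo, c <= q n x / q n (2 * x)) ->
  exists c A, [/\ 1 < c, 0 < A & forall x, A <= x -> c * q 0 (2 * x) <= q 0 x].
Proof.
move=> [c c1 hc]; have c0 : 0 < c by exact: lt_trans c1.
have h2 := cvg_comp _ _ (cvg_mull_pinfty (ltr0n R 2)) (@hazard_equiv n 0).
have := cvgM (@hazard_equiv 0 n) h2; rewrite mulr1 => hP.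
have lt1 : (1 + c) / (2 * c) < 1 by rewrite ltr_pdivrMr ?mulr_gt0//; lra.
have := cvgr_ge _ (hP _) _ lt1 => /= hP'.
have [A [_ hA]] : \forall x \near +oo, (1 + c) / 2 * q 0 (2 * x) <= q 0 x.
  near=> x.
  have x0 : 0 < x by near: x; exact: nbhs_pinfty_gt.
  have x20 : 0 < 2 * x by rewrite mulr_gt0.
  have Px : (1 + c) / (2 * c) <= q 0 x / q n x * (q n (2 * x) / q 0 (2 * x)).
    by near: x; exact: hP'.
  have cx : c <= q n x / q n (2 * x) by near: x.
  have a1 := hazard_gt0 H1 0 x0; have a2 := hazard_gt0 H1 0 x20.
  have b1 := hazard_gt0 H1 n x0; have b2 := hazard_gt0 H1 n x20.
  have : (1 + c) / (2 * c) * c <= q 0 x / q n x * (q n (2 * x) / q 0 (2 * x)) *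
      (q n x / q n (2 * x)).
    by apply: ler_pM => //; rewrite ltW// divr_gt0 ?mulr_gt0// addr_gt0.
  have -> : (1 + c) / (2 * c) * c = (1 + c) / 2 by field; rewrite gt_eqF.
  have -> : q 0 x / q n x * (q n (2 * x) / q 0 (2 * x)) * (q n x / q n (2 * x)) =
     q 0 x / q 0 (2 * x).
    move: (q 0 x) (q n x) (q n (2 * x)) (q 0 (2 * x)) a1 b1 b2 a2 => u1 u2 u3 u4 a1 b1 b2 a2.
    by field; rewrite !gt_eqF.
  by rewrite ler_pdivlMr.
exists ((1 + c) / 2), (Num.max A 0 + 1); split.
- by rewrite ltr_pdivlMr//; lra.
- by rewrite ltr_wpDl// le_max lexx orbT.
- move=> x Ax; apply: hA; apply: lt_le_trans Ax.
  by rewrite ltr_pwDr// le_max lexx.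
Unshelve. all: by end_near. Qed.

(** The cumulative hazard of M_0, whose derivative is q_0. *)
Definition cumhazard x := - ln (M 0 x).
Local Notation Q := cumhazard.

Lemma lmomentE0 x : 0 < x -> M 0 x = expR (- Q x).
Proof. by move=> x0; rewrite /Q opprK lnK// posrE lmoment_gt0. Qed.

Lemma cumhazard_ge0 x : 0 < x -> 0 <= Q x.
Proof. by move=> x0; rewrite oppr_ge0 ln_le0// lmoment0_le1. Qed.

(** Q is concave with slope q_0. *)
Lemma cumhazard_tangent x y : 0 < x -> 0 < y -> Q y <= Q x + q 0 x * (y - x).
Proof.
move=> x0 y0; have := lmoment_tangent H1 0 x0 y0.
rewrite !lmomentE0// -expRD ler_expR.
by move: (Q x) (Q y) (q 0 x * _) => a b c; lra.
Qed.

Lemma cumhazard_nondecreasing x y : 0 < x -> x <= y -> Q x <= Q y.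
Proof.
move=> x0 xy; have y0 := lt_le_trans x0 xy.
by rewrite lerN2 ler_ln ?posrE ?lmoment_gt0// lmoment_nonincreasing.
Qed.

(** The tangent to the concave function Q at x lies above Q >= 0, so it meets the
    vertical axis at a nonnegative height. *)
Lemma cumhazard_ge x : 0 < x -> x * q 0 x <= Q x.
Proof.
move=> x0; apply/ler_addgt0Pr => e e0; have qx := hazard_gt0 H1 0 x0.
have w0 : 0 < e / q 0 x by rewrite divr_gt0.
have := cumhazard_tangent x0 w0.
have := cumhazard_ge0 w0.
have -> : q 0 x * (e / q 0 x - x) = e - x * q 0 x.
  by rewrite mulrBr mulrCA mulfV ?gt_eqF// mulr1 [x * _]mulrC.
by move: (Q x) (Q (e / _)) (x * _) => a b c; lra.
Qed.

Lemma cumhazard_pinfty : Q x @[x --> +oo] --> +oo.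
Proof.
apply/cvgryPge => B; near=> x.
have x0 : 0 < x by near: x; exact: nbhs_pinfty_gt.
have : M 0 x <= expR (- B).
  near: x; apply: (cvgr_le _ (lmoment_cvg0 H 0)); exact: expR_gt0.
by rewrite lmomentE0// ler_expR lerN2.
Unshelve. all: by end_near. Qed.

(** Concavity on the segment from 0 to x. *)
Lemma cumhazard_scale x s : 0 < x -> 0 < s -> s <= 1 -> s * Q x <= Q (s * x).
Proof.
move=> x0 s0 s1; have w0 : 0 < s * x by rewrite mulr_gt0.
have h1 := cumhazard_tangent w0 x0.
have h2 := cumhazard_ge w0.
have qw := hazard_gt0 H1 0 w0.
have h3 : s * Q x <= s * (Q (s * x) + q 0 (s * x) * (x - s * x)).
  by rewrite ler_pM2l.
apply: le_trans h3 _.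
have h4 : (1 - s) * (s * x * q 0 (s * x)) <= (1 - s) * Q (s * x).
  by rewrite ler_wpM2l// subr_ge0.
rewrite -subr_ge0 in h4; rewrite -subr_ge0.
by congr (0 <= _) : h4; ring.
Qed.

Section Halving.
Context (c A : R).
Hypothesis c1 : 1 < c.
Hypothesis A0 : 0 < A.
Hypothesis halving : forall x, A <= x -> c * q 0 (2 * x) <= q 0 x.

(** As q_0 decreases to its infimum i, halving gives c i <= i, hence i <= 0. *)
Lemma hazard_cvg0 k : q k x @[x --> +oo] --> (0 : R).
Proof.
suff h0 : q 0 x @[x --> +oo] --> (0 : R).
  have := cvgM (@hazard_equiv k 0) h0; rewrite mulr0 => h.
  apply: cvg_trans (h _); apply: near_eq_cvg; near=> x.
  have x0 : 0 < x by near: x; exact: nbhs_pinfty_gt.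
  change (q k x / q 0 x * q 0 x = q k x).
  by rewrite divfK// gt_eqF// hazard_gt0.
pose S := [set q 0 x | x in [set x | A <= x]].
have S0 : has_inf S.
  split; first by exists (q 0 A), A => //=.
  exists 0 => _ [x /= Ax <-]; rewrite ltW// hazard_gt0//.
  exact: lt_le_trans Ax.
have infle : inf S <= 0.
  have : c * inf S <= inf S.
    apply: lb_le_inf; first by case: S0.
    move=> _ [x /= Ax <-].
    apply: le_trans (halving Ax); rewrite ler_pM2l ?(lt_trans ltr01)//.
    apply: ge_inf; first by case: S0.
    have x0 := lt_le_trans A0 Ax.
    exists (2 * x) => //=; apply: (le_trans Ax).
    by rewrite ler_peMl ?ltW// ltr1n.
  have := c1; nra.
apply/cvgrPdist_le => e e0.
have [_ [y /= Ay <-] ye] : exists2 s, S s & s < e.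
  by apply: inf_lt; [case: S0|exact: le_lt_trans infle e0].
near=> x.
have yx : y <= x by near: x; apply: nbhs_pinfty_ge; exact: num_real.
have y0 := lt_le_trans A0 Ay; have x0 := lt_le_trans y0 yx.
rewrite sub0r normrN gtr0_norm ?hazard_gt0//.
by apply: le_trans (ltW ye); exact: hazard_nonincreasing.
Unshelve. all: by end_near. Qed.

(** Lower Q(y) to Q(y/2) along the chord, whose slope is at least q_0(y):
    Q(y) >= Q(y/2) + (y/2) q_0(y), and Q(y/2) >= (y/2) q_0(y/2) >= (y/2) c q_0(y). *)
Lemma cumhazard_halving y : 2 * A <= y -> (1 + c) / 2 * (y * q 0 y) <= Q y.
Proof.
move=> Ay; have y0 : 0 < y by apply: lt_le_trans Ay; rewrite mulr_gt0.
have z0 : 0 < y / 2 by rewrite divr_gt0.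
have Az : A <= y / 2 by rewrite ler_pdivlMr// mulrC.
have h1 := cumhazard_tangent y0 z0.
have h2 := cumhazard_ge z0.
have h3 := halving Az.
have e2 : 2 * (y / 2) = y by field.
rewrite e2 in h3.
have h4 : y / 2 * (c * q 0 y) <= y / 2 * q 0 (y / 2) by rewrite ler_pM2l.
move: h1 h2 h4; move: (Q y) (Q (y / 2)) (q 0 y) (q 0 (y / 2)) => a b u v; lra.
Qed.

End Halving.

End HazardDecay.

(** * Subexponentiality of the mixture *)

Lemma measurable_superlevel d (T : measurableType d) (R : realType)
    (h : T -> R) (a : R) :
  measurable_fun setT h -> measurable [set y | a < h y].
Proof.
move=> mh; have := mh measurableT `]a, +oo[%classic (measurable_itv _).
rewrite setTI; congr (measurable _).
by apply/seteqP; split => y /=; rewrite in_itv/= andbT.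
Qed.

(** Cut the values of h at the integers: e^(theta h) is at most 1 plus the sum of
    e^(theta (n+1)) over the n < h, and the integrals of these terms form a
    geometric series of ratio e^(theta - kappa). *)
Lemma integrable_expR_of_levels d (T : measurableType d) (R : realType)
    (mu : probability T R) (h : T -> R) (K kappa theta : R) :
  measurable_fun setT h -> (forall y, 0 <= h y) ->
  0 <= theta -> theta < kappa ->
  (forall n : nat, (mu [set y | n%:R < h y]%R <= (K * expR (- (kappa * n%:R)))%:E)%E) ->
  mu.-integrable setT (EFin \o (fun y => expR (theta * h y))).
Proof.
move=> mh h0 t0 tk level.
have mA (n : nat) : measurable [set y | n%:R < h y] by exact: measurable_superlevel.
have mE : measurable_fun setT (fun y => expR (theta * h y)).
  apply: measurableT_comp => //.
  by apply: measurable_realfun.measurable_funM; first exact: measurable_cst.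
pose f (n : nat) y := ((expR (theta * n.+1%:R))%:E * (\1_[set y | n%:R < h y] y)%:E)%E.
have f0 n y : (0 <= f n y)%E.
  by rewrite mule_ge0// lee_fin// expR_ge0.
have mf n : measurable_fun setT (f n).
  apply: emeasurable_funM; first exact: measurable_cst.
  by apply/measurable_EFinP; exact: measurable_indic.
have upper y : ((expR (theta * h y))%:E <= 1 + \sum_(n <oo) f n y)%E.
  have [hy|hy] := leP (h y) 0.
    have -> : h y = 0 by apply/eqP; rewrite eq_le hy h0.
    rewrite mulr0 expR0 leeDl// nneseries_ge0// => n _ _; exact: f0.
  have [n [ny hn]] : exists n : nat, n%:R < h y /\ h y <= n.+1%:R.
    have [m hm] : exists m : nat, h y <= m%:R.
      exists (Num.bound (h y)); rewrite ltW// archi_boundP// ltW.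
    elim: m hm => [|m IH] hm; first by move: hm; rewrite leNgt hy.
    by have [?|?] := leP (h y) m%:R; [exact: IH|exists m].
  apply: (@le_trans _ _ (f n y)).
    rewrite /f indicE mem_set//= mule1 lee_fin ler_expR ler_wpM2l//.
  apply: (@le_trans _ _ (\sum_(n <oo) f n y)%E); last by rewrite leeDr.
  apply: le_trans (nneseries_lim_ge n.+1 _) => [|i _ _]; last exact: f0.
  by rewrite big_nat_recr//= leeDr// sume_ge0.
apply/integrableP; split; first exact/measurable_EFinP.
apply: (@le_lt_trans _ _ (\int[mu]_y (1 + \sum_(n <oo) f n y))%E).
  apply: ge0_le_integral => //.
  - by apply: measurableT_comp => //; exact/measurable_EFinP.
  - apply: emeasurable_funD; first exact: measurable_cst.
    by apply: ge0_emeasurable_sum => // n y _ _; exact: f0.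
  - by move=> y _ /=; rewrite ger0_norm ?expR_ge0//; exact: upper.
rewrite ge0_integralD//=; last 2 first.
- by move=> y _; rewrite nneseries_ge0// => n _ _; exact: f0.
- by apply: ge0_emeasurable_sum => // n y _ _; exact: f0.
rewrite integral_cst//= probability_setT mule1 integral_nneseries//.
apply: lte_add_pinfty; first by rewrite ltry.
pose r := expR (theta - kappa); pose C := `|K| * expR theta.
have r1 : `|r| < 1 by rewrite ger0_norm ?expR_ge0// /r expR_lt1 subr_lt0.
apply: (@le_lt_trans _ _ (\sum_(n <oo) (geometric C r n)%:E)%E).
  apply: lee_nneseries => [n _ _|n _]; first by rewrite integral_ge0.
  rewrite /f ge0_integralZl_EFin ?expR_ge0//; last first.
    by apply/measurable_EFinP; exact: measurable_indic.
  rewrite integral_indic// setIT.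
  apply: (@le_trans _ _ ((expR (theta * n.+1%:R))%:E * (K * expR (- (kappa * n%:R)))%:E)%E).
    by apply: lee_wpmul2l; [rewrite lee_fin expR_ge0|exact: level].
  rewrite -EFinM lee_fin /geometric/= /C /r -expRM_natr mulrCA -mulrA -!expRD.
  rewrite (_ : theta * n.+1%:R - kappa * n%:R = theta + (theta - kappa) * n%:R).
    by rewrite ler_wpM2r ?expR_ge0 ?ler_norm.
  by rewrite -[n.+1%:R]natr1; ring.
have := @cvg_geometric_series _ C r r1 => hr.
rewrite (_ : (\sum_(n <oo) _)%E = (C / (1 - r))%:E) ?ltry//.
apply/cvg_lim => //; under eq_fun do rewrite sumEFin.
by apply: cvg_EFin => //; exact: nearW.
Qed.
Section SubexponentialTail.
Context {R : realType} (H : probability (measurableTypeR R) R).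
Hypothesis H1 : H `]0, +oo[ = 1%E.
Hypothesis st : forall k, steady H k.
Context (c A : R).
Hypothesis c1 : 1 < c.
Hypothesis A0 : 0 < A.
Hypothesis halving : forall x, A <= x -> c * hazard H 0 (2 * x) <= hazard H 0 x.
Context (F : R -> R) (d : nat) (k C : R).
Hypothesis Fnd : {homo F : x y / x <= y}.
Hypothesis Fpos : forall x, 0 < 1 - F x.
Hypothesis F1 : F x @[x --> +oo] --> (1 : R).
Hypothesis k0 : 0 < k.
Hypothesis C0 : 0 < C.
Hypothesis FC : (1 - F x) / mixterm H d k x @[x --> +oo] --> C.
Implicit Types (x y z a : R).

Local Notation phi := (mixterm H d k).
Local Notation M := (lmoment H).
Local Notation q := (hazard H).
Local Notation Q := (cumhazard H).
Local Notation T x := (1 - F x).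

(** M_d lies above its exponential tangent at k (x - y). *)
Lemma mixterm_shift x y : 0 <= y -> y < x ->
  phi (x - y) <= phi x * expR (k * y * q d (k * (x - y))).
Proof.
move=> y0 yx; have xy0 : 0 < x - y by rewrite subr_gt0.
have x0 : 0 < x by exact: le_lt_trans yx.
have h := lmoment_tangentV H1 d (mulr_gt0 k0 x0) (mulr_gt0 k0 xy0).
have e : q d (k * (x - y)) * (k * x - k * (x - y)) = k * y * q d (k * (x - y)).
  by move: (q d _) => b; ring.
rewrite e in h; rewrite /mixterm -mulrA; apply: ler_pM => //.
- by rewrite exprn_ge0// ltW.
- by rewrite ltW// lmoment_gt0// mulr_gt0.
- by apply: lerXn2r; rewrite ?nnegrE ?(ltW x0) ?(ltW xy0)// gerBl.
Qed.

Lemma cvg_addr_pinfty a : x + a @[x --> +oo] --> +oo.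
Proof.
apply/cvgryPge => B; near=> x; rewrite -lerBlDr; near: x.
by apply: nbhs_pinfty_ge; exact: num_real.
Unshelve. all: by end_near. Qed.

Let rho_ratio a : (T (x - a) / phi (x - a)) / (T x / phi x) @[x --> +oo] --> (1 : R).
Proof.
have h1 := cvg_comp _ _ (cvg_addr_pinfty (- a)) FC.
have h2 := cvgV (lt0r_neq0 C0) FC.
by have := cvgM h1 (h2 _); rewrite mulfV ?gt_eqF//; apply.
Qed.

Let long_tailed_ge0 a : 0 <= a -> T (x - a) / T x @[x --> +oo] --> (1 : R).
Proof.
move=> a0.
have e1 : k * a * q d (k * (x - a)) @[x --> +oo] --> k * a * 0.
  apply: cvgMr; apply: (cvg_comp (fun x => k * (x - a)) (q d)).
    exact: (cvg_comp _ _ (cvg_addr_pinfty (- a)) (cvg_mull_pinfty k0)).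
  exact: (hazard_cvg0 H1 st c1 A0 halving).
rewrite mulr0 in e1.
have e2 := cvg_comp _ _ e1 (@continuous_expR R 0).
rewrite expR0 in e2.
have up := cvgM (rho_ratio a) e2; rewrite mulr1 in up.
apply: (@squeeze_cvgr _ _ _ _ (fun=> 1) _ _ _ _ _ (up _)); last exact: cvg_cst.
near=> x.
have ax : a < x by near: x; apply: nbhs_pinfty_gt; exact: num_real.
have x0 : 0 < x by exact: le_lt_trans ax.
have xa0 : 0 < x - a by rewrite subr_gt0.
apply/andP; split.
  by rewrite ler_pdivlMr// mul1r lerD2l lerN2; apply: Fnd; rewrite gerBl.
change (T (x - a) / T x <= (T (x - a) / phi (x - a)) / (T x / phi x) *
  expR (k * a * q d (k * (x - a)))).
have p1 : 0 < phi x by exact: mixterm_gt0.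
have p2 : 0 < phi (x - a) by exact: mixterm_gt0.
have := mixterm_shift a0 ax.
have := Fpos x; have := Fpos (x - a).
move: (T (x - a)) (T x) (phi x) (phi (x - a)) (expR _) p1 p2 => u v w z e w0 z0 u0 v0 zw.
have -> : u / z / (v / w) * e = u / v * ((w * e) / z) by field; rewrite !gt_eqF.
by rewrite ler_peMr ?(ltW (divr_gt0 _ _))// ler_pdivlMr// mul1r.
Unshelve. all: by end_near. Qed.

(** For a >= 0 the ratio is at least 1 by monotonicity and at most
    e^(k a q_d(k (x - a))) asymptotically, where q_d tends to 0; for a < 0 exchange
    the two points. *)
Lemma tail_long_tailed a : T (x - a) / T x @[x --> +oo] --> (1 : R).
Proof.
have [a0|a0] := leP 0 a; first exact: long_tailed_ge0.
have a0' : 0 <= - a by rewrite oppr_ge0 ltW.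
have h := cvg_comp _ _ (cvg_addr_pinfty (- a)) (long_tailed_ge0 a0').
have h' := cvgV (oner_neq0 R) h; rewrite invr1 in h'.
apply: cvg_trans (h' _); apply: near_eq_cvg; apply: nearW => x.
change ((T (x - a - - a) / T (x - a))^-1 = T (x - a) / T x).
by rewrite opprK subrK invf_div.
Qed.

Let tail_sandwich : exists2 X, 0 < X &
  forall x, X <= x -> C / 2 * phi x <= T x /\ T x <= 2 * C * phi x.
Proof.
have l1 : C / 2 < C by rewrite ltr_pdivrMr// ltr_pMr// ltr1n.
have l2 : C < 2 * C by rewrite ltr_pMl// ltr1n.
have [X [_ hX]] : \forall x \near +oo, C / 2 * phi x <= T x /\ T x <= 2 * C * phi x.
  near=> x.
  have x0 : 0 < x by near: x; exact: nbhs_pinfty_gt.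
  have p0 : 0 < phi x by exact: mixterm_gt0.
  have b1 : C / 2 <= T x / phi x by near: x; exact: (cvgr_ge _ FC _ l1).
  have b2 : T x / phi x <= 2 * C by near: x; exact: (cvgr_le _ FC _ l2).
  by rewrite ler_pdivlMr// in b1; rewrite ler_pdivrMr// in b2.
exists (Num.max X 0 + 1); first by rewrite ltr_wpDl// le_max lexx orbT.
move=> x Xx; apply: hX; apply: lt_le_trans Xx.
by rewrite ltr_pwDr// le_max lexx.
Unshelve. all: by end_near. Qed.

(** A rate slightly smaller than k absorbs the degree d, and concavity of Q gives
    Q(s k y) >= s Q(k y). *)
Lemma tail_decay s : 0 < s -> s < 1 -> exists K y1, [/\ 0 < K, 0 < y1 &
  forall y, y1 <= y -> T y <= K * expR (- (s * Q (k * y)))].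
Proof.
move=> s0 s1; have [X X0 hX] := tail_sandwich.
have sk : s * k < k by rewrite gtr_pMl.
have sk0 : 0 < s * k by rewrite mulr_gt0.
exists (2 * C * (d`!%:R / (k - s * k) ^+ d)), X; split => //.
  by rewrite !mulr_gt0// ?invr_gt0 ?exprn_gt0 ?subr_gt0// ltr0n fact_gt0.
move=> y Xy; have y0 := lt_le_trans X0 Xy; have [_ hy] := hX _ Xy.
apply: (le_trans hy); rewrite -[leRHS]mulrA ler_pM2l ?mulr_gt0//.
have ml := mixterm_le H 0 d sk0 sk y0.
apply: (le_trans ml).
apply: ler_wpM2l; first by rewrite divr_ge0// exprn_ge0// subr_ge0 ltW.
have ky0 := mulr_gt0 k0 y0.
rewrite /mixterm expr0 mul1r -mulrA lmomentE0 ?mulr_gt0// ler_expR lerN2.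
by apply: cumhazard_scale => //; exact: ltW.
Qed.

(** The cut at y0 makes the function nonnegative and nondecreasing on the whole
    line, where Q itself is meaningless for y <= 0. *)
Let level y0 y := if y0 < y then Q (k * y) else 0.

Let level_ge0 y0 y : 0 < y0 -> 0 <= level y0 y.
Proof.
move=> y00; rewrite /level; case: ltP => // yy; apply: cumhazard_ge0 => //.
by rewrite mulr_gt0// (lt_trans y00).
Qed.

Let level_nondecreasing y0 : 0 < y0 -> {homo level y0 : x y / x <= y}.
Proof.
move=> y00 x y xy; rewrite {1}/level; case: ltP => xy0; last exact: level_ge0.
have x0 := lt_trans y00 xy0.
rewrite /level (lt_le_trans xy0 xy); apply: cumhazard_nondecreasing => //.
  exact: mulr_gt0.
by rewrite ler_pM2l.
Qed.

Let measurable_level y0 : 0 < y0 ->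
  measurable_fun [set: measurableTypeR R] (level y0 : measurableTypeR R -> R).
Proof. by move=> y00; exact: nondecreasing_measurable (level_nondecreasing y00). Qed.

(** For y0 < y <= x/2 the exponent k y q_d(k (x - y)) of [mixterm_shift] is at most
    k y q_d(k y), which is (1 + e) k y q_0(k y) at most, and then
    [cumhazard_halving] applies.  For y <= y0, negative values included, F being
    long-tailed suffices. *)
Lemma tail_ratio_bound e : 0 < e -> exists y1, 0 < y1 /\
  forall y0, y1 <= y0 -> exists x1, forall x y, x1 <= x -> y <= x / 2 ->
    T (x - y) <= 4 * expR ((1 + e) * (2 / (1 + c)) * level y0 y) * T x.
Proof.
move=> e0; have [X X0 hX] := tail_sandwich.
have l1 : 1 < 1 + e by rewrite ltrDl.
have [B [_ hB]] : \forall x \near +oo, q d x <= (1 + e) * q 0 x.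
  near=> x.
  have x0 : 0 < x by near: x; exact: nbhs_pinfty_gt.
  rewrite -ler_pdivrMr ?hazard_gt0//; near: x.
  exact: (cvgr_le _ (@hazard_equiv _ _ H1 st d 0) _ l1).
have A20 : 0 < 2 * A by rewrite mulr_gt0.
exists (Num.max (2 * A) (B + 1) / k).
have m0 : 0 < Num.max (2 * A) (B + 1) by rewrite lt_max A20.
split; first by rewrite divr_gt0.
move=> y0; rewrite ler_pdivrMr// ge_max [y0 * k]mulrC => /andP[ky0A ky0B].
have y00 : 0 < y0 by rewrite -(pmulr_rgt0 _ k0) (lt_le_trans A20).
have [X2 [_ hX2]] : \forall x \near +oo, T (x - y0) / T x <= 4.
  apply: (cvgr_le _ (tail_long_tailed y0)); rewrite ltr1n//.
exists (Num.max (2 * X) (X2 + 1)) => x y; rewrite ge_max => /andP[xX xX2] yx.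
rewrite /level; case: (ltP y0 y) => [y0y|yy0]; last first.
  rewrite mulr0 expR0 mulr1.
  have : T (x - y0) / T x <= 4 by apply: hX2; rewrite (lt_le_trans _ xX2)// ltrDl.
  rewrite ler_pdivrMr//; apply: le_trans.
  by rewrite lerD2l lerN2; apply: Fnd; rewrite lerB.
have y_gt0 := lt_trans y00 y0y.
have yxy : y <= x - y by move: yx; rewrite ler_pdivlMr// => h; lra.
have Xxy : X <= x - y by move: yx xX; rewrite ler_pdivlMr// => h h2; lra.
have yltx : y < x by rewrite -subr_gt0 (lt_le_trans X0).
have Xx : X <= x by rewrite (le_trans Xxy)// gerBl ltW.
have [_ u1] := hX _ Xxy; have [u2 _] := hX _ Xx.
have ms := mixterm_shift (ltW y_gt0) yltx.
have ky : k * y0 <= k * y by rewrite ler_pM2l// ltW.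
have kxy : k * y <= k * (x - y) by rewrite ler_pM2l.
have ky_gt0 : 0 < k * y by rewrite mulr_gt0.
have qb : k * y * q d (k * (x - y)) <= (1 + e) * (2 / (1 + c)) * Q (k * y).
  have h1 : q d (k * (x - y)) <= (1 + e) * q 0 (k * y).
    apply: (@le_trans _ _ ((1 + e) * q 0 (k * (x - y)))).
      apply: hB; apply: lt_le_trans kxy; apply: lt_le_trans ky.
      by apply: lt_le_trans ky0B; rewrite ltrDl.
    by rewrite ler_pM2l ?addr_gt0//; exact: hazard_nonincreasing.
  have h2 := cumhazard_halving H1 A0 halving (le_trans ky0A ky).
  have h3 : k * y * q 0 (k * y) <= 2 / (1 + c) * Q (k * y).
    have c10 : 0 < 1 + c by rewrite addr_gt0// (lt_trans _ c1).
    rewrite [leRHS]mulrAC ler_pdivlMr//.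
    move: h2; move: (k * y * q 0 _) (Q (k * y)) => a b; lra.
  apply: (@le_trans _ _ (k * y * ((1 + e) * q 0 (k * y)))).
    by rewrite ler_pM2l.
  by rewrite mulrCA -[leRHS]mulrA ler_pM2l ?addr_gt0.
have Eb : expR (k * y * q d (k * (x - y))) <= expR ((1 + e) * (2 / (1 + c)) * Q (k * y)).
  by rewrite ler_expR.
move: (expR (k * y * _)) (expR _) (expR_gt0 ((1 + e) * (2 / (1 + c)) * Q (k * y))) Eb ms => E1 E2 E20 Eb ms.
apply: (le_trans u1).
apply: (@le_trans _ _ (2 * C * (phi x * E2))).
  rewrite ler_pM2l ?mulr_gt0//; apply: (le_trans ms).
  by rewrite ler_pM2l// mixterm_gt0// (lt_trans y_gt0).
rewrite (_ : 2 * C * _ = 4 * E2 * (C / 2 * phi x)); last by field.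
by rewrite ler_pM2l ?mulr_gt0.
Unshelve. all: by end_near. Qed.

Context (mu : probability (measurableTypeR R) R).
Hypothesis muF : forall x, mu `]-oo, x] = (F x)%:E.
Hypothesis mu0 : mu `]-oo, 0[ = 0%E.

Let continuous_cumhazard_scaled x : 0 < x -> {for x, continuous (fun y => Q (k * y))}.
Proof.
move=> x0; have kx := mulr_gt0 k0 x0.
have h : k * y @[y --> x] --> k * x by apply: cvgMr; exact: cvg_id.
have h2 := continuous_ln (lmoment_gt0 H1 0 kx).
have hM : M 0 (k * y) @[y --> x] --> M 0 (k * x).
  exact: (cvg_comp _ _ h (continuous_lmoment H1 (k := 0) kx)).
have hQ := cvg_comp _ _ hM h2.
exact: (cvgN hQ).
Qed.

(** By continuity Q(k Y) = n for some Y, if n is large, and then Q(k y) > n forces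
    y > Y, an event whose probability is bounded by [tail_decay]. *)
Lemma level_measure s : 0 < s -> s < 1 -> exists y1, 0 < y1 /\
  forall y0, y1 <= y0 -> exists K, forall n : nat,
    (mu [set y | n%:R < level y0 y]%R <= (K * expR (- (s * n%:R)))%:E)%E.
Proof.
move=> s0 s1; have [K [y1 [K0 y10 hK]]] := tail_decay s0 s1.
exists y1; split => // y0 y1y0; have y00 := lt_le_trans y10 y1y0.
have ky00 := mulr_gt0 k0 y00.
exists (K + expR (s * Q (k * y0))) => n.
have mL : measurable ([set y | n%:R < level y0 y]%R : set (measurableTypeR R)).
  exact: (measurable_superlevel _ (measurable_level y00)).
have [nQ|Qn] := ltP n%:R (Q (k * y0)).
  apply: le_trans (probability_le1 mu mL) _.
  rewrite lee_fin mulrDl -expRD; apply: (@le_trans _ _ (0 + expR 0)).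
    by rewrite expR0 add0r.
  rewrite lerD ?mulr_ge0 ?expR_ge0 ?(ltW K0)// ler_expR.
  by rewrite -mulrBr mulr_ge0 ?(ltW s0)// subr_ge0 ltW.
have [B [B0 hB]] : exists B, y0 <= B /\ n%:R <= Q (k * B).
  have := cvg_comp _ _ (cvg_mull_pinfty k0) (cumhazard_pinfty H1).
  move/cvgryPge => /(_ n%:R) [B [_ hB]]; exists (Num.max y0 (B + 1)).
  by rewrite le_max lexx; split => //; apply: hB; rewrite lt_max ltrDl ltr01 orbT.
have : exists2 y, y \in `[y0, B]%R & Q (k * y) = n%:R.
  apply: IVT => //.
    apply: continuous_in_subspaceT => y; rewrite inE/= in_itv/= => /andP[y0y _].
    by apply: continuous_cumhazard_scaled; exact: lt_le_trans y0y.
  move: hB Qn; move: (Q _) (Q _) => u v vn nu.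
  by rewrite ge_min le_max nu vn orbT.
move=> [Y]; rewrite in_itv/= => /andP[y0Y _] QY.
have Y0 := lt_le_trans y00 y0Y.
apply: (@le_trans _ _ (mu `]Y, +oo[)).
  apply: le_measure; rewrite ?inE// => y /=; rewrite in_itv/= andbT.
  rewrite /level; have [y0y ny|_] := @ltP _ R y0 y; last by rewrite ltNge ler0n.
  rewrite ltNge; apply/negP => yY; move: ny; rewrite -QY ltNge => /negP; apply.
  by apply: cumhazard_nondecreasing; rewrite ?mulr_gt0 ?ler_pM2l// (lt_trans y00).
rewrite (cdf_tail muF) lee_fin; apply: le_trans (hK Y (le_trans y1y0 y0Y)) _.
by rewrite QY ler_pM2r ?expR_gt0// lerDl expR_ge0.
Qed.

(** With a = 2/(1 + c) < 1 the exponents are theta = (1 + e) a and s = 1 - e, where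
    e = (1 - a)/4 is small enough for theta < s.  Then e^(theta Q(k y)) is an
    integrable bound, and the square of the tail at x/2 is at most
    e^(-(s - theta) Q(k x/2)) times the tail at x, up to a constant. *)
Lemma mixture_conv_tail_cvg n : (1 <= n)%N ->
  conv_tail mu n x / conv_tail mu 1 x @[x --> +oo] --> (n%:R : R).
Proof.
pose a := 2 / (1 + c); pose e := (1 - a) / 4; pose theta := (1 + e) * a; pose s := 1 - e.
have c10 : 0 < 1 + c by rewrite addr_gt0// (lt_trans _ c1).
have a0 : 0 < a by rewrite divr_gt0.
have a1 : a < 1 by rewrite ltr_pdivrMr// mul1r -[2]/(1 + 1) ltrD2l.
have e0 : 0 < e by rewrite divr_gt0// subr_gt0.
have e1 : e < 1 by rewrite /e ltr_pdivrMr//; lra.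
have s0 : 0 < s by rewrite subr_gt0.
have s1 : s < 1 by rewrite gtrBl.
have t0 : 0 < theta by rewrite mulr_gt0// addr_gt0.
have ts : theta < s.
  have : 0 < (1 - a) * (1 - (1 + a) / 4) by rewrite mulr_gt0 ?subr_gt0// ltr_pdivrMr//; lra.
  rewrite -[theta < s]subr_gt0 (_ : s - theta = (1 - a) * (1 - (1 + a) / 4))//.
  by rewrite /s /theta /e; field.
have [K [b1 [K0 b10 hK]]] := tail_decay s0 s1.
have [b2 [b20 hb2]] := tail_ratio_bound e0.
have [b3 [b30 hb3]] := level_measure s0 s1.
pose y0 := Num.max b1 (Num.max b2 b3).
have y01 : b1 <= y0 by rewrite le_max lexx.
have y02 : b2 <= y0 by rewrite !le_max lexx orbT.
have y03 : b3 <= y0 by rewrite !le_max lexx !orbT.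
have y00 : 0 < y0 by rewrite lt_max b10.
have [x1 dom] := hb2 _ y02; have [L hL] := hb3 _ y03.
pose g y := 4 * expR (theta * level y0 y).
have g0 y : 0 <= g y by rewrite mulr_ge0// expR_ge0.
have ig : mu.-integrable setT (EFin \o g).
  apply: integrable_EFinZl => //.
  apply: (integrable_expR_of_levels _ _ (ltW t0) ts hL) => //.
    exact: measurable_level.
  by move=> y; exact: level_ge0.
apply: (conv_tail_cvg muF mu0 Fpos F1 tail_long_tailed _ g0 ig dom).
have up : K * 4 * expR (- ((s - theta) * Q (k * (x / 2)))) @[x --> +oo] --> (0 : R).
  rewrite -(mulr0 (K * 4)); apply: cvgMr.
  apply: (cvg_comp (fun x => (s - theta) * Q (k * (x / 2))) (fun z => expR (- z))).
    apply: (cvg_comp (fun x => Q (k * (x / 2))) (fun z => (s - theta) * z)).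
      apply: (cvg_comp (fun x => k * (x / 2)) Q); last exact: cumhazard_pinfty.
      apply: (cvg_comp (fun x => x / 2) (fun z => k * z)); last exact: cvg_mull_pinfty.
      under eq_fun do rewrite mulrC; apply: cvg_mull_pinfty; by rewrite invr_gt0.
    by apply: cvg_mull_pinfty; rewrite subr_gt0.
  exact: cvgr_expR.
apply: (@squeeze_cvgr _ _ _ _ (fun=> 0) _ _ _ _ _ up); last exact: cvg_cst.
near=> x.
have xb : 2 * y0 < x by near: x; apply: nbhs_pinfty_gt; exact: num_real.
have yx : y0 < x / 2 by rewrite ltr_pdivlMr// mulrC.
have xx1 : x1 <= x by near: x; apply: nbhs_pinfty_ge; exact: num_real.
rewrite divr_ge0 ?sqr_ge0 ?(ltW (Fpos _))//=.
rewrite ler_pdivrMr//.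
have h1 := dom x (x / 2) xx1 (lexx _).
have h2 := hK (x / 2) (le_trans y01 (ltW yx)).
have xE : x - x / 2 = x / 2 by field.
rewrite xE /level yx in h1.
apply: (@le_trans _ _ (T (x / 2) * (4 * expR (theta * Q (k * (x / 2))) * T x))).
  by rewrite expr2 ler_pM2l.
rewrite mulrA ler_pM2r//.
rewrite [(s - theta) * _]mulrBl opprB expRD.
move: (expR _) (expR_gt0 (theta * Q (k * (x / 2)))) h2 => E1 E10.
move: (expR _) => E2 h2.
rewrite (_ : K * 4 * (E1 * E2) = K * E2 * (4 * E1)); last by ring.
by rewrite ler_pM2r// mulr_gt0.
Unshelve. all: by end_near. Qed.

End SubexponentialTail.

(** * From the hypotheses on V to the theorem *)

Section Transform.
Context {R : realType} (H : probability (measurableTypeR R) R).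
Hypothesis H1 : H `]0, +oo[ = 1%E.
Implicit Types (x : R) (n : nat).

Lemma derive1_near (f g : R -> R) x : 0 < x ->
  (forall y, 0 < y -> f y = g y) -> derive1 f x = derive1 g x.
Proof.
move=> x0 fg; rewrite !derive1E; apply: near_eq_derive.
near=> y; apply: fg; near: y; exact: lt_nbhsr.
Unshelve. all: by end_near. Qed.

Lemma derive1_lmoment n x : 0 < x -> derive1 (lmoment H n) x = - lmoment H n.+1 x.
Proof. by move=> x0; rewrite derive1E; have [_ ->] := is_derive_lmoment H1 n x0. Qed.

Lemma derive1n_laplace n x : 0 < x ->
  derive1n n (laplace_inv H) x = (-1) ^+ n * lmoment H n x.
Proof.
elim: n x => [|n IH] x x0; first by rewrite derive1n0 lmoment_laplace expr0 mul1r.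
rewrite derive1nS (derive1_near x0 IH) derive1E.
have h := is_deriveZ ((-1) ^+ n) (is_derive_lmoment H1 n x0).
have [_ e] := h.
rewrite (_ : (fun y => _) = (-1) ^+ n \*: lmoment H n)// e.
by rewrite /GRing.scale/= exprS mulN1r mulrN mulNr.
Qed.

Let V n x := (-1) ^+ n * derive1n n (laplace_inv H) x.

Lemma signed_derive_laplace n x : 0 < x -> V n x = lmoment H n x.
Proof.
move=> x0; rewrite /V derive1n_laplace// mulrA -exprD addnn -muln2 mulnC exprM.
by rewrite sqrrN expr1n expr1n mul1r.
Qed.

Lemma derive1_signed n x : 0 < x -> derive1 (V n) x = - lmoment H n.+1 x.
Proof.
move=> x0; rewrite (derive1_near x0 (signed_derive_laplace n)).
exact: derive1_lmoment.
Qed.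

Lemma derive2_signed n x : 0 < x -> derive1n 2 (V n) x = lmoment H n.+2 x.
Proof.
move=> x0; rewrite derive1nS derive1n1 (derive1_near x0 (@derive1_signed n)) derive1E.
by have [_ ->] := is_deriveN (is_derive_lmoment H1 n.+1 x0); rewrite opprK.
Qed.

(** V V'' / V'^2 is M_n M_(n+2) / M_(n+1)^2. *)
Lemma von_mises_steady n : von_mises (V n) -> steady H n.
Proof.
move=> [_ vm]; rewrite /steady -[1]opprK; have h := cvgN vm.
apply: cvg_trans (h _); apply: near_eq_cvg; near=> x.
have x0 : 0 < x by near: x; exact: nbhs_pinfty_gt.
change (- (V n x * - derive1n 2 (V n) x / (- derive1 (V n) x) ^+ 2) =
  hazard H n.+1 x / hazard H n x).
rewrite signed_derive_laplace// derive1_signed// derive2_signed// /hazard.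
have p0 := lmoment_gt0 H1 n x0; have p1 := lmoment_gt0 H1 n.+1 x0.
move: (lmoment H n x) (lmoment H n.+1 x) (lmoment H n.+2 x) p0 p1 => u v w u0 v0.
by field; rewrite !gt_eqF.
Unshelve. all: by end_near. Qed.

(** At t = 2 the quotient is q_n(x) / q_n(2 x). *)
Lemma liminf_halving n :
  (forall t, 1 < t -> (1 < limf_einf (fun x : R =>
     ((V n (t * x) * derive1 (V n) x) / (derive1 (V n) (t * x) * V n x))%:E) +oo%R)%E) ->
  exists2 c, 1 < c & \forall x \near +oo, c <= hazard H n x / hazard H n (2 * x).
Proof.
have h12 : 1 < 2 :> R by rewrite ltr1n.
move=> /(_ 2 h12) /limf_einf_gt[c c1 hc]; exists c => //.
near=> x; have x0 : 0 < x by near: x; exact: nbhs_pinfty_gt.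
have : c <= V n (2 * x) * derive1 (V n) x / (derive1 (V n) (2 * x) * V n x).
  by near: x.
have x20 : 0 < 2 * x by rewrite mulr_gt0.
rewrite !signed_derive_laplace// !derive1_signed// /hazard.
have p0 := lmoment_gt0 H1 n x0; have p1 := lmoment_gt0 H1 n.+1 x0.
have r0 := lmoment_gt0 H1 n x20; have r1 := lmoment_gt0 H1 n.+1 x20.
move: (lmoment H n x) (lmoment H n.+1 x) (lmoment H n (2 * x)) (lmoment H n.+1 (2 * x))
  p0 p1 r0 r1.
move=> u v w z u0 v0 w0 z0.
rewrite (_ : v / u / (z / w) = w * - v / (- z * u))//.
by field; rewrite !gt_eqF.
Unshelve. all: by end_near. Qed.

End Transform.

Section Law.
Context {R : realType}.

(** The Lebesgue-Stieltjes measure of F. *)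
Lemma law_of_cdf (F : R -> R) : {homo F : x y / x <= y} -> right_continuous F ->
  F x @[x --> -oo] --> (0 : R) -> F x @[x --> +oo] --> (1 : R) ->
  exists mu : probability (measurableTypeR R) R, forall x, mu `]-oo, x] = (F x)%:E.
Proof.
move=> Fnd Frc FNy Fy.
pose f1 := isCumulative.Build R _ R F Fnd Frc.
pose f2 := isCumulativeBounded.Build R 0 1 F FNy Fy.
pose f : cumulativeBounded (0 : R) (1 : R) := HB.pack F f1 f2.
exists (lebesgue_stieltjes_measure f) => x.
exact: (cdf_lebesgue_stieltjes_id f x).
Qed.

Lemma law_nonneg (F : R -> R) (mu : probability (measurableTypeR R) R) :
  (forall x, mu `]-oo, x] = (F x)%:E) -> (forall x, x < 0 -> F x = 0) ->
  mu `]-oo, 0[ = 0%E.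
Proof.
move=> muF F0; have -> : (`]-oo, 0[%classic : set (measurableTypeR R)) =
    \bigcup_n `]-oo, - n.+1%:R^-1].
  apply/seteqP; split => x /=; rewrite ?in_itv/=.
    move=> x0; have xn : 0 < - x by rewrite oppr_gt0.
    exists (Num.bound (- x)^-1) => //=; rewrite in_itv/= lerNr.
    rewrite -[leRHS]invrK lef_pV2 ?posrE ?invr_gt0//.
    rewrite (le_trans (ltW (archi_boundP _)))// ?invr_ge0 ?(ltW xn)//.
    by rewrite ler_nat.
  by move=> [n _] /=; rewrite in_itv/= => /le_lt_trans; apply; rewrite oppr_lt0 invr_gt0.
apply/negligibleP; first by apply: bigcup_measurable => n _.
apply: negligible_bigcup => n; apply/negligibleP => //.
apply: (etrans (muF _)).
by rewrite F0// oppr_lt0 invr_gt0.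
Qed.

End Law.

Theorem theorem3p6 (R : realType) (p : nat) (beta : 'rV[R]_p) (L : 'M[R]_p)
    (H : probability (measurableTypeR R) R) (lambda : R) (eta : nat)
    (hbeta : initial_probabilities beta)
    (hL : subintensity_matrix L)
    (hreal : only_real_eigenvalues L)
    (hH : scaling_distribution H)
    (hlambda : largest_eigenvalue L (- lambda))
    (heta : max_jordan_dim L (- lambda) eta) :
  let F : R -> R := scale_mixture (phase_type_cdf beta L) H in
  let V : R -> R :=
    fun x => (-1) ^+ eta.-1 * derive1n eta.-1 (laplace_inv H) x in
  von_mises V ->
  gumbel_mda F /\
  ((forall t : R, 1 < t ->
      (1 < limf_einf (fun x : R =>
             ((V (t * x) * derive1 V x) / (derive1 V (t * x) * V x))%:E) +oo%R)%E) ->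
   subexponential F).
Proof.
move=> F V vmV.
have H1 := scaling_support hH.
have st k : steady H k := steady_all H1 k (von_mises_steady H1 vmV).
have [r [ev [k [jf _]]]] := heta.
have [m [D [l [c [l0 GE gmono g01 [c0 [c1 [c00 c10 glow]]]]]]]] :=
  phase_type_tail hbeta hL jf.
have G0 y : y < 0 -> phase_type_cdf beta L y = 0 by rewrite /phase_type_cdf => ->.
have Fnd : {homo F : x y / x <= y}
  by move=> x y; apply: (mixture_nondecreasing H G0 GE gmono g01 c00 glow).
have Fpos x : 0 < 1 - F x
  by exact: (mixture_tail_gt0 hH G0 GE gmono g01 c00 c10 glow).
have Fcont x : 0 < x -> {for x, continuous F}
  by move=> x0; exact: (mixture_continuous hH l0 G0 GE gmono g01 c00 glow x0).
have F1 : F x @[x --> +oo] --> (1 : R)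
  by exact: (mixture_cvg_pinfty hH l0 G0 GE gmono g01 c00 glow).
have FN : F x @[x --> -oo] --> (0 : R) by exact: (mixture_cvg_ninfty H G0).
have Frc : right_continuous F
  by move=> x; exact: (mixture_right_continuous G0 GE gmono g01 c00 glow).
have F0 x : x < 0 -> F x = 0 by exact: (mixture_lt0 H G0).
have [d [b [C [b0 C0 FC]]]] : exists d (b C : R), [/\ 0 < b, 0 < C &
    (1 - F x) / mixterm H d b x @[x --> +oo] --> C].
  exact: (mixture_dominant hH l0 G0 GE gmono g01 c00 c10 glow st).
split; first exact: (mixture_gumbel H1 st Fnd Fpos Fcont F1 b0 C0 FC).
move=> /(liminf_halving H1) /(hazard_halving H1 st)[c' [A [c'1 A0 halving]]].
have [mu muF] := law_of_cdf Fnd Frc FN F1.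
have mu0 := law_nonneg muF F0.
exists mu; split => // n n2.
have n1 := ltnW n2.
have := mixture_conv_tail_cvg H1 st c'1 A0 halving Fnd Fpos F1 b0 C0 FC muF mu0 n1.
move=> /cvg_limf_esup_pinfty <-; congr limf_esup; apply/funext => x.
by rewrite (conv_tail1 muF mu0).
Qed.
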